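(* Let $n\ge 1$ and let $Y_1,Y_2,\ldots,Y_k$ be a balanced set (with repetitions allowed) of oriented $(n-1)$-dimensional combinatorial spheres. Then there is an oriented cubic cell combinatorial manifold $X$ (of dimension $n$) whose set (with repetitions) of links of vertices coincides, up to orientation-preserving isomorphism, with the set $$\underbrace{Y_1',\ldots,Y_1'}_{r},\underbrace{Y_2',\ldots,Y_2'}_{r},\ldots,\underbrace{Y_k',\ldots,Y_k'}_{r}$$ for some positive integer $r$, where $Y_i'$ is the first barycentric subdivision of $Y_i$.
   Context: All complexes are finite. A combinatorial sphere is a simplicial complex piecewise-linearly homeomorphic to the boundary of a simplex. An isomorphism of oriented complexes preserves orientation; an anti-isomorphism reverses it. The link of an oriented cell $\sigma$ is oriented so that $\sigma*\mathrm{link}\,\sigma$ has the given orientation of the complex. A set (with repetitions) $Y_1,\ldots,Y_k$ of oriented combinatorial spheres of the same dimension is balanced if the vertices of $Y_1\sqcup\cdots\sqcup Y_k$ can be paired off so that the links of the two vertices of each pair are anti-isomorphic. (Degenerate case: an oriented $0$-sphere is a pair of points of opposite signs, the link of a signed point is the empty set with that sign, and empty sets of opposite signs are anti-isomorphic.) A cubic cell complex is the quotient of a disjoint union of finitely many closed cubes by an equivalence relation $\sim$ such that (1) $\sim$ does not identify two distinct points of the same cube; (2) if $\sim$ identifies a point $x_1$ of one cube with a point $x_2$ of another, then $\sim$ identifies some face of the first cube containing $x_1$ with some face of the second cube containing $x_2$ along a linear homeomorphism. (Thus two cubes may meet in several common faces.) Images of faces of the cubes are the cells. A simplicial cell complex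 is defined in the same way with simplices instead of cubes. The link of a vertex $x$ of a cubic cell complex $X$ is the simplicial cell complex that is the union of simplices $\Delta_{x,\tau}$, over cells $\tau\ni x$, $\tau\neq x$, where $\Delta_{x,\tau}$ is the convex hull in $\tau$ of the midpoints of the edges of $\tau$ containing $x$. An $n$-dimensional cubic cell combinatorial manifold is a cubic cell complex such that the link of each vertex is piecewise-linearly homeomorphic to the boundary of an $n$-simplex. (It need not be connected.) *)

(* Defs.v *)
From mathcomp Require Import all_boot all_order all_algebra.
Set Implicit Arguments.
Unset Strict Implicit.
Unset Printing Implicit Defensive.
Import Order.TTheory GRing.Theory Num.Theory.
Local Open Scope ring_scope.

(* Every point of [vert] is a vertex, and the empty face is included. *)
Record scomplex := SComplex {
  vert : finType;
  face : {set {set vert}};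
  face0 : set0 \in face;
  face1 : forall v : vert, [set v] \in face;
  face_sub : forall s t : {set vert}, t \subset s -> s \in face -> t \in face }.

(* [s] is an ordering of the vertices of a maximal face. *)
Definition facet_list (K : scomplex) (s : seq (vert K)) : bool :=
  uniq s && maxset (fun t => t \in face K) [set x in s].

(* An orientation is a sign attached to each ordered facet; the sign is a bool,
   and its values on lists that are not orderings of a facet are irrelevant.
   The sign is alternating, and facets with a common codimension 1 face induce
   opposite orientations on it.  For a 0-sphere the second clause says that the
   two points have opposite signs; for the complex whose only face is empty, an
   orientation is the sign of the empty list. *)
Definition orientation (K : scomplex) (o : seq (vert K) -> bool) : Prop :=
  (forall s1 a b s2, facet_list (s1 ++ a :: b :: s2) ->
     o (s1 ++ b :: a :: s2) = ~~ o (s1 ++ a :: b :: s2)) /\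
  (forall a b s, a != b -> facet_list (a :: s) -> facet_list (b :: s) ->
     o (b :: s) = ~~ o (a :: s)).

Section Link.
Variables (K : scomplex) (v : vert K).

Definition link_vert : finType :=
  {w : vert K | (w != v) && ([set v; w] \in face K)}.

Definition link_face : {set {set link_vert}} :=
  [set s : {set link_vert} | v |: [set val w | w in s] \in face K].

Lemma link_face0 : set0 \in link_face.
Proof. by rewrite inE imset0 setU0 face1. Qed.

Lemma link_face1 (w : link_vert) : [set w] \in link_face.
Proof. by rewrite inE imset_set1; case/andP: (valP w). Qed.

Lemma link_face_sub (s t : {set link_vert}) :
  t \subset s -> s \in link_face -> t \in link_face.
Proof. by move=> ts; rewrite !inE; apply/face_sub/setUS/imsetS. Qed.

Definition link : scomplex := SComplex link_face0 link_face1 link_face_sub.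

Definition link_sgn (o : seq (vert K) -> bool) (s : seq (vert link)) : bool :=
  o (v :: [seq val w | w : link_vert <- s]).
End Link.

Definition isomorphism (K L : scomplex) (f : vert K -> vert L) : Prop :=
  bijective f /\ forall s : {set vert K}, (f @: s \in face L) = (s \in face K).

Definition anti_isomorphic (K : scomplex) (oK : seq (vert K) -> bool)
    (L : scomplex) (oL : seq (vert L) -> bool) : Prop :=
  exists f : vert K -> vert L, isomorphism f /\
    forall s, facet_list s -> oL (map f s) = ~~ oK s.

(* The pairing is a fixed point free involution of the disjoint union of the
   vertex sets. *)
Definition balanced (k : nat) (Y : 'I_k -> scomplex)
    (o : forall i, seq (vert (Y i)) -> bool) : Prop :=
  exists mu : {i : 'I_k & vert (Y i)} -> {i : 'I_k & vert (Y i)},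
    [/\ involutive mu, forall p, mu p != p &
      forall p, anti_isomorphic (link_sgn (v := tagged p) (o (tag p)))
                                (link_sgn (v := tagged (mu p)) (o (tag (mu p))))].

Section Barycentric.
Variable K : scomplex.

Definition sd_vert : finType := {s : {set vert K} | (s \in face K) && (s != set0)}.

Definition sd_face : {set {set sd_vert}} :=
  [set c : {set sd_vert} | [forall a in c, forall b in c,
     (val a \subset val b) || (val b \subset val a)]].

Lemma sd_faceP (c : {set sd_vert}) :
  reflect {in c &, forall a b : sd_vert, (val a \subset val b) || (val b \subset val a)}
          (c \in sd_face).
Proof.
rewrite inE; apply: (iffP forall_inP) => [h a b ac bc|h a ac].
  by move/forall_inP: (h a ac); apply.
by apply/forall_inP => b bc; apply: h.
Qed.

Lemma sd_face0 : set0 \in sd_face.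
Proof. by apply/sd_faceP => a b; rewrite inE. Qed.

Lemma sd_face1 (a : sd_vert) : [set a] \in sd_face.
Proof. by apply/sd_faceP => b c /set1P-> /set1P->; rewrite subxx. Qed.

Lemma sd_face_sub (s t : {set sd_vert}) :
  t \subset s -> s \in sd_face -> t \in sd_face.
Proof.
move=> /subsetP ts /sd_faceP h; apply/sd_faceP => a b /ts ? /ts ?; exact: h.
Qed.

Definition sd : scomplex := SComplex sd_face0 sd_face1 sd_face_sub.

(* {t_0}, {t_0, t_1}, {t_0, t_1, t_2}, ... *)
Definition flag (t : seq (vert K)) : seq {set vert K} :=
  [seq [set x in take m.+1 t] | m <- iota 0 (size t)].

Fixpoint inv_parity (s : seq nat) : bool :=
  if s is a :: s' then odd (count (fun b => (b < a)%N) s') (+) inv_parity s'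
  else false.

(* The simplex spanned by the barycenters of the members of [flag t], in this
   order, has the same orientation as the simplex t_0, t_1, ... (the transition
   matrix is triangular with positive diagonal).  An ordering [s] of a facet of
   the subdivision is a permutation of [flag t] for exactly one [t], and the
   parity of that permutation is the parity of the number of inversions of the
   cardinalities in [s]. *)
Definition sd_sgn (o : seq (vert K) -> bool) (s : seq (vert sd)) : bool :=
  [exists t : (size s).-tuple (vert K),
    perm_eq [seq val a | a : sd_vert <- s] (flag t) &&
    (o t (+) inv_parity [seq #|val a| | a : sd_vert <- s])].
End Barycentric.

From mathcomp Require Import classical_sets functions reals.

(* The quotient of the disjoint union of finitely many compact polyhedra
   [body i], each in its own R^(crd i), by the relation [glue], which is only
   meaningful on points of the bodies. *)
Record space (R : realType) := Space {
  part : finType;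
  crd : part -> finType;
  body : forall i, set {ffun crd i -> R};
  glue : {i : part & {ffun crd i -> R}} -> {i : part & {ffun crd i -> R}} -> Prop }.

Definition pt (R : realType) (S : space R) := {i : part S & {ffun crd i -> R}}.

Definition in_space (R : realType) (S : space R) (p : pt S) : Prop :=
  body (tagged p).

Definition bary (R : realType) (E : finType) (t : R) (x y : {ffun E -> R}) :
    {ffun E -> R} :=
  [ffun e => t * x e + (1 - t) * y e].

Definition affine (R : realType) (E F : finType)
    (A : {ffun E -> R} -> {ffun F -> R}) : Prop :=
  forall t x y, A (bary t x y) = bary t (A x) (A y).

(* An intersection of finitely many closed half-spaces  <h.1, x> <= h.2. *)
Definition polyhedron (R : realType) (E : finType)
    (P : seq ({ffun E -> R} * R)) : set {ffun E -> R} :=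
  [set x | forall h, h \in P -> \sum_e h.1 e * x e <= h.2]%classic.

(* Every body is covered by finitely many closed convex polyhedra on each of
   which the map is given by an affine map into one body of the target; such a
   map is automatically continuous. *)
Definition PL_map (R : realType) (S T : space R) (f : pt S -> pt T) : Prop :=
  [/\ forall p, in_space p -> in_space (f p),
      forall p q, in_space p -> in_space q -> glue p q -> glue (f p) (f q) &
      forall i : part S, exists D : seq (seq ({ffun crd i -> R} * R)),
        (forall x, body x -> exists2 P, P \in D & polyhedron P x) /\
        (forall P, P \in D ->
           exists (j : part T) (A : {ffun crd i -> R} -> {ffun crd j -> R}),
             affine A /\
             forall x, body x -> polyhedron P x ->
               body (A x) /\
               glue (f (Tagged (fun i => {ffun crd i -> R}) x))
                    (Tagged (fun j => {ffun crd j -> R}) (A x)))].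

Definition PL_homeomorphic (R : realType) (S T : space R) : Prop :=
  exists (f : pt S -> pt T) (g : pt T -> pt S),
    [/\ PL_map f, PL_map g,
        forall p, in_space p -> glue (g (f p)) p &
        forall q, in_space q -> glue (f (g q)) q].

Definition simplex (R : realType) (E : finType) : set {ffun E -> R} :=
  [set x | (forall e, 0 <= x e) /\ \sum_e x e = 1]%classic.

Definition realization (R : realType) (K : scomplex) : set {ffun vert K -> R} :=
  [set x | simplex x /\ [set v | x v != 0]%SET \in face K]%classic.
Arguments realization : clear implicits.

Definition single (R : realType) (E : finType) (B : set {ffun E -> R}) : space R :=
  @Space R unit (fun=> E) (fun=> B) eq.

(* The boundary of the standard n-simplex in R^(n+1). *)
Definition simplex_boundary (R : realType) (n : nat) : set {ffun 'I_n.+1 -> R} :=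
  [set x | simplex x /\ exists e, x e = 0]%classic.
Arguments simplex_boundary : clear implicits.

(* A combinatorial sphere of dimension n - 1 (for n >= 1). *)
Definition combinatorial_sphere (R : realType) (n : nat) (K : scomplex) : Prop :=
  PL_homeomorphic (single (realization R K)) (single (simplex_boundary R n)).

Definition cube (R : realType) (d : nat) : set {ffun 'I_d -> R} :=
  [set x | forall e, 0 <= x e <= 1]%classic.

Definition cube_face (R : realType) (d : nat) (c : {ffun 'I_d -> option bool}) :
    set {ffun 'I_d -> R} :=
  [set x | cube x /\ forall e b, c e = Some b -> x e = b%:R]%classic.

Definition cube_pt (R : realType) (I : finType) (d : I -> nat) :=
  {i : I & {ffun 'I_(d i) -> R}}.

Definition cpt (R : realType) (I : finType) (d : I -> nat) (i : I)
    (x : {ffun 'I_(d i) -> R}) : cube_pt R d :=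
  Tagged (fun i => {ffun 'I_(d i) -> R}) x.

Record cubic_complex (R : realType) := CubicComplex {
  cubes : finType;
  cdim : cubes -> nat;
  eqv : cube_pt R cdim -> cube_pt R cdim -> Prop;
  eqv_refl : forall p, cube (tagged p) -> eqv p p;
  eqv_sym : forall p q, cube (tagged p) -> cube (tagged q) -> eqv p q -> eqv q p;
  eqv_trans : forall p q r, cube (tagged p) -> cube (tagged q) -> cube (tagged r) ->
    eqv p q -> eqv q r -> eqv p r;
  eqv_same_cube : forall i (x y : {ffun 'I_(cdim i) -> R}),
    cube x -> cube y -> eqv (cpt x) (cpt y) -> x = y;
  eqv_faces : forall i j (x : {ffun 'I_(cdim i) -> R}) (y : {ffun 'I_(cdim j) -> R}),
    i != j -> cube x -> cube y -> eqv (cpt x) (cpt y) ->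
    exists (a : {ffun 'I_(cdim i) -> option bool})
           (b : {ffun 'I_(cdim j) -> option bool})
           (phi : {ffun 'I_(cdim i) -> R} -> {ffun 'I_(cdim j) -> R}),
      [/\ cube_face a x, cube_face b y, affine phi,
          set_bij (cube_face a) (cube_face b) phi &
          forall z, cube_face a z -> eqv (cpt z) (cpt (phi z))] }.

(* The vertices of the complex are the classes of corners under [same_vertex]. *)
Definition corner (R : realType) (X : cubic_complex R) : finType :=
  {i : cubes X & {ffun 'I_(cdim i) -> bool}}.

(* The coordinates [u] centred at the corner [v]: u = 0 is the corner itself,
   and the coordinate axes run along the edges of the cube that contain it. *)
Definition from_corner (R : realType) (d : nat) (v : {ffun 'I_d -> bool})
    (u : {ffun 'I_d -> R}) : {ffun 'I_d -> R} :=
  [ffun e => if v e then 1 - u e else u e].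

Definition same_vertex (R : realType) (X : cubic_complex R) (c c' : corner X) : Prop :=
  eqv (cpt (from_corner (tagged c) 0)) (cpt (from_corner (tagged c') 0)).

(* The link of the vertex represented by [c].  It has one simplex for each
   corner [c'] at that vertex, with vertices the midpoints of the edges at [c']
   of the cube of [c'].  The simplices of the smaller cells of this cube are its
   faces.  A corner elsewhere, or the corner of a 0-cube, has an empty body. *)
Definition link_pt (R : realType) (X : cubic_complex R)
    (p : {c : corner X & {ffun 'I_(cdim (tag c)) -> R}}) : cube_pt R (@cdim R X) :=
  cpt (from_corner (tagged (tag p)) [ffun e => tagged p e / 2]).

Definition vertex_link (R : realType) (X : cubic_complex R) (c : corner X) : space R :=
  @Space R (corner X) (fun c' => 'I_(cdim (tag c')) : finType)
    (fun c' => [set x | same_vertex c c' /\ simplex x]%classic)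
    (fun p q => eqv (link_pt p) (link_pt q)).

Definition combinatorial_manifold (R : realType) (n : nat) (X : cubic_complex R) :=
  forall c : corner X,
    PL_homeomorphic (vertex_link c) (single (simplex_boundary R n)).

Definition spread (R : realType) (d : nat) (s : seq 'I_d) (u : seq R) : {ffun 'I_d -> R} :=
  [ffun e => if e \in s then u`_(index e s) else 0].

(* The face of the cube of [c] spanned by the edges [s] at [c] is identified
   with the face spanned by the edges [s'] at [c'], in such a way that c goes
   to c' and the m-th edge of [s] goes to the m-th edge of [s']. *)
Definition frame_eqv (R : realType) (X : cubic_complex R) (c c' : corner X)
    (s : seq 'I_(cdim (tag c))) (s' : seq 'I_(cdim (tag c'))) : Prop :=
  size s = size s' /\
  forall u : seq R, size u = size s -> (forall a, a \in u -> 0 <= a <= 1) ->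
    eqv (cpt (from_corner (tagged c) (spread s u)))
        (cpt (from_corner (tagged c') (spread s' u))).

Definition subcell (R : realType) (X : cubic_complex R) (i j : cubes X) : Prop :=
  forall x : {ffun 'I_(cdim i) -> R}, cube x ->
    exists2 y : {ffun 'I_(cdim j) -> R}, cube y & eqv (cpt x) (cpt y).

Definition flip (d : nat) (e : 'I_d) (v : {ffun 'I_d -> bool}) : {ffun 'I_d -> bool} :=
  [ffun e' => (e' == e) (+) v e'].

(* An orientation gives a sign to each frame formed by the n edges of an n-cube
   at one of its corners, taken in some order and directed away from the corner;
   other values are irrelevant.  The first two clauses say that the signs on one
   cube come from an orientation of R^n, the third that they only depend on the
   cell, and the last that distinct n-cells with a common (n-1)-cell induce
   opposite orientations on it. *)
Definition frame_sgn (R : realType) (X : cubic_complex R) :=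
  forall c : corner X, seq 'I_(cdim (tag c)) -> bool.

Definition cubic_orientation (R : realType) (n : nat) (X : cubic_complex R)
    (w : frame_sgn X) : Prop :=
  [/\ forall (c : corner X) s1 a b s2, cdim (tag c) = n ->
        perm_eq (s1 ++ a :: b :: s2) (enum 'I_(cdim (tag c))) ->
        w c (s1 ++ b :: a :: s2) = ~~ w c (s1 ++ a :: b :: s2),
      forall (i : cubes X) (v : {ffun 'I_(cdim i) -> bool}) e s, cdim i = n ->
        perm_eq s (enum 'I_(cdim i)) ->
        w (Tagged (fun i => {ffun 'I_(cdim i) -> bool}) (flip e v)) s =
        ~~ w (Tagged (fun i => {ffun 'I_(cdim i) -> bool}) v) s,
      forall (c c' : corner X) s s', cdim (tag c) = n -> cdim (tag c') = n ->
        perm_eq s (enum 'I_(cdim (tag c))) -> perm_eq s' (enum 'I_(cdim (tag c'))) ->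
        frame_eqv s s' -> w c' s' = w c s &
      forall (c c' : corner X) e s e' s', cdim (tag c) = n -> cdim (tag c') = n ->
        perm_eq (e :: s) (enum 'I_(cdim (tag c))) ->
        perm_eq (e' :: s') (enum 'I_(cdim (tag c'))) ->
        ~ subcell (tag c) (tag c') ->
        frame_eqv s s' -> w c' (e' :: s') = ~~ w c (e :: s)].

(* The affine map of simplices with vertex map [phi], in barycentric coordinates. *)
Definition push (R : realType) (E F : finType) (phi : E -> F) (x : {ffun E -> R}) :
    {ffun F -> R} :=
  [ffun v => \sum_(e | phi e == v) x e].

(* An orientation preserving isomorphism from the link of the vertex [c], with
   the orientation induced by [w], to [(K, o)]: a bijection of the underlying
   spaces that maps each simplex of the link linearly onto a simplex of [K].
   The cone from the vertex over the simplex with vertices the midpoints of the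
   edges s_1, ..., s_n has the orientation of the frame s_1, ..., s_n. *)
Definition link_oriented_iso (R : realType) (n : nat) (X : cubic_complex R)
    (w : frame_sgn X) (c : corner X) (K : scomplex) (o : seq (vert K) -> bool) : Prop :=
  exists f : pt (vertex_link c) -> {ffun vert K -> R},
    [/\ forall p q, in_space p -> in_space q -> (glue p q <-> f p = f q),
        forall y, realization R K y <-> exists2 p, in_space p & f p = y &
        forall c' : corner X, same_vertex c c' ->
          exists phi : 'I_(cdim (tag c')) -> vert K,
            [/\ injective phi,
                [set phi e | e in 'I_(cdim (tag c'))]%SET \in face K,
                forall x, simplex x ->
                  f (Tagged (fun c' : corner X => {ffun 'I_(cdim (tag c')) -> R}) x)
                  = push phi x &
                cdim (tag c') = n -> forall s, perm_eq s (enum 'I_(cdim (tag c'))) ->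
                  o (map phi s) = w c' s]].

(* Main.v *)
(* The corners of the cubes of X are frames: a vertex of X together with an
   ordered facet t_0, t_1, ... of the sphere Y_i that sits there; the l-th edge
   at such a corner is the simplex {t_0, ..., t_l}.  One needs commuting
   involutions "cross the l-th edge" which reverse the orientation and depend
   only on {t_0, ..., t_l} up to reordering the frame.

   The first one is given by the pairing of the vertices of the spheres: it
   replaces the star of t_0 by the star of its partner.  Together with the
   reorderings of the frame it generates a finite group of permutations.  Let
   W_l be generated by the first crossing and the reorderings of t_0, ..., t_l,
   S_l by the reorderings of the rest; W_l and S_l commute; let K_l = W_l S_l.
   Frames carry an element w of the group, and the l-th crossing is the left
   multiplication w |-> x w by a reflection x, a conjugate of the first crossing
   by an element of w K_l.  It commutes with the right action of everything that
   has to be preserved, and it changes the orientation because x w = w g with g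
   in W_l a conjugate of the first crossing.  The reflections are chosen for all
   cosets w K_l and are part of the data of a vertex of X; crossing an edge
   conjugates the reflections of the lower cosets inside w K_l, and this is what
   makes the crossings commute.  All values of the data occur equally often over
   each Y_i, so all Y_i occur the same number of times.

   The link of a vertex is the barycentric subdivision of Y_i by construction.
   It is PL homeomorphic to Y_i by the affine maps that send the vertex
   {t_0, ..., t_l} to the barycenter of that simplex, so nothing has to be known
   about the topology of combinatorial spheres. *)
Require Import Defs.
From mathcomp Require Import all_boot all_order all_algebra all_fingroup.
From mathcomp Require Import ring lra zify.
From mathcomp Require classical_sets functions boolp.
From mathcomp Require Import reals.
Set Implicit Arguments.
Unset Strict Implicit.
Unset Printing Implicit Defensive.

(** * Commuting reflections *)

Section Reflections.
Local Open Scope group_scope.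
Variables (gT : finGroupType) (m : nat) (W S : 'I_m -> {group gT}) (e0 : gT).
Hypothesis e0K : e0 * e0 = 1.
Hypothesis e0W : forall l, e0 \in W l.
Hypothesis W_mono : forall i j : 'I_m, (i <= j)%N -> W i \subset W j.
Hypothesis S_anti : forall i j : 'I_m, (i <= j)%N -> S j \subset S i.
Hypothesis SW_comm : forall l, S l \subset 'C(W l).

Definition block_group (l : 'I_m) : {group gT} := (W l <*> S l)%G.
Local Notation K := block_group.

Lemma block_groupE l : K l = W l * S l :> {set gT}.
Proof. exact/cent_joinEr/SW_comm. Qed.

Lemma W_sub_block (i j : 'I_m) : (i <= j)%N -> W i \subset K j.
Proof. by move=> /W_mono ij; apply: subset_trans ij (joing_subl _ _). Qed.

Lemma S_sub_block (i j : 'I_m) : (i <= j)%N -> S j \subset K i.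
Proof. by move=> /S_anti ij; apply: subset_trans ij (joing_subr _ _). Qed.

(* [D (l, w)] only depends on the coset [w K_l] and is conjugate to [e0] by an
   element of it; left multiplication by it is an involution of this coset. *)
Definition reflections (D : {ffun 'I_m * gT -> gT}) : bool :=
  [forall p, [forall k in K p.1, D (p.1, p.2 * k) == D p] &&
             [exists k in K p.1, D p == e0 ^ (p.2 * k)^-1]].

Lemma reflectionsP (D : {ffun 'I_m * gT -> gT}) :
  reflect (forall l w, (forall k, k \in K l -> D (l, w * k) = D (l, w)) /\
             exists2 k, k \in K l & D (l, w) = e0 ^ (w * k)^-1)
          (reflections D).
Proof.
apply: (iffP forallP) => [h l w|h [l w]].
  have /andP[/forall_inP h1 /exists_inP[k kK /eqP h2]] := h (l, w).
  by split; [move=> x xK; apply/eqP/h1|exists k].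
have [h1 [k kK h2]] := h l w; apply/andP; split.
  by apply/forall_inP => x xK; apply/eqP/h1.
by apply/exists_inP; exists k => //; apply/eqP.
Qed.

(** The condition that the cosets [u K_i] and [w K_l] meet. *)
Definition in_block_range (l i : 'I_m) (w u : gT) : bool := w^-1 * u \in K l * K i.

(* Crossing the l-th edge conjugates the reflections of the lower cosets that meet
   [w K_l].  This makes the crossings commute: for i < l with reflections [x] and
   [y], both orders lead from [w] to [y * x * w]. *)
Definition reflect_blocks (l : 'I_m) (w : gT) (D : {ffun 'I_m * gT -> gT}) :
    {ffun 'I_m * gT -> gT} :=
  [ffun p : 'I_m * gT => if (p.1 < l)%N && in_block_range l p.1 w p.2
             then D (l, w) * D (p.1, D (l, w) * p.2) * D (l, w) else D p].

Lemma in_block_rangeMl l i w u y : y \in K l ->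
  in_block_range l i (w * y) u = in_block_range l i w u.
Proof.
move=> yK; rewrite /in_block_range invMg -mulgA.
apply/imset2P/imset2P => [] [a b aK bK eq]; last first.
  by exists (y^-1 * a) b; rewrite ?groupM ?groupV // eq mulgA.
by exists (y * a) b; rewrite ?groupM // -mulgA -eq mulKVg.
Qed.

Lemma in_block_rangeMr l i w u y : y \in K i ->
  in_block_range l i w (u * y) = in_block_range l i w u.
Proof.
move=> yK; rewrite /in_block_range mulgA.
apply/imset2P/imset2P => [] [a b aK bK eq]; last first.
  by exists a (b * y); rewrite ?groupM // eq mulgA.
by exists a (b * y^-1); rewrite ?groupM ?groupV // mulgA -eq mulgK.
Qed.

Section OneFamily.
Variable D : {ffun 'I_m * gT -> gT}.
Hypothesis DP : reflections D.

Lemma reflection_block l w k : k \in K l -> D (l, w * k) = D (l, w).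
Proof. by move: DP => /reflectionsP /(_ l w) [h _]; apply: h. Qed.

Lemma reflectionK l w : D (l, w) * D (l, w) = 1.
Proof.
by move: DP => /reflectionsP /(_ l w) [_ [k _ ->]]; rewrite -conjMg e0K conj1g.
Qed.

Lemma reflection_inv l w : (D (l, w))^-1 = D (l, w).
Proof. by apply/eqP; rewrite eq_invg_mul reflectionK. Qed.

Lemma reflectionKg l w u : D (l, w) * (D (l, w) * u) = u.
Proof. by rewrite mulgA reflectionK mul1g. Qed.

(** Of the conjugating element [a * s] of [K_l = W_l S_l] only the factor [a] matters, because [s]
    commutes with [e0]. Hence crossing an edge is also right multiplication of [w] by a conjugate of
    [e0] inside [W_l]. *)
Lemma reflection_conj l w : exists2 a, a \in W l & D (l, w) ^ w = e0 ^ a.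
Proof.
move: DP => /reflectionsP /(_ l w) [_ [k]].
rewrite -[k \in _]/(k \in (K l : {set gT})) block_groupE => /imset2P[a s aW sS ->] ->.
exists a^-1; first by rewrite groupV.
rewrite -conjgM !invMg mulgKV conjgM; congr (_ ^ _).
apply/conjg_fixP/commgP/commuteV.
by move/subsetP/(_ s sS)/centP/(_ e0 (e0W l)): (SW_comm l).
Qed.

Lemma reflection_conjW l w : D (l, w) ^ w \in W l.
Proof. by have [a aW ->] := reflection_conj l w; rewrite groupJ. Qed.

Lemma reflection_mul l w : D (l, w) * w = w * (D (l, w) ^ w).
Proof. by rewrite -conjgC. Qed.

(** Crossing a lower edge multiplies [w] on the right by an element of [W_i], which lies in [K_j],
    so the coset [w K_j] stays the same. *)
Lemma reflection_lower (i j : 'I_m) w : (i <= j)%N -> D (j, D (i, w) * w) = D (j, w).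
Proof.
move=> ij; rewrite reflection_mul reflection_block //.
exact: (subsetP (W_sub_block ij)) (reflection_conjW _ _).
Qed.

Lemma in_block_range_reflect i l w u :
  in_block_range l i (D (l, w) * w) u = in_block_range l i w u.
Proof.
rewrite reflection_mul in_block_rangeMl //.
exact: (subsetP (W_sub_block (leqnn _))) (reflection_conjW _ _).
Qed.

Lemma in_block_range_translate i l w u x :
  in_block_range l i (x * w) (x * u) = in_block_range l i w u.
Proof. by rewrite /in_block_range invMg -mulgA mulKg. Qed.

Lemma in_block_range_reflectr i l w u :
  in_block_range l i w (D (l, w) * u) = in_block_range l i w u.
Proof. by rewrite -in_block_range_reflect in_block_range_translate. Qed.

Lemma reflect_blocks_top l w u : reflect_blocks l w D (l, u) = D (l, u).
Proof. by rewrite ffunE /= ltnn. Qed.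

(** Conjugation by [D (l, w)] turns the reflection chosen for the coset of [D (l, w) * u] into one
    that is admissible for the coset of [u]. *)
Lemma reflect_blocks_reflections l w : reflections (reflect_blocks l w D).
Proof.
apply/reflectionsP => i u; split=> [k kK|]; rewrite !ffunE /=.
  by rewrite in_block_rangeMr // mulgA !(reflection_block _ kK).
move: DP => /reflectionsP h.
case: ifP => _; last by case: (h i u).
have [_ [k kK ->]] := h i (D (l, w) * u); exists k => //.
have conjE y : D (l, w) * y * D (l, w) = y ^ D (l, w).
  by rewrite conjgE reflection_inv mulgA.
by rewrite conjE -conjgM -mulgA invMg mulgKV.
Qed.

Lemma reflect_blocksK l w :
  reflect_blocks l (D (l, w) * w) (reflect_blocks l w D) = D.
Proof.
apply/ffunP => -[i u]; rewrite !ffunE /= ltnn /= reflection_lower //.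
rewrite in_block_range_reflect in_block_range_reflectr.
by case: (_ && _) => //; rewrite reflectionKg -!mulgA reflectionK mulg1 reflectionKg.
Qed.

(** In [K_i = W_i S_i] the factor [W_i] lies in [K_j] and the factor [S_i] in [K_l], so [K_i K_l] is
    contained in [K_j K_l]. *)
Lemma in_block_range_sub (i j l : 'I_m) w u : (l <= i)%N -> (i <= j)%N ->
  in_block_range i l w u -> in_block_range j l w u.
Proof.
move=> li ij /imset2P[a b]; rewrite /in_block_range.
rewrite -[a \in _]/(a \in (K i : {set gT})) block_groupE => /imset2P[c s cW sS ->] bK ->.
rewrite -mulgA mem_mulg ?groupM //; first exact: (subsetP (W_sub_block ij)).
exact: (subsetP (S_sub_block li)).
Qed.

End OneFamily.

Lemma reflect_blocksC (D : {ffun 'I_m * gT -> gT}) (i j : 'I_m) w : reflections D -> (i < j)%N ->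
  reflect_blocks j (D (i, w) * w) (reflect_blocks i w D) =
  reflect_blocks i (D (j, w) * w) (reflect_blocks j w D) /\
  (reflect_blocks i w D) (j, D (i, w) * w) * (D (i, w) * w) =
  (reflect_blocks j w D) (i, D (j, w) * w) * (D (j, w) * w).
Proof.
move=> DP ij; set x : gT := D (i, w); set y : gT := D (j, w).
have DJ : reflect_blocks i w D (j, x * w) = y.
  by rewrite ffunE /= ltnNge (ltnW ij) /= /x reflection_lower // ltnW.
have one_in : in_block_range j i w w by rewrite /in_block_range mulVg -(mulg1 1) mem_mulg.
have DI : reflect_blocks j w D (i, y * w) = y * x * y.
  by rewrite ffunE /= ij /= in_block_range_reflectr // one_in -/y reflectionKg.
have yy u : y * (y * u) = u by exact: reflectionKg.
have xx u : x * (x * u) = u by exact: reflectionKg.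
split; last by rewrite DJ DI -!mulgA yy.
have jx l u : in_block_range j l (x * w) u = in_block_range j l w u.
  rewrite /x reflection_mul // in_block_rangeMl //.
  exact: (subsetP (W_sub_block (ltnW ij))) (reflection_conjW DP _ _).
have sub (l : 'I_m) u : (l < i)%N -> in_block_range i l w u -> in_block_range j l w u.
  by move=> li; apply: in_block_range_sub; [apply: ltnW|apply: ltnW].
have ysub l u : in_block_range j l w (y * u) = in_block_range j l w u.
  exact: in_block_range_reflectr.
have iy l u : in_block_range i l (y * w) u = in_block_range i l w (y * u).
  by rewrite -(in_block_range_translate _ _ w (y * u) y) yy.
have ix l u : in_block_range i l w (x * u) = in_block_range i l w u.
  exact: in_block_range_reflectr.
apply/ffunP => -[l u].
rewrite [LHS]ffunE /= DJ jx [RHS]ffunE /= DI iy !ffunE /= -/x -/y.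
rewrite -!mulgA ?yy.
(* From level [i] up only crossing [j] can change the family. Below [i], a coset that meets [w K_i]
   also meets [w K_j] by [sub], which matches the cases of the two orders. *)
case: (ltnP l i) => [li|il] /=; last by case: ifP.
rewrite (ltn_trans li ij) /=.
have := sub l u li; have := sub l (x * (y * u)) li; have := sub l (y * u) li.
rewrite ix ysub.
case: (in_block_range i l w (y * u)) => [/(_ isT) -> /(_ isT) xyu _ /=|_ _].
  by rewrite ysub xyu -!mulgA !yy.
by case: (in_block_range i l w u) => [/(_ isT) ->|].
Qed.

(** Conjugating by the inverse of a coset representative gives a value that depends only on the
    coset. *)
Lemma reflections_exist : exists D, reflections D.
Proof.
exists [ffun p : 'I_m * gT => e0 ^ (repr (p.2 *: K p.1))^-1].
apply/reflectionsP => l w; rewrite !ffunE /=; split=> [k kK|].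
  by rewrite ffunE /= lcosetM lcoset_id.
have /lcosetP[k kK ->] : repr (w *: K l) \in w *: K l.
  by apply: (mem_repr w); rewrite lcoset_refl.
by exists k.
Qed.

End Reflections.

(** * Cubic complexes from frames *)

(** The default [x0] makes data on cubes of different dimensions comparable axis by axis, as
    functions on [nat]. *)
Definition ext (T : Type) (x0 : T) (d : nat) (f : 'I_d -> T) (l : nat) : T :=
  oapp f x0 (insub l).

Lemma ext_ord T (x0 : T) d (f : 'I_d -> T) (j : 'I_d) : ext x0 f j = f j.
Proof. by rewrite /ext insubT //= => h; congr f; apply: val_inj. Qed.

Lemma ext_lt T (x0 : T) d (f : 'I_d -> T) l (ld : (l < d)%N) :
  ext x0 f l = f (Ordinal ld).
Proof. by rewrite -(ext_ord x0). Qed.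

Lemma ext_out T (x0 : T) d (f : 'I_d -> T) l : (d <= l)%N -> ext x0 f l = x0.
Proof. by move=> dl; rewrite /ext insubF // ltnNge dl. Qed.

(* A frame stands for a cube with a distinguished corner: [vtx] is the vertex at
   that corner, [turn l] moves the corner to the other end of the l-th edge, and
   [level x l] is the vertex of the link that this edge determines.  [parity]
   keeps the corners of one cube apart, so that no two of its points get
   identified. *)
Record frame_system := FrameSystem {
  frame : finType;
  vtx_type : eqType;
  ground : finType;
  top : nat;
  vtx : frame -> vtx_type;
  dim : frame -> nat;
  level : frame -> nat -> {set ground};
  turn : nat -> frame -> frame;
  parity : vtx_type -> nat -> bool;
  dim_le_top : forall x, (dim x <= top)%N;
  turnK : forall l, involutive (turn l);
  turnC : forall l m x, turn l (turn m x) = turn m (turn l x);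
  dim_turn : forall l x, (l < dim x)%N -> dim (turn l x) = dim x;
  parity_turn : forall l m x, (l < top)%N -> (m < top)%N ->
    parity (vtx (turn l x)) m = (m == l) (+) parity (vtx x) m;
  turn_vtx : forall l x y, (l < top)%N -> vtx x = vtx y -> level x l = level y l ->
    vtx (turn l x) = vtx (turn l y);
  turn_level : forall l m x y, (l < top)%N -> (m < top)%N ->
    vtx x = vtx y -> level x l = level y l -> level x m = level y m ->
    level (turn l x) m = level (turn l y) m;
  level_inj : forall x y l m, (l < dim x)%N -> (m < dim y)%N ->
    level x l = level y m -> l = m }.

Section Turns.
Variable F : frame_system.
Implicit Types (x y : frame F) (b : nat -> bool) (r : seq nat).

(** [b] encodes a set of axes. Since the turns commute and are involutions, composition corresponds
    to the symmetric difference of such sets. *)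
Definition turns_on r b x : frame F := foldr (fun l z => if b l then turn l z else z) x r.

Definition turns b x := turns_on (iota 0 (top F)) b x.

Lemma turns_on_turn r b l x : turns_on r b (turn l x) = turn l (turns_on r b x).
Proof. by elim: r => //= m r ->; case: ifP => // _; rewrite turnC. Qed.

Lemma turns_onD r b b' x :
  turns_on r b (turns_on r b' x) = turns_on r (fun l => b l (+) b' l) x.
Proof.
elim: r => //= l r IH; case: (b' l) => /=; rewrite ?turns_on_turn IH.
  by case: (b l) => //=; rewrite turnK.
by case: (b l).
Qed.

Lemma turnsD b b' x : turns b (turns b' x) = turns (fun l => b l (+) b' l) x.
Proof. exact: turns_onD. Qed.

Lemma eq_turns b b' x : (forall l, (l < top F)%N -> b l = b' l) -> turns b x = turns b' x.
Proof.
move=> eqb; rewrite /turns /turns_on.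
have : all (fun l => l < top F)%N (iota 0 (top F)).
  by apply/allP => l; rewrite mem_iota.
by elim: (iota _ _) => //= l r IH /andP[/eqb -> /IH ->].
Qed.

Lemma turns0 x : turns (fun=> false) x = x.
Proof. by rewrite /turns /turns_on; elim: (iota _ _). Qed.

Lemma turns1 l x : (l < top F)%N -> turns (fun m => m == l) x = turn l x.
Proof.
move=> lt; have : l \in iota 0 (top F) by rewrite mem_iota.
rewrite /turns; have := iota_uniq 0 (top F).
elim: (iota _ _) => //= m r IH /andP[mr ur]; rewrite inE eq_sym.
case: (eqVneq m l) mr => [-> lr _|_ _ /= /(IH ur) //].
congr turn; elim: r lr {ur IH} => //= a r IH; rewrite inE negb_or => /andP[la /IH ->].
by rewrite eq_sym (negbTE la).
Qed.

Definition inside b x := forall l, b l -> (l < dim x)%N.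

Lemma dim_turns_on r b x : inside b x -> dim (turns_on r b x) = dim x.
Proof.
by move=> bx; elim: r => //= l r IH; case: ifP => // /bx; rewrite -IH => /dim_turn.
Qed.

Lemma dim_turns b x : inside b x -> dim (turns b x) = dim x.
Proof. exact: dim_turns_on. Qed.

(** The vertex reached from [x] thus determines [b] below [top], so that distinct corners of one
    cube are distinct vertices. *)
Lemma parity_turns b x m : (m < top F)%N ->
  parity (vtx (turns b x)) m = b m (+) parity (vtx x) m.
Proof.
move=> mt; rewrite /turns; have : m \in iota 0 (top F) by rewrite mem_iota.
have : all (fun l => l < top F)%N (iota 0 (top F)) by apply/allP => l; rewrite mem_iota.
have := iota_uniq 0 (top F).
have aux r : all (fun l => l < top F)%N r -> m \notin r ->
    parity (vtx (turns_on r b x)) m = parity (vtx x) m.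
  elim: r => //= a r IH /andP[at_ rt]; rewrite inE negb_or => /andP[ma mr].
  by case: ifP => _; rewrite ?parity_turn ?(negbTE ma) ?IH.
elim: (iota _ _) => //= a r IH /andP[ar ur] /andP[at_ rt].
rewrite inE; case: eqP => [ma _|/eqP ma /= mr].
  by case: ifP => ba; rewrite ?parity_turn // aux ?ma ?eqxx // ba.
by case: ifP => ba; rewrite ?parity_turn ?(negbTE ma) // IH.
Qed.

(** Expresses that the cells spanned by the axes in [J] at the corners [x] and [y] are to be
    identified. *)
Definition agree (J : nat -> bool) x y :=
  vtx x = vtx y /\ forall l, J l -> level x l = level y l.

Lemma agree_turns (J b : nat -> bool) x y : (forall l, J l -> (l < top F)%N) ->
  (forall l, b l -> J l) -> agree J x y -> agree J (turns b x) (turns b y).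
Proof.
move=> Jt bJ xy; rewrite /turns; elim: (iota _ _) => //= l r [v lv].
case: ifP => // /bJ Jl; split; first by apply: turn_vtx; auto.
by move=> m Jm; apply: turn_level; auto.
Qed.

Lemma agree_sub (J J' : nat -> bool) x y : (forall l, J' l -> J l) -> agree J x y -> agree J' x y.
Proof. by move=> JJ [v lv]; split=> // l /JJ/lv. Qed.

Lemma agree_sym J x y : agree J x y -> agree J y x.
Proof. by move=> [v lv]; split=> // l /lv. Qed.

Lemma agree_trans J x y z : agree J x y -> agree J y z -> agree J x z.
Proof. by move=> [v1 l1] [v2 l2]; split=> [|l Jl]; [rewrite v1|rewrite l1 ?l2]. Qed.
End Turns.

(** * The equivalence of points of cubes and the resulting complex *)

Section Complex.
Local Open Scope ring_scope.
Import Order.TTheory GRing.Theory Num.Theory.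
Variables (R : realType) (F : frame_system).
Implicit Types (x y z : frame F) (b c f : nat -> bool) (p q s u : nat -> R).

(* The coordinate of [p] along the l-th axis, measured from the corner [b]. *)
Definition from (b : nat -> bool) (p : nat -> R) (l : nat) : R :=
  if b l then 1 - p l else p l.

Lemma fromD b b' p l : from (fun m => b m (+) b' m) p l = from b (from b' p) l.
Proof. by rewrite /from; case: (b l); case: (b' l) => //=; rewrite subKr. Qed.

Lemma eq_from b p q l : p l = q l -> from b p l = from b q l.
Proof. by rewrite /from => ->. Qed.

Lemma from0 b p l : p l = 0 -> from b p l = (b l)%:R.
Proof. by rewrite /from => ->; case: (b l); rewrite ?subr0. Qed.

Definition coords d (p : {ffun 'I_d -> R}) : nat -> R := ext 0 p.

(* The two points have equal coordinates, seen from corners [b] and [b'] that are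
   the same vertex, along edges that determine the same vertices of the link. *)
Definition same_point x y b b' (p q : nat -> R) : Prop :=
  [/\ inside b x, inside b' y, forall l, from b p l = from b' q l &
      agree (fun l => from b p l != 0) (turns b x) (turns b' y)].

Definition frame_pt := cube_pt R (@dim F).

Definition eqv_pt (P Q : frame_pt) : Prop :=
  exists b b', same_point (tag P) (tag Q) b b' (coords (tagged P)) (coords (tagged Q)).

Lemma coords_ge d (p : {ffun 'I_d -> R}) l : (d <= l)%N -> coords p l = 0.
Proof. exact: ext_out. Qed.

Lemma coords_ord d (p : {ffun 'I_d -> R}) (l : 'I_d) : coords p l = p l.
Proof. exact: ext_ord. Qed.

Lemma coords_inj d (p q : {ffun 'I_d -> R}) : coords p =1 coords q -> p = q.
Proof. by move=> pq; apply/ffunP => l; rewrite -!coords_ord. Qed.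

Lemma from_inside x b (p : {ffun 'I_(dim x) -> R}) l :
  inside b x -> from b (coords p) l != 0 -> (l < dim x)%N.
Proof.
move=> bx; rewrite /from; case: ifP => [/bx //|_].
by apply: contraNT; rewrite -leqNgt => /coords_ge ->.
Qed.

Lemma lt_top x l : (l < dim x)%N -> (l < top F)%N.
Proof. by move/leq_trans; apply; apply: dim_le_top. Qed.

Lemma insideD b b' x : inside b x -> inside b' x -> inside (fun l => b l (+) b' l) x.
Proof.
by move=> h h' l; case E: (b l) => /=; [move=> _; apply: h|apply: h'].
Qed.

(** A common point may be viewed from other corners: both viewpoints can be moved along the axes of
    [f], because these axes belong to the cell that the two cubes share. *)
Lemma same_point_turns x y b b' f (p : {ffun 'I_(dim x) -> R}) (q : {ffun 'I_(dim y) -> R}) :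
  same_point x y b b' (coords p) (coords q) ->
  (forall l, f l -> from b (coords p) l != 0) ->
  [/\ inside (fun l => f l (+) b l) x, inside (fun l => f l (+) b' l) y,
      forall l, from (fun l => f l (+) b l) (coords p) l =
                from (fun l => f l (+) b' l) (coords q) l &
      agree (fun l => from b (coords p) l != 0)
        (turns (fun l => f l (+) b l) x) (turns (fun l => f l (+) b' l) y)].
Proof.
move=> [bx by_ pq xy] fp.
have fx : inside f x by move=> l /fp; apply: from_inside.
have fy : inside f y by move=> l /fp; rewrite pq; apply: from_inside.
split; [exact: insideD|exact: insideD| |].
  by move=> l; rewrite !fromD; apply/eq_from/pq.
rewrite -!turnsD; apply: agree_turns => // l /from_inside => /(_ bx).
exact: lt_top.
Qed.

Lemma eqv_pt_refl P : eqv_pt P P.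
Proof. by exists (fun=> false), (fun=> false); split. Qed.

Lemma eqv_pt_sym P Q : eqv_pt P Q -> eqv_pt Q P.
Proof.
move=> [b [b' [bx by_ pq xy]]]; exists b', b; split=> //.
by apply: agree_sym; apply: agree_sub xy => l; rewrite pq.
Qed.

Lemma eqv_pt_trans P Q S : eqv_pt P Q -> eqv_pt Q S -> eqv_pt P S.
Proof.
case: P Q S => [x p] [y q] [z s] [b [b' xy]] [c [c' yz]].
rewrite /= in xy yz.
have [_ by_ pq _] := xy; have [cy cz qs _] := yz.
(* The cube of [y] is viewed from the corners [b'] and [c], which differ along [f]. Axes of [f] with
   nonzero coordinate from [b'] are turned in the first equivalence. The others have coordinate 0
   from [b'], hence 1 from [c], and are turned in the second. *)
pose f l := b' l (+) c l.
pose f1 l := f l && (from b (coords p) l != 0).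
pose f0 l := f l && (from b (coords p) l == 0).
have f1b l : f1 l -> from b (coords p) l != 0 by case/andP.
have [h1 h2 h3 h4] := same_point_turns xy f1b.
have f0c l : f0 l -> from c (coords q) l != 0.
  rewrite /f0 /f => /andP[]; rewrite pq /from.
  by case: (b' l); case: (c l) => //= _ /eqP E; rewrite -?E; apply/eqP; lra.
have [g1 g2 g3 g4] := same_point_turns yz f0c.
have mid l : f1 l (+) b' l = f0 l (+) c l.
  by rewrite /f1 /f0 /f; case: eqP; case: (b' l); case: (c l).
have supp1 l : from (fun l => f1 l (+) b l) (coords p) l != 0 -> from b (coords p) l != 0.
  rewrite fromD /from /f1 -/(from b (coords p) l).
  by case: (eqVneq (from b (coords p) l) 0) => // -> ; rewrite andbF eqxx.
have pq1 l : from (fun l => f1 l (+) b l) (coords p) l =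
             from (fun l => f0 l (+) c l) (coords q) l.
  by rewrite h3 /from mid.
have supp0 l : from (fun l => f1 l (+) b l) (coords p) l != 0 -> from c (coords q) l != 0.
  rewrite pq1 fromD {1}/from -/(from c (coords q) l).
  by case: ifP => // /f0c.
exists (fun l => f1 l (+) b l), (fun l => f0 l (+) c' l); split=> //.
  by move=> l; rewrite /= pq1 g3.
apply: agree_trans (agree_sub supp1 h4) _.
rewrite (eq_turns (b' := fun l => f0 l (+) c l) y) //.
exact: agree_sub supp0 g4.
Qed.

(** Coordinates are read from the corner [b] and written from the corner [b']; on the common face
    this is the identification of the two cubes. *)
Definition transfer x y b b' (z : {ffun 'I_(dim x) -> R}) : {ffun 'I_(dim y) -> R} :=
  [ffun l : 'I_(dim y) => from b' (from b (coords z)) l].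

(** With [u] the coordinates of a point seen from the corner [b], this is the smallest face
    containing that corner and the point. *)
Definition face_of x b (u : nat -> R) : {ffun 'I_(dim x) -> option bool} :=
  [ffun l : 'I_(dim x) => if u l == 0 then Some (b l) else None].

Lemma coords_bary d t (p q : {ffun 'I_d -> R}) l :
  coords (bary t p q) l = t * coords p l + (1 - t) * coords q l.
Proof.
have [ld|dl] := ltnP l d; last by rewrite !coords_ge ?mulr0 ?addr0.
by rewrite /coords !ext_lt ffunE.
Qed.

Lemma transfer_affine x y b b' : affine (@transfer x y b b').
Proof.
move=> t p q; apply/ffunP => l; rewrite !ffunE /from coords_bary.
by case: (b l); case: (b' l); lra.
Qed.

Lemma coords_cube d (p : {ffun 'I_d -> R}) l : cube p -> 0 <= coords p l <= 1.
Proof.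
move=> p01; have [ld|dl] := ltnP l d; last by rewrite coords_ge // lexx ler01.
by rewrite /coords ext_lt.
Qed.

Lemma from_cube b p l : 0 <= p l <= 1 -> 0 <= from b p l <= 1.
Proof. by rewrite /from; case: (b l) => //; lra. Qed.

Lemma fromK b p l : from b (from b p) l = p l.
Proof. by rewrite /from; case: (b l) => //; rewrite subKr. Qed.

Section Transfer.
Variables (x y : frame F) (b b' : nat -> bool) (u : nat -> R).
Hypotheses (bx : inside b x) (b'y : inside b' y).
Hypothesis u_ge : forall l, (dim y <= l)%N -> u l = 0.

Lemma face_from (z : {ffun 'I_(dim x) -> R}) l : cube_face (face_of x b u) z -> u l = 0 ->
  from b (coords z) l = 0.
Proof.
move=> [_ zf] ul0; have [lx|xl] := ltnP l (dim x).
  have := zf (Ordinal lx) (b l); rewrite ffunE /= ul0 eqxx => /(_ erefl).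
  rewrite /from /coords ext_lt => ->; case: (b l) => //=.
  by rewrite subrr.
rewrite /from coords_ge //; case: ifP => // /bx.
by rewrite ltnNge xl.
Qed.

Lemma transfer_from (z : {ffun 'I_(dim x) -> R}) l : cube_face (face_of x b u) z ->
  from b' (coords (transfer y b b' z)) l = from b (coords z) l.
Proof.
move=> zf; have [ly|yl] := ltnP l (dim y).
  rewrite -[RHS](fromK b'); apply: eq_from.
  by rewrite /coords ext_lt ffunE.
rewrite face_from ?u_ge // /from coords_ge //; case: ifP => // /b'y.
by rewrite ltnNge yl.
Qed.

Lemma transfer_face (z : {ffun 'I_(dim x) -> R}) : cube_face (face_of x b u) z ->
  cube_face (face_of y b' u) (transfer y b b' z).
Proof.
move=> zf; split=> [l|l c].
  by rewrite ffunE; apply/from_cube/from_cube/coords_cube; case: zf.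
rewrite !ffunE; case: eqP => // ul0 [<-].
by rewrite from0 // face_from.
Qed.
End Transfer.

Lemma transferK x y b b' (u : nat -> R) (z : {ffun 'I_(dim x) -> R}) :
  inside b x -> inside b' y -> (forall l, (dim y <= l)%N -> u l = 0) ->
  cube_face (face_of x b u) z -> transfer x b' b (transfer y b b' z) = z.
Proof.
move=> bx b'y u0 zf; apply/ffunP => l; rewrite ffunE -[RHS]coords_ord -[RHS](fromK b).
by apply: eq_from; rewrite (transfer_from bx b'y u0).
Qed.

(** The parities of the common vertex recover the viewpoint on either side, so [b] and [b'] agree,
    and then so do the coordinates. *)
Lemma eqv_pt_same_frame x (p q : {ffun 'I_(dim x) -> R}) :
  eqv_pt (cpt p : frame_pt) (cpt q : frame_pt) -> p = q.
Proof.
case=> b [b' [bx b'x pq [v _]]]; apply: coords_inj => l.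
have bb : b l = b' l.
  have [lt|tl] := ltnP l (top F).
    by have := congr1 (fun v => parity v l) v; rewrite !parity_turns // => /addIb.
  case E: (b l); first by have := leq_trans (lt_top (bx _ E)) tl; rewrite ltnn.
  by case E': (b' l) => //; have := leq_trans (lt_top (b'x _ E')) tl; rewrite ltnn.
by have := pq l; rewrite /from bb; case: (b' l) => // /(congr1 (fun t => 1 - t)); rewrite !subKr.
Qed.

Lemma eqv_pt_faces x y (p : {ffun 'I_(dim x) -> R}) (q : {ffun 'I_(dim y) -> R}) :
  cube p -> cube q -> eqv_pt (cpt p : frame_pt) (cpt q : frame_pt) ->
  exists (a : {ffun 'I_(dim x) -> option bool}) (a' : {ffun 'I_(dim y) -> option bool})
         (phi : {ffun 'I_(dim x) -> R} -> {ffun 'I_(dim y) -> R}),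
    [/\ cube_face a p, cube_face a' q, affine phi,
        functions.set_bij (cube_face a) (cube_face a') phi &
        forall t, cube_face a t -> eqv_pt (cpt t : frame_pt) (cpt (phi t) : frame_pt)].
Proof.
move=> p01 q01 [b [b' /= [bx b'y pq xy]]].
(* The common face is cut out by the axes along which the point has coordinate 0 from the matched
   corners. *)
pose u := from b (coords p).
have ux l : (dim x <= l)%N -> u l = 0.
  by move=> xl; apply/eqP; apply: contraTT xl => /(from_inside bx); rewrite -ltnNge.
have uy l : (dim y <= l)%N -> u l = 0.
  by rewrite /u pq => yl; apply/eqP; apply: contraTT yl => /(from_inside b'y); rewrite -ltnNge.
exists (face_of x b u), (face_of y b' u), (transfer y b b'); split.
- split=> // l c; rewrite ffunE; case: eqP => // + [<-].
  rewrite /u /from coords_ord; case: (b l) => //=; lra.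
- split=> // l c; rewrite ffunE; case: eqP => // + [<-].
  rewrite /u pq /from coords_ord; case: (b' l) => //=; lra.
- exact: transfer_affine.
- split=> [z /(transfer_face y b' bx)//|z1 z2 /classical_sets.set_mem h1 /classical_sets.set_mem h2 e|z zf].
    by rewrite -(transferK bx b'y uy h1) e (transferK bx b'y uy h2).
  exists (transfer x b' b z); first exact: transfer_face zf.
  exact: (transferK b'y bx ux zf).
- move=> z zf; exists b, b'; split=> //= [l|].
    by rewrite (transfer_from bx b'y uy).
  apply: agree_sub xy => l; apply: contraNN => /eqP ul.
  by rewrite (face_from bx zf).
Qed.

Definition complex_of : cubic_complex R :=
  @CubicComplex R (frame F) (@dim F) eqv_pt
    (fun P _ => eqv_pt_refl P) (fun P Q _ _ => @eqv_pt_sym P Q)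
    (fun P Q S _ _ _ => @eqv_pt_trans P Q S)
    (fun x t t' _ _ => @eqv_pt_same_frame x t t')
    (fun x y t t' _ => @eqv_pt_faces x y t t').
End Complex.

(** * Frames from ordered facets *)

Section PermGeneration.
Local Open Scope group_scope.
Variable T : finType.

Lemma perm_onI (S : {set T}) (p : {perm T}) :
  (forall x, x \notin S -> p x = x) -> perm_on S p.
Proof.
by move=> h; apply/subsetP => x; rewrite inE; apply: contraNT => /h ->.
Qed.

(** Induction on the number of moved points: [p * tperm x (p x)] fixes [x] and every fixed point of
    [p]. *)
Lemma perm_on_tperm_ind (S : {set T}) (Q : {perm T} -> Prop) :
  Q 1 -> (forall p q, Q p -> Q q -> Q (p * q)) ->
  (forall x y, x \in S -> y \in S -> x != y -> Q (tperm x y)) ->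
  forall p, perm_on S p -> Q p.
Proof.
move=> Q1 QM Qt p; have [c] := ubnP #|[set x | p x != x]|.
elim: c p => // c IH p lc pS.
have [x px|fx] := pickP (fun x => p x != x); last first.
  suff -> : p = 1 by [].
  by apply/permP => x; rewrite perm1; move/negbFE/eqP: (fx x).
have xS : x \in S by apply: contraNT px => /(out_perm pS)->.
have pxS : p x \in S by rewrite (perm_closed _ pS).
pose q := p * tperm x (p x).
have -> : p = q * tperm x (p x) by rewrite /q -mulgA tperm2 mulg1.
apply: QM; last by apply: Qt => //; rewrite eq_sym.
have qfix z : p z == z -> q z = z.
  move=> /eqP pz; rewrite permM pz tpermD //.
    by apply: contra_neq px => ->.
  by apply: contra_neq px => pxz; apply: (@perm_inj _ p); rewrite pxz pz.
apply: IH; last first.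
  by apply: perm_onI => z /(out_perm pS) pz; apply: qfix; rewrite pz.
rewrite ltnS in lc; apply: leq_trans lc; apply: proper_card; apply/properP; split.
  by apply/subsetP => z; rewrite !inE; apply: contraNneq => /eqP/qfix ->.
by exists x; rewrite !inE // /q permM tpermR eqxx.
Qed.
End PermGeneration.

(** A transposition of distant elements is a conjugate of a shorter one by an adjacent
    transposition. *)
Lemma adjacent_tperm_ind m d (Q : {perm 'I_m} -> Prop) :
  Q 1%g -> (forall p q, Q p -> Q q -> Q (p * q)%g) ->
  (forall x y : 'I_m, y = x.+1 :> nat -> (y < d)%N -> Q (tperm x y)) ->
  forall p, perm_on [set x : 'I_m | (x < d)%N] p -> Q p.
Proof.
move=> Q1 QM Qa; apply: perm_on_tperm_ind => //.
have Qlt (x y : 'I_m) : (x < y)%N -> (y < d)%N -> Q (tperm x y).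
  case: y => y ym /=; elim: y ym => // y IH ym; rewrite ltnS leq_eqVlt => /orP[/eqP xy|xy] yd.
    by apply: Qa => //=; rewrite xy.
  have ym' : (y < m)%N by apply: ltnW.
  have -> : tperm x (Ordinal ym) =
      (tperm (Ordinal ym') (Ordinal ym) * (tperm x (Ordinal ym') * tperm (Ordinal ym') (Ordinal ym)))%g.
    rewrite -{1}(tpermV (Ordinal ym') (Ordinal ym)) -conjgE tpermJ tpermL.
    by rewrite tpermD // -val_eqE /= gtn_eqF // ltnW.
  have Qy : Q (tperm (Ordinal ym') (Ordinal ym)) by apply: Qa.
  by apply: (QM) => //; apply: (QM) => //; apply: IH; rewrite // ltnW.
move=> x y; rewrite !inE => xd yd; rewrite -val_eqE neq_ltn => /orP[xy|yx].
  exact: Qlt.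
by rewrite tpermC; apply: Qlt.
Qed.

(** * Orderings compared through their initial segments *)

Section PrefixSets.
Variable T : finType.
Implicit Types s u r : seq T.

Lemma prefix_set_nth x0 s u j : uniq s -> (j < size s)%N -> (j < size u)%N ->
  [set z in take j s] = [set z in take j u] ->
  [set z in take j.+1 s] = [set z in take j.+1 u] -> nth x0 s j = nth x0 u j.
Proof.
move=> us js ju ej /setP/(_ (nth x0 s j)); rewrite !inE !(take_nth x0) //.
rewrite !mem_rcons !inE eqxx => /esym/orP[/eqP //|].
move/setP/(_ (nth x0 s j)): ej; rewrite !inE => <-.
by rewrite in_take ?mem_nth // index_uniq // ltnn.
Qed.

Lemma prefix_sets_eq s u : uniq s -> size s = size u ->
  (forall j, (j < size s)%N -> [set z in take j.+1 s] = [set z in take j.+1 u]) -> s = u.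
Proof.
case: s => [_ /esym/size0nil -> //|x0 s] us su e.
apply: (@eq_from_nth _ x0) => // j js; apply: prefix_set_nth => //; [by rewrite -su| |exact: e].
by case: j js => [|j] js; [rewrite !take0|apply: e; apply: ltnW].
Qed.

(** These are the two ways in which top simplices of a barycentric subdivision share a ridge: across
    a ridge of the complex when [e] is the last index, and inside one facet otherwise. *)
Lemma prefix_sets_ridge s u e : uniq s -> uniq u -> size s = size u -> (e < size s)%N ->
  (forall j, (j < size s)%N -> j != e -> [set z in take j.+1 s] = [set z in take j.+1 u]) ->
  [set z in take e.+1 s] != [set z in take e.+1 u] ->
  (exists r a b, [/\ a != b, s = rcons r a & u = rcons r b]) \/
  (exists r a b q, s = r ++ a :: b :: q /\ u = r ++ b :: a :: q).
Proof.
move=> us uu su es eqs neq; have x0 : T by case: s es {us su eqs neq}.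
have eqj j : (j <= size s)%N -> j != e.+1 -> [set z in take j s] = [set z in take j u].
  by case: j => [|j] js je; [rewrite !take0|apply: eqs].
have nthE j : (j < size s)%N -> j != e -> j != e.+1 -> nth x0 s j = nth x0 u j.
  move=> js je je1; apply: prefix_set_nth => //; first by rewrite -su.
    by apply: eqj => //; apply: ltnW.
  by apply: eqs.
have tE : take e s = take e u.
  apply: (@eq_from_nth _ x0); first by rewrite !size_take_min su.
  move=> j; rewrite size_take_min leq_min => /andP[je js].
  by rewrite !nth_take // nthE // ltn_eqF // ltnW.
have eu : (e < size u)%N by rewrite -su.
have sE : take e.+1 s = rcons (take e s) (nth x0 s e) by rewrite (take_nth x0).
have uE : take e.+1 u = rcons (take e s) (nth x0 u e) by rewrite (take_nth x0) // tE.
have ab : nth x0 s e != nth x0 u e by apply: contraNneq neq => ab; rewrite sE uE ab.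
move: es; rewrite leq_eqVlt => /orP[/eqP es|es].
  left; exists (take e s), (nth x0 s e), (nth x0 u e); split=> //.
    by rewrite -sE es take_size.
  by rewrite -uE es su take_size.
have e1u : (e.+1 < size u)%N by rewrite -su.
have s2 : take e.+2 s = rcons (rcons (take e s) (nth x0 s e)) (nth x0 s e.+1).
  by rewrite (take_nth x0) // sE.
have u2 : take e.+2 u = rcons (rcons (take e s) (nth x0 u e)) (nth x0 u e.+1).
  by rewrite (take_nth x0) // uE.
have e2 : [set z in take e.+2 s] = [set z in take e.+2 u].
  by apply: eqs => //; rewrite gtn_eqF.
have mem2 z : (z \in [:: nth x0 s e; nth x0 s e.+1]) = (z \in [:: nth x0 u e; nth x0 u e.+1]).
  have := take_uniq e.+2 us; have := take_uniq e.+2 uu; rewrite s2 u2 -!cats1 -!catA /=.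
  rewrite !cat_uniq => /and3P[_ nu _] /and3P[_ ns _].
  case zt: (z \in take e s).
    transitivity false; first by apply: contraNF ns => zs; apply/hasP; exists z.
    by apply/esym; apply: contraNF nu => zs; apply/hasP; exists z.
  move/setP/(_ z): e2; rewrite s2 u2 !in_set -!cats1 -!catA /=.
  by rewrite !(mem_cat z (take e s)) zt.
have ba : nth x0 u e = nth x0 s e.+1.
  have := mem2 (nth x0 u e); rewrite !inE eqxx (eq_sym (nth x0 u e) (nth x0 s e)) (negbTE ab) /=.
  by move/eqP.
have ab1 : nth x0 u e.+1 = nth x0 s e.
  have := mem2 (nth x0 s e); rewrite !inE eqxx (negbTE ab) /=.
  by move/esym/eqP.
right; exists (take e s), (nth x0 s e), (nth x0 s e.+1), (drop e.+2 s).
split; first by rewrite -{1}(cat_take_drop e.+2 s) s2 -!cats1 -!catA.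
rewrite -{1}(cat_take_drop e.+2 u) u2 ba ab1 -!cats1 -!catA; congr (_ ++ [:: _, _ & _]).
apply: (@eq_from_nth _ x0); first by rewrite !size_drop su.
move=> j; rewrite size_drop => js; rewrite !nth_drop nthE //.
- lia.
- lia.
- lia.
Qed.
End PrefixSets.

(** * The group acting on arrangements, and the frame system *)

Section Flags.
Local Open Scope group_scope.
Variables (k m : nat).
Local Notation V := 'I_m.+1.
(* [fl i s]: [s] orders a facet of the i-th complex; [sg i s] is its sign;
   [tg y] is the complex that contains the vertex [y]; [F y] extends the
   anti-isomorphism from the star of [y] to the star of its partner [F y y]. *)
Variables (fl sg : 'I_k -> seq V -> bool) (tg : V -> option 'I_k) (F : V -> {perm V}).
Hypothesis fl_tg : forall i s x, fl i s -> x \in s -> tg x = Some i.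
Hypothesis fl_swap : forall i s1 a b s2, fl i (s1 ++ a :: b :: s2) ->
  fl i (s1 ++ b :: a :: s2) /\ sg i (s1 ++ b :: a :: s2) = ~~ sg i (s1 ++ a :: b :: s2).
Hypothesis fl_star : forall i y s, fl i (y :: s) -> exists j,
  [/\ tg (F y y) = Some j, fl j (map (F y) (y :: s)) &
      sg j (map (F y) (y :: s)) = ~~ sg i (y :: s)].
Hypothesis F_inv : forall y, F (F y y) = (F y)^-1.
Hypothesis fl_max : forall i s s', fl i s -> fl i (s ++ s') -> s' = [::].
Hypothesis fl_ridge : forall i s a b, a != b -> fl i (rcons s a) -> fl i (rcons s b) ->
  sg i (rcons s b) = ~~ sg i (rcons s a).

(* [(i, t)] is the i-th complex with all the vertices listed in the order [t]. *)
Definition arrangement : finType := ('I_k * {perm V})%type.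
Implicit Types (v : arrangement) (t p q : {perm V}).

(** The inverse makes [hat] multiplicative, as permutations compose from left to right. *)
Definition hat_fun p v : arrangement := (v.1, p^-1 * v.2).

Lemma hat_inj p : injective (hat_fun p).
Proof. by move=> [i t] [j u] [-> /mulgI ->]. Qed.

Definition hat p : {perm arrangement} := perm (@hat_inj p).

Lemma hatE p v : hat p v = (v.1, p^-1 * v.2).
Proof. exact: permE. Qed.

Lemma hatM p q : hat (p * q) = hat p * hat q.
Proof. by apply/permP => v; rewrite permM !hatE /= invMg mulgA. Qed.

Lemma hat1 : hat 1 = 1.
Proof. by apply/permP => -[i t]; rewrite perm1 hatE /= invg1 mul1g. Qed.

Lemma hatV p : hat p^-1 = (hat p)^-1.
Proof. by apply/eqP; rewrite eq_sym eq_invg_mul -hatM mulgV hat1. Qed.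

(* Crossing the first edge of an arrangement replaces the complex at hand by the
   one paired with it at the first vertex and relabels the listing by [F]. *)
Definition pass_fun v : arrangement :=
  let y := v.2 ord0 in
  if tg y == Some v.1 then
    if tg (F y y) is Some j then (j, v.2 * F y) else v
  else v.

Lemma pass_funK : involutive pass_fun.
Proof.
move=> [i t]; rewrite /pass_fun /=.
case ti: (tg (t ord0) == Some i); last by rewrite ti.
case E: (tg (F (t ord0) (t ord0))) => [j|] /=; last by rewrite ti E.
by rewrite permM E eqxx F_inv permK (eqP ti) -mulgA mulgV mulg1.
Qed.

Definition pass : {perm arrangement} := perm (can_inj pass_funK).

Lemma passE v : pass v = pass_fun v.
Proof. exact: permE. Qed.

Lemma passK : pass * pass = 1.
Proof. by apply/permP => v; rewrite permM perm1 !passE pass_funK. Qed.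

Definition prefix (l : nat) : {set V} := [set x : V | (x < l.+1)%N].

(** The group W_l; [lower] is S_l. *)
Definition upper (l : V) : {group {perm arrangement}} :=
  <<pass |: [set hat p | p : {perm V} & perm_on (prefix l) p]>>%G.

Definition lower (l : V) : {group {perm arrangement}} :=
  <<[set hat p | p : {perm V} & perm_on (~: prefix l) p]>>%G.

Lemma pass_upper (l : V) : pass \in upper l.
Proof. by rewrite mem_gen // !inE eqxx. Qed.

Lemma hat_upper (l : V) p : perm_on (prefix l) p -> hat p \in upper l.
Proof. by move=> pl; rewrite mem_gen // inE orbC imset_f ?inE. Qed.

Lemma hat_lower (l : V) p : perm_on (~: prefix l) p -> hat p \in lower l.
Proof. by move=> pl; rewrite mem_gen // imset_f ?inE. Qed.

Lemma prefix_mono (i j : nat) : (i <= j)%N -> prefix i \subset prefix j.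
Proof. by move=> ij; apply/subsetP => x; rewrite !inE ltnS => /leq_trans; apply. Qed.

Lemma upper_mono (i j : V) : (i <= j)%N -> upper i \subset upper j.
Proof.
move=> ij; rewrite gen_subG; apply/subsetP => g; rewrite !inE => /orP[/eqP -> | ].
  exact: pass_upper.
case/imsetP => p; rewrite inE => pi ->; apply: hat_upper.
exact: subset_trans pi (prefix_mono ij).
Qed.

Lemma lower_anti (i j : V) : (i <= j)%N -> lower j \subset lower i.
Proof.
move=> ij; rewrite gen_subG; apply/subsetP => g /imsetP[p]; rewrite inE => pj ->.
by apply/hat_lower/(subset_trans pj); rewrite setCS prefix_mono.
Qed.

(** [pass] inspects only position 0, which is fixed by reorderings away from the prefix, and it
    relabels values while [hat] permutes positions. Reorderings with disjoint supports commute. *)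
Lemma lower_cent l : lower l \subset 'C(upper l).
Proof.
rewrite /lower /upper /= cent_gen gen_subG; apply/subsetP => g /imsetP[p].
rewrite inE => pl ->; apply/centP => h; rewrite !inE => /orP[/eqP ->|/imsetP[q]].
  apply/permP => v; rewrite !permM !hatE !passE /pass_fun /=.
  rewrite permM; have -> : p^-1 ord0 = ord0.
    by apply: (out_perm (perm_onV pl)); rewrite !inE.
  case: eqP => // _; case: (tg _) => [j|] //=.
  by rewrite mulgA.
rewrite inE => ql ->; rewrite /commute -!hatM; congr hat.
apply: (perm_onC pl ql).
by rewrite disjoint_sym -setI_eq0 setICr.
Qed.

Definition block_family : finType :=
  {D : {ffun 'I_m.+1 * {perm arrangement} -> {perm arrangement}} |
    reflections upper lower pass D}.

(* A frame [(v0, w, D, e)] sits at the arrangement [place = w v0].  Its vertex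
   forgets the ordering: [hat p] reorders the arrangement, and [(v0, w)] and
   [(v0, w * hat p)] give the same vertex. *)
Definition flag_frame : finType :=
  (arrangement * {perm arrangement} * block_family * {ffun V -> bool})%type.

Definition flag_vtx_type : finType :=
  ('I_k * ({perm arrangement} * block_family * {ffun V -> bool}))%type.

Definition place (x : flag_frame) : arrangement := x.1.1.2 x.1.1.1.

(** Passing from [w] to [w * hat q] changes the listing [t] into [q^-1 * t], so [w * hat t] is what
    remains of [w] when the ordering is forgotten. *)
Definition flag_vtx (x : flag_frame) : flag_vtx_type :=
  ((place x).1, (x.1.1.2 * hat (place x).2, x.1.2, x.2)).

Definition flag_level (x : flag_frame) (l : nat) : {set V} :=
  [set (place x).2 y | y in prefix l].

(* Locked, so that simplification does not unfold the enumeration. *)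
Definition positions : seq V := locked (enum 'I_m.+1).

Lemma positionsE : positions = enum 'I_m.+1.
Proof. by rewrite /positions -lock. Qed.

Definition listing (t : {perm V}) : seq V := map t positions.

(* 0 when no initial segment of the listing is an ordered facet; such a frame
   gives a harmless 0-cube. *)
Definition flag_dim (v : arrangement) : nat :=
  head 0%N [seq d <- iota 0 m.+2 | fl v.1 (take d (listing v.2))].

Lemma reflect_family_subproof (l : V) (w : {perm arrangement}) (D : block_family) :
  reflections upper lower pass (reflect_blocks upper lower l w (val D)).
Proof. exact: (reflect_blocks_reflections passK (valP D)). Qed.

Definition reflect_family (l : V) (w : {perm arrangement}) (D : block_family) : block_family :=
  exist (fun D' : {ffun V * {perm arrangement} -> {perm arrangement}} =>
    is_true (reflections upper lower pass D')) _ (reflect_family_subproof l w D).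

(** The bits [e] change at exactly one edge per crossing and supply the parity of the frame
    system. *)
Definition turn_at (l : V) (x : flag_frame) : flag_frame :=
  let: (v, w, D, e) := x in
  (v, val D (l, w) * w, reflect_family l w D, [ffun y => (y == l) (+) e y]).

Lemma turn_atK l : involutive (turn_at l).
Proof.
move=> [[[v w] D] e]; rewrite /turn_at /=.
have DP := valP D.
have tw : reflect_blocks upper lower l w (val D) (l, val D (l, w) * w) = val D (l, w).
  by rewrite reflect_blocks_top (reflection_lower pass_upper upper_mono lower_cent DP).
rewrite tw (reflectionKg passK DP); congr (_, _, _, _).
  by apply: val_inj; exact: (reflect_blocksK passK pass_upper upper_mono lower_cent DP).
by apply/ffunP => y; rewrite !ffunE addbA addbb.
Qed.

Lemma turn_atC i j x : turn_at i (turn_at j x) = turn_at j (turn_at i x).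
Proof.
case: x => [[[v w] D] e]; rewrite /turn_at /=; have DP := valP D.
have ee : [ffun y => (y == i) (+) [ffun y => (y == j) (+) e y] y] =
          [ffun y => (y == j) (+) [ffun y => (y == i) (+) e y] y] :> {ffun V -> bool}.
  by apply/ffunP => y; rewrite !ffunE addbCA.
rewrite ee; have [ij|ji|/val_inj -> //] := ltngtP i j.
  have [D2 w2] := reflect_blocksC passK pass_upper upper_mono lower_anti lower_cent w DP ij.
  by rewrite w2; congr (_, _, _, _); apply: val_inj; rewrite /= D2.
have [D2 w2] := reflect_blocksC passK pass_upper upper_mono lower_anti lower_cent w DP ji.
by rewrite w2; congr (_, _, _, _); apply: val_inj; rewrite /= D2.
Qed.

(** Seen on arrangements, the crossing is a conjugate of [pass] within W_l. This is the form in
    which its effect on facets and signs can be computed. *)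
Lemma place_turn l x : exists2 a, a \in upper l &
  place (turn_at l x) = a (pass (a^-1 (place x))).
Proof.
case: x => [[[v w] D] e]; rewrite /place /turn_at /=.
have [a al e0] := reflection_conj pass_upper lower_cent (valP D) l w; exists a => //.
by rewrite -!permM (conjgC _ w) e0 conjgE !mulgA.
Qed.

Definition linked (x y : flag_frame) (q : {perm V}) : Prop :=
  [/\ x.1.1.1 = y.1.1.1, y.1.1.2 = x.1.1.2 * hat q, x.1.2 = y.1.2 & x.2 = y.2].

Lemma linked_place x y q : linked x y q -> place y = hat q (place x).
Proof. by move=> [v w _ _]; rewrite /place w -v permM. Qed.

Lemma flag_vtxP x y : flag_vtx x = flag_vtx y <-> exists q, linked x y q.
Proof.
split=> [[]|[q lq]]; last first.
  rewrite /flag_vtx (linked_place lq) hatE /=; have [_ -> -> ->] := lq.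
  by rewrite -mulgA -hatM mulKVg.
move=> ei ew eD ee.
have ewq : y.1.1.2 = x.1.1.2 * hat ((place x).2 * (place y).2^-1).
  by rewrite hatM hatV mulgA ew mulgK.
exists ((place x).2 * (place y).2^-1); split=> //.
apply: (@perm_inj _ y.1.1.2); rewrite -/(place y) {1}ewq permM -/(place x) hatE.
by rewrite invMg invgK mulgKV ei -surjective_pairing.
Qed.

Definition stabilizes (l : nat) (q : {perm V}) : Prop := forall y, (q y \in prefix l) = (y \in prefix l).

Lemma flag_levelP x y q l : linked x y q -> flag_level x l = flag_level y l <-> stabilizes l q.
Proof.
move=> /linked_place py; rewrite /flag_level py hatE /=.
have inl (z : V) (t : {perm V}) : (t z \in [set t u | u in prefix l]) = (z \in prefix l).
  by rewrite mem_imset //; apply: perm_inj.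
have tq z : (q^-1 * (place x).2) (q z) = (place x).2 z by rewrite permM permK.
split=> [e z|st]; first by rewrite -(inl z (place x).2) e -tq inl.
apply/setP => z; rewrite -(permKV (place x).2 z) inl -tq inl; exact: esym (st _).
Qed.

(** Such a [q] splits into a permutation supported on the prefix and one supported on its
    complement, which give elements of W_l and S_l. *)
Lemma stabilizes_block (l : V) q : stabilizes l q -> hat q \in block_group upper lower l.
Proof.
move=> st.
have inj : {in prefix l &, injective q} by move=> a b _ _; apply: perm_inj.
have sub : [set q a | a in prefix l] \subset prefix l.
  by apply/subsetP => _ /imsetP[a al ->]; rewrite st.
pose q1 := perm_in inj sub.
have q1E : {in prefix l, q1 =1 q} by apply: perm_inE.
have -> : q = q1 * (q1^-1 * q) by rewrite mulKVg.
rewrite hatM; apply: groupM.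
  by apply/mem_gen; rewrite inE hat_upper // perm_in_on.
apply/mem_gen; rewrite inE orbC hat_lower // perm_onI // => z; rewrite inE negbK => zl.
rewrite permM -(q1E (q1^-1 z)) ?permKV //.
by rewrite (perm_closed _ (perm_onV (perm_in_on inj sub))).
Qed.

(** The reflection at [w] is the same as at [w * hat q], since [hat q] lies in K_l, and left
    multiplication by it commutes with right multiplication by [hat q]. *)
Lemma linked_turn (l : V) x y q : stabilizes l q -> linked x y q -> linked (turn_at l x) (turn_at l y) q.
Proof.
move=> /stabilizes_block qK.
case: x => [[[v w] D] e]; case: y => [[[v' w'] D'] e'] [/= <- -> <- <-].
rewrite /linked /turn_at /= (reflection_block (valP D) _ qK) mulgA; split=> //.
apply/val_inj/ffunP => -[i u]; rewrite /= !ffunE /= (reflection_block (valP D) _ qK).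
by rewrite in_block_rangeMl.
Qed.

Lemma flag_turn_vtx (l : V) x y : flag_vtx x = flag_vtx y -> flag_level x l = flag_level y l ->
  flag_vtx (turn_at l x) = flag_vtx (turn_at l y).
Proof.
move=> /flag_vtxP[q lq] /(flag_levelP _ lq) st.
by apply/flag_vtxP; exists q; apply: linked_turn.
Qed.

Lemma flag_turn_level (l : V) n x y : flag_vtx x = flag_vtx y -> flag_level x l = flag_level y l ->
  flag_level x n = flag_level y n -> flag_level (turn_at l x) n = flag_level (turn_at l y) n.
Proof.
move=> /flag_vtxP[q lq] /(flag_levelP _ lq) st /(flag_levelP _ lq) st'.
exact/(flag_levelP _ (linked_turn st lq)).
Qed.

(** * Dimensions and signs along the crossings *)

Definition good (d : nat) v : bool := fl v.1 (take d (listing v.2)).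

Definition head_sign (d : nat) v : bool := sg v.1 (take d (listing v.2)).

Lemma size_listing t : size (listing t) = m.+1.
Proof. by rewrite size_map positionsE size_enum_ord. Qed.

Lemma listing_uniq t : uniq (listing t).
Proof. by rewrite map_inj_uniq ?positionsE ?enum_uniq //; apply: perm_inj. Qed.

Lemma good_swap d (x y : V) i t : y = x.+1 :> nat -> (y < d)%N -> good d (i, t) ->
  good d (i, tperm x y * t) /\
  head_sign d (i, tperm x y * t) = ~~ head_sign d (i, t).
Proof.
move=> xy yd; rewrite /good /head_sign /listing -!map_take /=.
set e := take d positions.
have ye : (y < size e)%N by rewrite size_take_min positionsE size_enum_ord leq_min yd /=.
have ne (z : V) : (z <= y)%N -> nth ord0 e z = z.
  by move=> zy; rewrite nth_take ?positionsE ?nth_ord_enum // (leq_ltn_trans zy).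
have nx : nth ord0 e x = x by rewrite ne // xy.
have ny : nth ord0 e x.+1 = y by rewrite -xy ne.
have eE : e = take x e ++ x :: y :: drop x.+2 e.
  have xe : (x.+1 < size e)%N by rewrite -xy.
  by rewrite -{1}(cat_take_drop x e) (drop_nth ord0 (ltnW xe)) (drop_nth ord0 xe) nx ny.
have ue : uniq e by rewrite /e positionsE; apply/take_uniq/enum_uniq.
move: ue; rewrite eE cat_uniq /= !inE !negb_or.
set e1 := take x e; set e2 := drop x.+2 e.
case/and5P => _ /and3P[x1 y1 _] /andP[xny x2] y2 _.
have fixed r : x \notin r -> y \notin r -> map (tperm x y * t) r = map t r.
  move=> xr yr; apply/eq_in_map => z zr; rewrite permM tpermD //.
    by apply: contraNneq xr => ->.
  by apply: contraNneq yr => ->.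
rewrite !map_cat /= !permM tpermL tpermR !fixed //.
exact: fl_swap.
Qed.

Lemma good_perm d p : perm_on [set x : V | (x < d)%N] p ->
  forall i t, good d (i, t) ->
    good d (i, p * t) /\ head_sign d (i, p * t) = p (+) head_sign d (i, t).
Proof.
elim/adjacent_tperm_ind => [|p1 p2 h1 h2|x y xy yd] i t g.
- by rewrite mul1g odd_perm1.
- have [g2 s2] := h2 _ _ g; have [g1 s1] := h1 _ _ g2.
  by rewrite -mulgA s1 s2 odd_permM addbA.
- by rewrite odd_tperm -val_eqE /= xy (ltn_eqF (ltnSn x)); apply: good_swap.
Qed.

Lemma pass_good d v : (0 < d)%N -> good d v ->
  good d (pass v) /\ head_sign d (pass v) = ~~ head_sign d v.
Proof.
case: v d => [i t] [//|d] _; rewrite /good /head_sign passE /pass_fun /= => g.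
have lE u : take d.+1 (listing u) = u ord0 :: take d (behead (listing u)).
  by rewrite /listing positionsE enum_ordSl.
have FE : take d.+1 (listing (t * F (t ord0))) = map (F (t ord0)) (take d.+1 (listing t)).
  by rewrite /listing -!map_take -map_comp; apply: eq_map => z; rewrite /= permM.
have [j [tj gj sj]] := fl_star (eq_rect _ (fun s => is_true (fl i s)) g _ (lE t)).
have ti : tg (t ord0) = Some i by apply: (fl_tg g); rewrite lE inE eqxx.
by rewrite ti eqxx tj /= FE lE.
Qed.

(** The permutations that preserve good arrangements and change all their signs by one constant form
    a group, so it suffices to inspect the generators. Since [l < d], the reorderings involved stay
    within the first [d] positions. *)
Lemma upper_good d (l : V) g : (l < d)%N -> g \in upper l ->
  exists c : bool, forall v, good d v ->
    good d (g v) /\ head_sign d (g v) = c (+) head_sign d v.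
Proof.
move=> ld gl.
pose A := [set h : {perm arrangement} | [exists c, [forall v, good d v ==>
  good d (h v) && (head_sign d (h v) == c (+) head_sign d v)]]].
have AP (h : {perm arrangement}) : reflect (exists c : bool, forall v, good d v ->
    good d (h v) /\ head_sign d (h v) = c (+) head_sign d v) (h \in A).
  rewrite inE; apply: (iffP existsP) => -[c cP]; exists c.
    by move=> v gv; have /implyP/(_ gv)/andP[? /eqP ?] := forallP cP v.
  by apply/forallP => v; apply/implyP => /cP[-> ->] /=.
have gA : group_set A.
  apply/group_setP; split.
    by apply/AP; exists false => v; rewrite perm1.
  move=> h1 h2 /AP[c1 P1] /AP[c2 P2]; apply/AP; exists (c2 (+) c1) => v.
  by rewrite permM => /P1[/P2[g2 ->] ->]; rewrite addbA.
apply/AP; move: gl; apply/subsetP; rewrite -[A]/(gval (Group gA)) gen_subG.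
apply/subsetP => h; rewrite in_setU1 => /predU1P[->|/imsetP[p]].
  apply/AP; exists true => v gv; apply: pass_good => //.
  exact: leq_ltn_trans ld.
rewrite inE => pl ->; apply/AP; exists p => -[i t] gd; rewrite hatE /=.
rewrite -odd_permV; apply: good_perm => //; apply: perm_onV.
by apply: subset_trans pl _; apply/subsetP => z; rewrite !inE ltnS => /leq_ltn_trans; apply.
Qed.

(** In the conjugate of [pass] by [a] the sign constants of [a] and of its inverse cancel, and the
    reversal by [pass] remains. *)
Lemma good_turn d (l : V) x : (l < d)%N -> good d (place x) ->
  good d (place (turn_at l x)) /\
  head_sign d (place (turn_at l x)) = ~~ head_sign d (place x).
Proof.
move=> ld gx; have [a al ->] := place_turn l x.
have [c cP] := upper_good ld al.
have [c' c'P] := upper_good ld (groupVr al).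
have [g1 _] := c'P _ gx.
have [g2 s2] := pass_good (leq_ltn_trans (leq0n l) ld) g1.
have [g3 ->] := cP _ g2; split=> //.
by rewrite s2 addbN; congr (~~ _); have [_ <-] := cP _ g1; rewrite permKV.
Qed.

(** An ordered facet is not a proper initial segment of another, by maximality; this makes the
    dimension of a frame well defined. *)
Lemma good_uniq a b v : (a <= m.+1)%N -> (b <= m.+1)%N -> good a v -> good b v -> a = b.
Proof.
have aux c d : (c <= d <= m.+1)%N -> good c v -> good d v -> c = d.
  case/andP => cd dm gc; rewrite /good -(cat_take_drop c (take d _)) take_takel //.
  move/(fl_max gc)/(congr1 size); rewrite size_drop size_take_min size_listing.
  by rewrite (minn_idPl dm) => /eqP; rewrite subn_eq0 => dc; apply/eqP; rewrite eqn_leq cd.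
move=> am bm ga gb; have [ab|/ltnW ba] := leqP a b; first by apply: aux; rewrite ?ab.
by apply/esym/aux; rewrite ?ba.
Qed.

Lemma flag_dim_le v : (flag_dim v <= m.+1)%N.
Proof.
rewrite /flag_dim; case E: [seq _ <- _ | _] => [|d r] //=.
have : d \in d :: r by rewrite inE eqxx.
by rewrite -E mem_filter mem_iota add0n ltnS => /andP[_].
Qed.

Lemma flag_dimE d v : (d <= m.+1)%N -> good d v -> flag_dim v = d.
Proof.
move=> dm gd; rewrite /flag_dim.
have : d \in [seq d <- iota 0 m.+2 | fl v.1 (take d (listing v.2))].
  by rewrite mem_filter mem_iota leq0n add0n ltnS dm !andbT; apply: gd.
case E: [seq _ <- _ | _] => [//|a r] _ /=.
have : a \in a :: r by rewrite inE eqxx.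
by rewrite -E mem_filter mem_iota add0n ltnS => /andP[ga am]; apply: good_uniq gd.
Qed.

Lemma flag_dim_good v : (0 < flag_dim v)%N -> good (flag_dim v) v.
Proof.
rewrite /flag_dim; case E: [seq _ <- _ | _] => [|a r] //= _.
have : a \in a :: r by rewrite inE eqxx.
by rewrite -E mem_filter => /andP[].
Qed.

Lemma flag_dim_turn (l : V) x : (l < flag_dim (place x))%N ->
  flag_dim (place (turn_at l x)) = flag_dim (place x).
Proof.
move=> ld; apply: flag_dimE; first exact: flag_dim_le.
have [] // := good_turn ld (x := x).
by apply: flag_dim_good; apply: leq_ltn_trans ld.
Qed.

Lemma card_flag_level x l : (l < m.+1)%N -> #|flag_level x l| = l.+1.
Proof.
move=> lm; rewrite card_imset; last exact: perm_inj.
have inj : injective (widen_ord lm) by move=> a b e; apply: val_inj; exact: (congr1 val e).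
rewrite -[RHS]card_ord -[RHS](card_imset _ inj); apply: eq_card => z.
rewrite inE; apply/idP/imsetP => [zl|[u _ ->] //=].
by exists (Ordinal zl) => //; apply: val_inj.
Qed.

(** [inord] sends indices beyond [m] to 0. Involutivity and commutation hold there too, and the
    other axioms of a frame system concern indices below [top] only. *)
Definition turn_nat (l : nat) : flag_frame -> flag_frame := turn_at (inord l).

Definition place_dim (x : flag_frame) : nat := flag_dim (place x).

Definition flag_parity (z : flag_vtx_type) (l : nat) : bool := z.2.2 (inord l).

Lemma place_dim_le x : (place_dim x <= m.+1)%N.
Proof. exact: flag_dim_le. Qed.

Lemma place_dim_turn l x : (l < place_dim x)%N -> place_dim (turn_nat l x) = place_dim x.
Proof.
by move=> lx; apply: flag_dim_turn; rewrite inordK // (leq_trans lx) ?flag_dim_le.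
Qed.

Lemma flag_parity_turn l n x : (l < m.+1)%N -> (n < m.+1)%N ->
  flag_parity (flag_vtx (turn_nat l x)) n = (n == l) (+) flag_parity (flag_vtx x) n.
Proof.
move=> lm nm; case: x => [[[v w] D] e]; rewrite /flag_parity /= ffunE.
by congr (_ (+) _); rewrite -val_eqE /= !inordK.
Qed.

Lemma turn_nat_vtx l x y : (l < m.+1)%N -> flag_vtx x = flag_vtx y ->
  flag_level x l = flag_level y l -> flag_vtx (turn_nat l x) = flag_vtx (turn_nat l y).
Proof. by move=> lm v lv; apply: flag_turn_vtx => //; rewrite inordK. Qed.

Lemma turn_nat_level l n x y : (l < m.+1)%N -> (n < m.+1)%N -> flag_vtx x = flag_vtx y ->
  flag_level x l = flag_level y l -> flag_level x n = flag_level y n ->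
  flag_level (turn_nat l x) n = flag_level (turn_nat l y) n.
Proof. by move=> lm _ v lv lv'; apply: flag_turn_level => //; rewrite inordK. Qed.

Lemma flag_level_inj x y l n : (l < place_dim x)%N -> (n < place_dim y)%N ->
  flag_level x l = flag_level y n -> l = n.
Proof.
move=> lx ny; have lm := leq_trans lx (place_dim_le x); have nm := leq_trans ny (place_dim_le y).
by move/(congr1 (fun A : {set V} => #|A|)); rewrite !card_flag_level // => -[].
Qed.

Definition flag_system : frame_system :=
  @FrameSystem flag_frame flag_vtx_type V m.+1 flag_vtx place_dim flag_level turn_nat
    flag_parity place_dim_le (fun l => turn_atK _) (fun l n => turn_atC _ _) place_dim_turn
    flag_parity_turn turn_nat_vtx turn_nat_level flag_level_inj.

Definition head_list (x : flag_frame) : seq V := take (place_dim x) (listing (place x).2).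

Definition flag_sign (x : flag_frame) : bool := sg (place x).1 (head_list x).

Lemma size_head_list x : size (head_list x) = place_dim x.
Proof. by rewrite size_take_min size_listing; apply/minn_idPl/place_dim_le. Qed.

Lemma head_list_uniq x : uniq (head_list x).
Proof. exact/take_uniq/listing_uniq. Qed.

Lemma head_list_fl x : (0 < place_dim x)%N -> fl (place x).1 (head_list x).
Proof. exact: flag_dim_good. Qed.

Lemma flag_sign_turn l x : (l < place_dim x)%N ->
  flag_sign (turn_nat l x) = ~~ flag_sign x.
Proof.
move=> lx; rewrite /flag_sign /head_list place_dim_turn //.
have lx' : ((inord l : V) < place_dim x)%N by rewrite inordK // (leq_trans lx) ?place_dim_le.
by have [] := good_turn lx' (flag_dim_good (leq_ltn_trans (leq0n l) lx)).
Qed.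

Lemma flag_levelE x l : (l < place_dim x)%N -> flag_level x l = [set z in take l.+1 (head_list x)].
Proof.
move=> lx; have lm := leq_trans lx (place_dim_le x).
rewrite /head_list take_takel // /listing -map_take positionsE; apply/setP => z.
rewrite inE; apply/imsetP/mapP => -[y yl ->]; exists y => //.
  rewrite in_take ?mem_enum // index_enum_ord.
  by move: yl; rewrite inE.
by move: yl; rewrite inE in_take ?mem_enum // index_enum_ord.
Qed.

Lemma flag_vtx_place x y : flag_vtx x = flag_vtx y -> (place x).1 = (place y).1.
Proof. by case. Qed.

Lemma head_list_eq x y : place_dim x = place_dim y ->
  (forall l, (l < place_dim x)%N -> flag_level x l = flag_level y l) -> head_list x = head_list y.
Proof.
move=> xy lv; apply: prefix_sets_eq; rewrite ?size_head_list ?head_list_uniq //.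
by move=> j jx; rewrite -!flag_levelE -?xy //; apply: lv.
Qed.

(** In both cases of [prefix_sets_ridge] an orientation changes sign: across a ridge by [fl_ridge],
    under a swap by [fl_swap]. *)
Lemma flag_sign_ridge x y e : flag_vtx x = flag_vtx y -> place_dim x = place_dim y ->
  (e < place_dim x)%N ->
  (forall l, (l < place_dim x)%N -> l != e -> flag_level x l = flag_level y l) ->
  flag_level x e != flag_level y e -> flag_sign y = ~~ flag_sign x.
Proof.
move=> /flag_vtx_place xy dd ed lv ne; rewrite /flag_sign xy.
have fx : fl (place x).1 (head_list x) by apply: head_list_fl; apply: leq_ltn_trans ed.
have fy : fl (place y).1 (head_list y) by apply: head_list_fl; rewrite -dd; apply: leq_ltn_trans ed.
have [||||||[r [a [b [ab sx sy]]]]|[r [a [b [q [sx sy]]]]]] :=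
  @prefix_sets_ridge _ (head_list x) (head_list y) e.
- exact: head_list_uniq.
- exact: head_list_uniq.
- by rewrite !size_head_list.
- by rewrite size_head_list.
- by rewrite size_head_list => j jx je; rewrite -!flag_levelE -?dd //; apply: lv.
- by rewrite -!flag_levelE -?dd.
- by rewrite sx sy; apply: fl_ridge => //; rewrite -?sx -?sy // -xy.
- by rewrite sx sy; apply: (fl_swap _).2; rewrite -sx -xy.
Qed.

Lemma listing_prefix (s : seq V) : uniq s -> exists t, take (size s) (listing t) = s.
Proof.
move=> us; pose r := s ++ [seq x <- enum 'I_m.+1 | x \notin s].
have ur : uniq r.
  rewrite cat_uniq us filter_uniq ?enum_uniq // andbT /=.
  by apply/hasPn => x; rewrite mem_filter => /andP[].
have sr : size r = m.+1.
  rewrite -[RHS](size_enum_ord m.+1); apply/perm_size/uniq_perm; rewrite ?enum_uniq // => x.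
  by rewrite mem_cat mem_filter mem_enum andbT orbN.
have inj : injective (fun x : V => nth ord0 r x).
  move=> x y /eqP; rewrite nth_uniq ?sr // => /eqP; exact: val_inj.
exists (perm inj); rewrite -[RHS](take_size_cat _ (erefl (size s)) : take _ r = s).
congr take; apply: (@eq_from_nth _ ord0); first by rewrite size_listing sr.
move=> j; rewrite size_listing => jm; rewrite (nth_map ord0) positionsE ?size_enum_ord //.
by rewrite permE nth_enum_ord.
Qed.

Lemma flag_frame_exists (z : flag_vtx_type) t : exists x, flag_vtx x = z /\ place x = (z.1, t).
Proof.
(* The vertex and the ordering [t] force [w], and then the base arrangement is the preimage of
   [(i, t)] under [w]. *)
case: z => i [[g D] e]; pose w := g * hat t^-1.
exists (w^-1 (i, t), w, D, e).
have p : place (w^-1 (i, t), w, D, e) = (i, t) by rewrite /place /= permKV.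
by rewrite /flag_vtx p /=; split=> //; rewrite /w -mulgA -hatM mulVg hat1 mulg1.
Qed.

Lemma block_family_inhabited : exists D : block_family, True.
Proof. by have [D DP] := reflections_exist upper lower pass; exists (exist _ D DP). Qed.

End Flags.

(** * Numbering the facets of the given spheres *)

Section FacetLists.
Variable K : scomplex.
Implicit Types s t : seq (vert K).

Lemma facet_list_perm s t : perm_eq s t -> facet_list s = facet_list t.
Proof.
move=> st; rewrite /facet_list (perm_uniq st); congr (_ && maxset _ _).
by apply/setP => x; rewrite !inE (perm_mem st).
Qed.

Lemma facet_list_face s : facet_list s -> [set x in s] \in face K.
Proof. by case/andP => _ /maxsetp. Qed.

Lemma facet_list_max s t : facet_list s -> facet_list (s ++ t) -> t = [::].
Proof.
move=> /andP[us ms] /andP[]; rewrite cat_uniq => /and3P[_ st _] /maxsetp mst.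
case: t st mst => // x t st mst; case/maxsetP: ms => _ /(_ _ mst) e.
have : x \in [set y in s ++ x :: t] by rewrite inE mem_cat inE eqxx orbT.
rewrite e ?inE => [xs|]; first by rewrite /= xs in st.
by apply/subsetP => y; rewrite !inE mem_cat => ->.
Qed.

Variable o : seq (vert K) -> bool.
Hypothesis oP : orientation o.

Lemma orientation_front s1 a s2 : facet_list (s1 ++ a :: s2) ->
  o (s1 ++ a :: s2) = odd (size s1) (+) o (a :: s1 ++ s2).
Proof.
elim/last_ind: s1 s2 => //= s1 c IH s2; rewrite -cats1 -!catA /= => f.
rewrite (oP.1 s1 a c s2); last by rewrite -(@facet_list_perm (s1 ++ [:: c, a & s2])) // perm_cat2l (perm_catCA [:: c] [:: a]).
rewrite IH; last by rewrite -(@facet_list_perm (s1 ++ [:: c, a & s2])) // perm_cat2l (perm_catCA [:: c] [:: a]).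
by rewrite size_cat addn1 /= addNb.
Qed.

(** An orientation compares first entries; moving the last entry to the front costs the same sign
    for [a] and for [b]. *)
Lemma orientation_ridge s a b : a != b -> facet_list (rcons s a) -> facet_list (rcons s b) ->
  o (rcons s b) = ~~ o (rcons s a).
Proof.
have front x : facet_list (s ++ [:: x]) -> facet_list (x :: s).
  by rewrite (@facet_list_perm _ (x :: s)) // -cat1s perm_catC.
rewrite -!cats1 => ab fa fb; rewrite !orientation_front // !cats0.
by rewrite (oP.2 a b s ab) ?addbN // front.
Qed.
End FacetLists.

Lemma isomorphism_facet K L (f : vert K -> vert L) s : isomorphism f ->
  facet_list s -> facet_list (map f s).
Proof.
move=> [[g fK gK] ff] /andP[us /maxsetP[fs ms]].
have fi := can_inj fK.
have fset (t : seq (vert K)) : [set x in map f t] = f @: [set x in t].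
  apply/setP => x; rewrite inE; apply/mapP/imsetP => -[y yt ->]; exists y => //.
    by rewrite inE.
  by rewrite inE in yt.
rewrite /facet_list map_inj_uniq // us fset; apply/maxsetP; split; first by rewrite ff.
move=> B BL sB; have BE : B = f @: (g @: B).
  by rewrite -imset_comp -[LHS]imset_id; apply: eq_imset => x /=; rewrite gK.
rewrite BE; suff -> : g @: B = [set x in s] by [].
apply: ms; first by rewrite -ff -BE.
apply/subsetP => x xs; rewrite -[x]fK imset_f //; apply: (subsetP sB).
exact: imset_f.
Qed.

(** * Facets of a link *)

Section LinkFacets.
Variables (K : scomplex) (v : vert K).

Lemma link_facetP s : facet_list (v :: s) ->
  exists2 r : seq (vert (link v)), s = map val r & facet_list r.
Proof.
move=> fs; have /andP[/= /andP[vs us] /maxsetP[ff mf]] := fs.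
have lk w : w \in s -> (w != v) && ([set v; w] \in face K).
  move=> ws; rewrite (contraNneq _ vs) => [|<- //]; apply: face_sub ff.
  by apply/subsetP => x; rewrite !inE => /orP[->|/eqP ->]; rewrite ?ws ?orbT.
pose r : seq (vert (link v)) := pmap insub s.
have sr : s = map val r.
  rewrite pmap_filter; last exact: insubK.
  by apply/esym/all_filterP/allP => w /lk; rewrite isSome_insub.
have setE : [set x in v :: s] = v |: [set val w | w in [set x in r]].
  apply/setP => x; rewrite !inE sr; congr (_ || _); apply/mapP/imsetP => -[y yr ->]; exists y => //.
    by rewrite inE.
  by rewrite inE in yr.
exists r => //; apply/andP; split; first by rewrite sr map_inj_uniq // in us; apply: val_inj.
apply/maxsetP; split; first by rewrite inE -setE.
move=> B; rewrite inE => BK rB; apply/eqP; rewrite eqEsubset rB andbT.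
have /mf e : v |: [set val w | w in B] \in face K by [].
apply/subsetP => x xB; have : val x \in v |: [set val w | w in B].
  by rewrite inE orbC imset_f.
rewrite e; last by rewrite setE; apply/setUS/imsetS.
have /andP[/negbTE xv _] := valP x.
by rewrite !inE xv sr mem_map //; apply: val_inj.
Qed.

Lemma facet_of_link (r : seq (vert (link v))) : facet_list r -> facet_list (v :: map val r).
Proof.
case/andP=> ur /maxsetP[]; rewrite inE => rK mr.
have setE : [set x in v :: map val r] = v |: [set val w | w in [set x in r]].
  apply/setP => x; rewrite !inE; congr (_ || _); apply/mapP/imsetP => -[y yr ->]; exists y => //.
    by rewrite inE.
  by rewrite inE in yr.
apply/andP; split.
  rewrite /= map_inj_uniq ?ur ?andbT; last exact: val_inj.
  by apply/mapP => -[w _ e]; have /andP[/eqP n _] := valP w; apply/n/esym.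
rewrite setE; apply/maxsetP; split=> // B BK rB.
have vB : v \in B by apply: (subsetP rB); rewrite !inE eqxx.
pose B0 := [set w : vert (link v) | val w \in B].
have BE : B = v |: [set val w | w in B0].
  apply/setP => x; rewrite inE in_set1; have [->|xv] := eqVneq x v; first by rewrite vB.
  apply/idP/imsetP => [xB|[w]]; last by rewrite inE => wB ->.
  have xl : (x != v) && ([set v; x] \in face K).
    by rewrite xv (face_sub _ BK) //; apply/subsetP => z; rewrite !inE => /orP[] /eqP ->.
  by exists (Sub x xl); rewrite ?inE SubK.
rewrite BE (mr B0) ?inE -?BE //; apply/subsetP => w; rewrite !inE => wr.
by apply: (subsetP rB); rewrite !inE (imset_f val) ?orbT // inE.
Qed.
End LinkFacets.

(** * Numbering the vertices and extending the pairing to permutations *)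

Section Star.
Variables (k : nat) (Y : 'I_k -> scomplex) (o : forall i, seq (vert (Y i)) -> bool).
Local Notation Vt := {i : 'I_k & vert (Y i)}.
Local Notation m := #|{: Vt}|.
Local Notation V := 'I_m.+1.

(* The last number is unused; it makes the type nonempty. *)
Definition vid (p : Vt) : V := widen_ord (leqnSn _) (enum_rank p).

Lemma vid_inj : injective vid.
Proof. by move=> p q /(congr1 val) /= /val_inj /enum_rank_inj. Qed.

Definition vnum i (v : vert (Y i)) : V := vid (Tagged (fun i => vert (Y i)) v).

Lemma vnum_inj i : injective (@vnum i).
Proof. by move=> v w /vid_inj /eqP; rewrite -tag_eqE /tag_eq eqxx tagged_asE /= => /eqP. Qed.

Definition pull i (z : V) : option (vert (Y i)) := [pick v | vnum v == z].

Lemma vnumK i (v : vert (Y i)) : pull i (vnum v) = Some v.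
Proof.
rewrite /pull; case: pickP => [w /eqP/vnum_inj -> //|/(_ v)].
by rewrite eqxx.
Qed.

Lemma pullK i z v : pull i z = Some v -> vnum v = z.
Proof. by rewrite /pull; case: pickP => // w /eqP e [<-]. Qed.

Definition owner (z : V) : option Vt := [pick p | vid p == z].

Lemma vidK p : owner (vid p) = Some p.
Proof.
by rewrite /owner; case: pickP => [q /eqP/vid_inj -> //|/(_ p)]; rewrite eqxx.
Qed.

Definition owner_index (z : V) : option 'I_k := omap tag (owner z).

Definition pulls i (s : seq V) : seq (vert (Y i)) := pmap (pull i) s.

Lemma pullsK i s : pulls i (map (@vnum i) s) = s.
Proof. by elim: s => //= v s IH; rewrite /pulls /= vnumK /= -/(pulls _ _) IH. Qed.

Definition num_facet i (s : seq V) : bool := all (fun z => pull i z) s && facet_list (pulls i s).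

Definition num_sign i (s : seq V) : bool := o (pulls i s).

Lemma num_facetP i s : reflect (exists2 r, s = map (@vnum i) r & facet_list r) (num_facet i s).
Proof.
apply: (iffP andP) => [[h f]|[r -> f]]; last first.
  by rewrite pullsK; split=> //; apply/allP => z /mapP[v _ ->]; rewrite vnumK.
exists (pulls i s) => //; elim: s h {f} => //= z s IH /andP[].
rewrite /pulls /=; case E: (pull i z) => [v|] //= _ /IH {1}->.
by rewrite (pullK E).
Qed.

Lemma map_eq_cat (A B : Type) (f : A -> B) s r1 r2 : map f s = r1 ++ r2 ->
  exists s1 s2, [/\ s = s1 ++ s2, map f s1 = r1 & map f s2 = r2].
Proof.
move=> e; exists (take (size r1) s), (drop (size r1) s).
by rewrite cat_take_drop map_take map_drop e take_size_cat // drop_size_cat.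
Qed.

Lemma num_facet_owner i s z : num_facet i s -> z \in s -> owner_index z = Some i.
Proof. by case/num_facetP => r -> _ /mapP[v _ ->]; rewrite /owner_index vidK. Qed.

Hypothesis oP : forall i, orientation (@o i).

Lemma num_facet_swap i s1 a b s2 : num_facet i (s1 ++ a :: b :: s2) ->
  num_facet i (s1 ++ b :: a :: s2) /\
  num_sign i (s1 ++ b :: a :: s2) = ~~ num_sign i (s1 ++ a :: b :: s2).
Proof.
case/num_facetP => r /esym/map_eq_cat[r1 [[|a' [|b' r2]]]] [-> <-] //= [<- <- <-] f.
have E x y : map (@vnum i) r1 ++ vnum x :: vnum y :: map (@vnum i) r2 =
    map (@vnum i) (r1 ++ x :: y :: r2) by rewrite map_cat.
rewrite !E; split; last by rewrite /num_sign !pullsK (oP i).1.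
apply/num_facetP; exists (r1 ++ b' :: a' :: r2) => //.
by rewrite -(@facet_list_perm _ (r1 ++ [:: a', b' & r2])) // perm_cat2l (perm_catCA [:: a'] [:: b']).
Qed.

Lemma num_facet_max i s s' : num_facet i s -> num_facet i (s ++ s') -> s' = [::].
Proof.
case/num_facetP => r -> f /num_facetP[r' /esym/map_eq_cat[r1 [r2 [-> /(inj_map (@vnum_inj i)) -> <-]]]].
by move/(facet_list_max f) => ->.
Qed.

Lemma num_facet_ridge i s a b : a != b -> num_facet i (rcons s a) -> num_facet i (rcons s b) ->
  num_sign i (rcons s b) = ~~ num_sign i (rcons s a).
Proof.
rewrite -!cats1 => ab /num_facetP[r /esym/map_eq_cat[r1 [[|a' [|? ?]] [-> <- //= [ea]]]] fa].
case/num_facetP => q /esym/map_eq_cat[q1 [[|b' [|? ?]] [-> /(inj_map (@vnum_inj i)) -> //= [eb]]]] fb.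
have E x : map (@vnum i) r1 ++ [:: vnum x] = map (@vnum i) (rcons r1 x).
  by rewrite map_rcons cats1.
rewrite -ea -eb !E /num_sign !pullsK.
move: fa fb; rewrite !cats1 => fa fb; apply: orientation_ridge => //.
by move: ab; rewrite -ea -eb; apply: contraNneq => ->.
Qed.

Definition star_reversal (p q : Vt) (F : {perm V}) : Prop :=
  F (vid p) = vid q /\
  forall s, facet_list (tagged p :: s) -> exists s',
    [/\ map F (map (@vnum (tag p)) s) = map (@vnum (tag q)) s',
        facet_list (tagged q :: s') & o (tagged q :: s') = ~~ o (tagged p :: s)].

(** A facet through a vertex is that vertex followed by a facet of its link, and the sign on the
    link is defined with the vertex in front. *)
Lemma star_reversal_of_links (p q : Vt) (F : {perm V})
    (f : vert (link (tagged p)) -> vert (link (tagged q))) :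
  F (vid p) = vid q -> (forall w, F (vnum (val w)) = vnum (val (f w))) ->
  isomorphism f ->
  (forall s, facet_list s ->
     link_sgn (v := tagged q) (@o (tag q)) (map f s) = ~~ link_sgn (v := tagged p) (@o (tag p)) s) ->
  star_reversal p q F.
Proof.
move=> Fp Fw fi fo; split=> // s /link_facetP[r -> fr].
exists (map val (map f r)); split.
- by rewrite -!map_comp; apply: eq_map => w /=; apply: Fw.
- by apply/facet_of_link/isomorphism_facet.
- exact: fo.
Qed.

(** The images of [f] and [g] are completed to listings [t] and [u] of all numbers; [t^-1 * u]
    carries the first to the second. *)
Lemma perm_extend (T : finType) (f g : T -> V) : injective f -> injective g ->
  exists F : {perm V}, forall x, F (f x) = g x.
Proof.
move=> fi gi.
have [t tE] := listing_prefix (s := map f (enum T)) (etrans (map_inj_uniq fi _) (enum_uniq T)).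
have [u uE] := listing_prefix (s := map g (enum T)) (etrans (map_inj_uniq gi _) (enum_uniq T)).
exists (t^-1 * u)%g => x.
have key (h : T -> V) (w : {perm V}) : take (size (map h (enum T))) (listing w) = map h (enum T) ->
    h x = w (nth ord0 (positions m) (index x (enum T))).
  have xT : (index x (enum T) < size (enum T))%N by rewrite index_mem mem_enum.
  move/(congr1 (fun s => nth ord0 s (index x (enum T)))).
  rewrite (nth_map x) // nth_index ?mem_enum // => <-.
  rewrite nth_take; last by rewrite size_map.
  rewrite (nth_map ord0) // -(size_map w) -/(listing w) size_listing.
  apply: leq_trans xT _; rewrite -cardE -[X in (_ <= X)%N]card_ord.
  exact: (leq_card _ fi).
by rewrite permM (key f t tE) permK (key g u uE).
Qed.

Hypothesis bal : balanced o.

Lemma balanced_reversal : exists (mu : Vt -> Vt) (F : Vt -> {perm V}),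
  [/\ involutive mu, forall p, star_reversal p (mu p) (F p) & forall p, F (mu p) = (F p)^-1%g].
Proof.
have [mu [muK muN anti]] := bal; exists mu.
have star p : exists F : {perm V}, star_reversal p (mu p) F /\ star_reversal (mu p) p F^-1%g.
  have [f [fi fo]] := anti p; have [[g fK gK] ff] := fi.
  (* [None] stands for the vertex [q] itself, so [e q] numbers all vertices of its star. *)
  pose e (q : Vt) (w : option (vert (link (tagged q)))) : V :=
    if w is Some w' then vnum (val w') else vid q.
  have ei q : injective (e q).
    have ne (w : vert (link (tagged q))) : vnum (val w) <> vid q.
      case: q w => i v w /vnum_inj e_w; have /andP[/eqP n _] := valP w; exact: n.
    by move=> [w|] [w'|] //= => [/vnum_inj/val_inj -> // |/ne|/esym/ne].
  have omap_inj : injective (omap f : option (vert (link (tagged p))) -> _) by move=> [w|] [w'|] //= [/(can_inj fK) ->].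
  have [F FE] := @perm_extend _ (e p) (fun w => e (mu p) (omap f w)) (ei p) (inj_comp (ei (mu p)) omap_inj).
  have gi : isomorphism g.
    split; first by exists f.
    move=> s; rewrite -ff; suff -> : [set f x | x in [set g y | y in s]] = s by [].
    by rewrite -imset_comp -[RHS]imset_id; apply: eq_imset => x /=; rewrite gK.
  exists F; split.
    apply: (@star_reversal_of_links p (mu p) F f _ _ fi fo); first exact: (FE None).
    by move=> w; apply: (FE (Some w)).
  apply: (@star_reversal_of_links (mu p) p F^-1%g g) => //.
  - by rewrite -[RHS](permK F) (FE None).
  - by move=> w; rewrite -[RHS](permK F) (FE (Some (g w))) /= gK.
  - move=> s fs; have := fo _ (isomorphism_facet gi fs).
    by rewrite mapK // => ->; rewrite negbK.
have [F0 F0P] := fin_all_exists star.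
(* In each pair the vertex of smaller rank keeps its permutation and its partner gets the inverse;
   there is exactly one such vertex because [mu] has no fixed points. *)
exists (fun p => if (enum_rank p < enum_rank (mu p))%N then F0 p else (F0 (mu p))^-1%g).
split=> // p; first by case: ifP => _; [case: (F0P p)|have [_] := F0P (mu p); rewrite muK].
rewrite muK; case: ltngtP => [_|_|/val_inj/enum_rank_inj e]; rewrite ?invgK //.
by have /eqP[] := muN p.
Qed.

Lemma numbered_star_exists : exists F : V -> {perm V},
  (forall z, F (F z z) = (F z)^-1%g) /\
  forall i y s, num_facet i (y :: s) -> exists j,
    [/\ owner_index (F y y) = Some j, num_facet j (map (F y) (y :: s)) &
        num_sign j (map (F y) (y :: s)) = ~~ num_sign i (y :: s)].
Proof.
have [mu [F [muK star Finv]]] := balanced_reversal.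
exists (fun z => if owner z is Some p then F p else 1%g); split=> [z|i y s].
  case E: (owner z) => [p|]; last by rewrite perm1 E invg1.
  have -> : z = vid p by move: E; rewrite /owner; case: pickP => // q /eqP <- [->].
  by have [-> _] := star p; rewrite vidK Finv.
case/num_facetP => -[//|v r] [-> ->] fr; rewrite {1 2 3}/vnum !vidK.
set p : Vt := Tagged (fun i => vert (Y i)) v; have [Fp Fs] := star p; exists (tag (mu p)).
have [s' [e fs' os']] := Fs r fr.
have mapE : map (F p) (vid p :: map (@vnum i) r) = map (@vnum (tag (mu p))) (tagged (mu p) :: s').
  rewrite /= Fp; congr (_ :: _); last exact: e.
  by case: (mu p).
split; first by rewrite Fp /owner_index vidK.
  by rewrite mapE; apply/num_facetP; exists (tagged (mu p) :: s').
rewrite mapE /num_sign pullsK os'; congr (~~ o _).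
exact: esym (pullsK (v :: r)).
Qed.
End Star.

(** * Flags and barycentric weights *)

Section InversionParity.
Implicit Types s : seq nat.

Lemma inv_parity_swap s1 a b s2 : a != b ->
  inv_parity (s1 ++ b :: a :: s2) = ~~ inv_parity (s1 ++ a :: b :: s2).
Proof.
move=> ab; elim: s1 => [|c s1 IH] /=.
  rewrite !oddD !oddb; case: (odd (count _ _)); case: (odd (count _ _)); case: inv_parity;
  by move: ab; case: ltngtP.
rewrite IH addbN; congr (~~ (odd _ (+) _)).
by apply/seq.permP; rewrite perm_cat2l (perm_catCA [:: b] [:: a]).
Qed.

Lemma inv_parity_succ s : inv_parity (map succn s) = inv_parity s.
Proof.
elim: s => //= a s ->; congr (odd _ (+) _).
by rewrite count_map; apply: eq_count => b /=; rewrite ltnS.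
Qed.
End InversionParity.

(** * The sign of a simplex of the subdivision *)

Section FlagSigns.
Variables (K : scomplex) (o : seq (vert K) -> bool).

Lemma card_prefix (r : seq (vert K)) j : uniq r -> (j < size r)%N ->
  #|[set x in take j.+1 r]| = j.+1.
Proof.
move=> ur jr; rewrite cardsE; have /card_uniqP -> := take_uniq j.+1 ur.
by rewrite size_take_min; apply/minn_idPl.
Qed.

(** The largest member of the flag of [r] forces the entries of [t] to be distinct; afterwards each
    member is located by its cardinality. *)
Lemma flag_inj (r t : seq (vert K)) : uniq r -> perm_eq (flag r) (flag t) -> r = t.
Proof.
move=> ur rt; have sz : size r = size t.
  by have := perm_size rt; rewrite !size_map !size_iota.
have [n0|n0] := posnP (size r).
  by rewrite (size0nil n0); apply/esym/size0nil; rewrite -sz.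
have rin : [set x in r] \in flag t.
  rewrite -(perm_mem rt); apply/mapP; exists (size r).-1; rewrite ?prednK ?take_size //.
  by rewrite mem_iota /= add0n prednK.
have ut : uniq t.
  case/mapP: rin => j; rewrite mem_iota add0n => /andP[_ jt] e.
  have : (#|[set x in r]| <= #|[set x in t]|)%N.
    by rewrite e; apply/subset_leq_card/subsetP => x; rewrite !inE => /mem_take.
  rewrite !cardsE (card_uniqP ur) sz => le.
  by apply/card_uniqP/eqP; rewrite eqn_leq card_size le.
apply: prefix_sets_eq => // j jr.
have : [set x in take j.+1 r] \in flag t.
  by rewrite -(perm_mem rt); apply/mapP; exists j; rewrite ?mem_iota.
case/mapP => l; rewrite mem_iota add0n => /andP[_ lt] e; rewrite e.
have := congr1 (fun A : {set _} => #|A|) e.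
by rewrite !card_prefix // => -[->].
Qed.

(** By [flag_inj] only [r] can be the tuple in [sd_sgn], and the cardinalities along [s] are the
    indices [js] shifted by one, which preserves inversions. *)
Lemma sd_sgn_flag (r : seq (vert K)) (js : seq nat) (s : seq (vert (sd K))) :
  uniq r -> perm_eq js (iota 0 (size r)) ->
  map val s = [seq [set x in take j.+1 r] | j <- js] ->
  sd_sgn o s = o r (+) inv_parity js.
Proof.
move=> ur pj es.
have szs : size s = size r by rewrite -(size_map val) es size_map (perm_size pj) size_iota.
have pf : perm_eq (map val s) (flag r) by rewrite es perm_map.
have cards : [seq #|val a| | a : vert (sd K) <- s] = map succn js.
  rewrite (map_comp (fun A : {set vert K} => #|A|) val) es -map_comp.
  apply/eq_in_map => j jj /=; rewrite card_prefix //.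
  by move: jj; rewrite (perm_mem pj) mem_iota.
rewrite /sd_sgn cards inv_parity_succ; apply/existsP/idP => [[t /andP[pt ot]]|b].
  rewrite (@flag_inj r t) // (perm_trans _ pt) //.
  by rewrite perm_sym.
have sr : size r == size s by rewrite szs.
by exists (Tuple sr); rewrite /= pf.
Qed.
End FlagSigns.

Lemma sorted_filter_cat (T : Type) (leT : rel T) (a : pred T) (r : seq T) :
  transitive leT -> (forall x y, a y -> ~~ a x -> ~~ leT x y) -> sorted leT r ->
  r = filter a r ++ filter (predC a) r.
Proof.
move=> tr h; elim: r => //= x r IH px; have sr := path_sorted px.
case ax: (a x) => /=; first by rewrite -IH.
suff -> : filter a r = [::].
  rewrite /=; congr (_ :: _).
  suff : all (predC a) r by move/all_filterP.
  apply: sub_all (order_path_min tr px) => y xy /=.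
  by apply: contraL xy => ay; apply: h; rewrite ?ax.
have : all (predC a) r.
  apply: sub_all (order_path_min tr px) => y xy /=.
  by apply: contraL xy => ay; apply: h; rewrite ?ax.
elim: (r) => //= y q IHq /andP[/negbTE -> /IHq //].
Qed.

(** * Every chain of faces lies in a full flag *)

Section FlagExtension.
Variable K : scomplex.

Lemma face_in_facet (A : {set vert K}) : A \in face K ->
  exists2 B : {set vert K}, maxset (fun t => t \in face K) B & A \subset B.
Proof. by case/maxset_exists => B mB AB; exists B. Qed.

Lemma sorted_facet (leT : rel (vert K)) (A : {set vert K}) : A \in face K ->
  total leT -> exists r, [/\ facet_list r, A \subset [set x in r] & sorted leT r].
Proof.
move=> /face_in_facet[B mB AB] tot; exists (sort leT (enum B)).
have setE : [set x in sort leT (enum B)] = B.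
  by apply/setP => x; rewrite inE mem_sort mem_enum.
by rewrite /facet_list sort_uniq enum_uniq setE sort_sorted.
Qed.

(** Order the vertices by decreasing number of members of the chain that contain them: vertices of a
    member then precede all others, so each member is an initial segment. *)
Lemma chain_in_flag (c : {set vert (sd K)}) : c \in face (sd K) ->
  exists2 r : seq (vert K), facet_list r &
    forall s, s \in c -> exists2 l, (l < size r)%N & val s = [set x in take l.+1 r].
Proof.
move=> /sd_faceP ch; pose n v := #|[set s in c | v \in val s]|.
have [A AK cA] : exists2 A, A \in face K & forall s : vert (sd K), s \in c -> val s \subset A.
  have [->|/set0Pn[s0 s0c]] := eqVneq c set0.
    by exists set0; [exact: face0|move=> s; rewrite inE].
  have [s sc smax] := arg_maxnP (fun s : vert (sd K) => #|val s|) s0c.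
  exists (val s) => [|t tc]; first by case/andP: (valP s).
  case/orP: (ch _ _ sc tc) => // st.
  suff /eqP -> : val t == val s by [].
  by rewrite eq_sym eqEcard st; apply: smax.
have tot : total (fun v w => n w <= n v)%N by move=> v w; apply: leq_total.
have [r [fr Ar sr]] := sorted_facet AK tot; exists r => // s sc.
have ur : uniq r by case/andP: fr.
have sub : val s \subset [set x in r] := subset_trans (cA s sc) Ar.
have tr : transitive (fun v w => n w <= n v)%N by move=> v w u wv uv; apply: leq_trans uv wv.
have h x y : y \in val s -> x \notin val s -> ~~ (n y <= n x)%N.
  move=> ys xs; rewrite -ltnNge; apply: proper_card; apply/properP; split.
    apply/subsetP => t; rewrite !inE => /andP[tc xt]; rewrite tc.
    case/orP: (ch _ _ sc tc) => [/subsetP -> //|/subsetP/(_ x xt) xs'].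
    by rewrite xs' in xs.
  by exists s; rewrite !inE sc ?ys.
have rE := sorted_filter_cat (a := fun v => v \in val s) tr h sr.
have /andP[_ s0] := valP s.
have fE : [set x in filter (fun v => v \in val s) r] = val s.
  apply/setP => x; rewrite inE mem_filter andb_idr // => xs.
  by have := subsetP sub x xs; rewrite inE.
have sz : size (filter (fun v => v \in val s) r) = #|val s|.
  by rewrite -[in RHS]fE cardsE; apply/esym/card_uniqP/filter_uniq.
have cs : (0 < #|val s|)%N by rewrite card_gt0.
exists #|val s|.-1.
  by rewrite prednK // rE size_cat sz leq_addr.
by rewrite prednK // rE take_size_cat // fE.
Qed.
End FlagExtension.

(** * Injectivity of the map from the subdivision to the complex *)

Section ChainWeights.
Local Open Scope ring_scope.
Import Order.TTheory GRing.Theory Num.Theory.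
Variables (R : realFieldType) (T : finType).
Implicit Types (y : {set T} -> R) (s t : {set T}).

Definition chain_weight y : Prop :=
  [/\ forall s, 0 <= y s, y set0 = 0 &
      forall s t, y s != 0 -> y t != 0 -> (s \subset t) || (t \subset s)].

(** The coordinate at [v] of the combination of the barycenters of the sets [s] with coefficients
    [y s]. *)
Definition barycentric_sum y (v : T) : R := \sum_(s : {set T} | v \in s) y s / #|s|%:R.

(** At a largest set where the weights differ, some vertex of it lies in no other set of the support
    of the smaller weight except larger ones, where the weights agree. The sums at that vertex
    differ. *)
Lemma chain_weight_inj y y' : chain_weight y -> chain_weight y' ->
  barycentric_sum y =1 barycentric_sum y' -> y =1 y'.
Proof.
have step z z' s : chain_weight z -> chain_weight z' ->
    (forall t, (#|s| < #|t|)%N -> z t = z' t) -> z' s < z s ->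
    ~ (barycentric_sum z =1 barycentric_sum z').
  move=> [z0 ze zc] [z'0 z'e z'c] big lt eqb.
  have /set0Pn[v vs] : s != set0.
    by apply: contraTneq lt => ->; rewrite ze z'e ltxx.
  have [w ws wP] : exists2 w, w \in s & forall t, z' t != 0 -> t != s -> w \in t -> (#|s| < #|t|)%N.
    pose bad t := [&& z' t != 0, t != s & (#|t| <= #|s|)%N].
    have [t0 bt0|none] := pickP bad; last first.
      exists v => // t t0 ts _; rewrite ltnNge; apply/negP => le.
      by have := none t; rewrite /bad t0 ts le.
    (* The bad sets form a chain, so a vertex of [s] outside the largest of them avoids them all. *)
    have [t bt tmax] := arg_maxnP (fun t : {set T} => #|t|) bt0.
    have /and3P[nz ts le] := bt.
    have /subsetPn[w ws wt] : ~~ (s \subset t).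
      by apply: contra ts => st; rewrite eq_sym eqEcard st.
    exists w => // u uz us wu; rewrite ltnNge; apply/negP => ule.
    have ub : bad u by rewrite /bad uz us.
    case/orP: (z'c _ _ nz uz) => [tu|/subsetP/(_ w wu) wt']; last by rewrite wt' in wt.
    suff ut : t = u by rewrite ut wu in wt.
    by apply/eqP; rewrite eqEcard tu; apply: tmax.
  have : 0 < barycentric_sum z w - barycentric_sum z' w.
    rewrite /barycentric_sum -sumrB (bigD1 s) //= ltr_pwDl //.
      rewrite -mulrBl divr_gt0 ?subr_gt0 // ltr0n card_gt0.
      by apply/set0Pn; exists w.
    apply: sumr_ge0 => t /andP[wt ts]; rewrite -mulrBl mulr_ge0 ?invr_ge0 ?ler0n //.
    have [z't|z't] := eqVneq (z' t) 0; first by rewrite z't subr0.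
    by rewrite big ?subrr // wP.
  by rewrite eqb subrr ltxx.
move=> cy cy' eqb s; apply/eqP/negPn/negP => ne.
have [t ht tmax] := @arg_maxnP _ s (fun t => y t != y' t) (fun t => #|t|) ne.
have big (u : {set T}) : (#|t| < #|u|)%N -> y u = y' u.
  by move=> tu; apply/eqP; apply: contraTT tu => /tmax; rewrite -leqNgt.
case: (ltgtP (y t) (y' t)) ht => // lt _.
  have eqb' : barycentric_sum y' =1 barycentric_sum y by move=> v; rewrite eqb.
  by case: (step y' y t cy' cy _ lt eqb') => u /big.
by case: (step y y' t cy cy' big lt eqb).
Qed.
End ChainWeights.

(** * Corners and links *)

Section Corners.
Local Open Scope ring_scope.
Import Order.TTheory GRing.Theory Num.Theory.
Variables (R : realType) (F : frame_system).
Local Notation X := (complex_of R F).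
Implicit Types (c : corner X).

Definition corner_code c : nat -> bool := ext false (tagged c).

(** The frame of the same cube that has [c] as its distinguished corner. *)
Definition corner_frame c : frame F := turns (corner_code c) (tag c).

Lemma corner_inside c : inside (corner_code c) (tag c : frame F).
Proof.
move=> l; rewrite /corner_code; case: (ltnP l (dim (tag c : frame F))) => // cl.
by rewrite ext_out.
Qed.

Lemma dim_corner_frame c : dim (corner_frame c) = cdim (tag c).
Proof. exact/dim_turns/corner_inside. Qed.

Lemma coords_from_corner c (u : {ffun 'I_(cdim (tag c)) -> R}) l :
  coords (from_corner (tagged c) u) l = from (corner_code c) (coords u) l.
Proof.
rewrite /corner_code /coords /from; case: (ltnP l (cdim (tag c))) => cl.
  by rewrite !ext_lt ffunE.
by rewrite !ext_out.
Qed.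

Lemma from_corner_coords c (u : {ffun 'I_(cdim (tag c)) -> R}) l :
  from (corner_code c) (coords (from_corner (tagged c) u)) l = coords u l.
Proof. by rewrite (eq_from _ (coords_from_corner _ _)) fromK. Qed.

Lemma eqv_from_corner_intro c c' (u : {ffun 'I_(cdim (tag c)) -> R})
    (u' : {ffun 'I_(cdim (tag c')) -> R}) :
  vtx (corner_frame c) = vtx (corner_frame c') ->
  coords u =1 coords u' ->
  (forall l, coords u l != 0 -> level (corner_frame c) l = level (corner_frame c') l) ->
  eqv (cpt (from_corner (tagged c) u) : cube_pt R (@cdim R X))
      (cpt (from_corner (tagged c') u') : cube_pt R (@cdim R X)).
Proof.
move=> v uu lv; exists (corner_code c), (corner_code c').
split=> /= [||l|]; [exact: corner_inside|exact: corner_inside| |].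
  by rewrite !from_corner_coords.
by split=> // l; rewrite from_corner_coords; apply: lv.
Qed.

(** The viewpoints [b] and [b'] that witness an equivalence need not be the corners [c] and [c']. If
    they differ from them along the same axes, they can be turned back, provided the point is not at
    the far end of these axes. *)
Lemma same_point_corner c c' (u : {ffun 'I_(cdim (tag c)) -> R})
    (u' : {ffun 'I_(cdim (tag c')) -> R}) b b' :
  @same_point R F (tag c) (tag c') b b' (coords (from_corner (tagged c) u))
    (coords (from_corner (tagged c') u')) ->
  (forall l, b l (+) corner_code c l = b' l (+) corner_code c' l) ->
  (forall l, b l (+) corner_code c l -> coords u l != 1) ->
  coords u =1 coords u' /\
  agree (fun l => (b l (+) corner_code c l) || (coords u l != 0))
    (corner_frame c) (corner_frame c').
Proof.
move=> sp ff u1; have [bx b'y pq _] := sp.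
have fromE d (v : {ffun 'I_(cdim (tag d)) -> R}) a l :
    from a (coords (from_corner (tagged d) v)) l =
    from (fun l => a l (+) corner_code d l) (coords v) l.
  by rewrite fromD; apply/eq_from/coords_from_corner.
have uu l : coords u l = coords u' l.
  have := pq l; rewrite !fromE /from ff; case: ifP => // _.
  by move/(congr1 (fun t => 1 - t)); rewrite !subKr.
split=> //.
have fp l : b l (+) corner_code c l ->
    from b (coords (from_corner (tagged c) u)) l != 0.
  by move=> fl; rewrite fromE /from fl subr_eq0 eq_sym u1.
have [_ _ _] := same_point_turns sp fp.
rewrite (eq_turns (b' := corner_code c)); last by move=> l _; case: (b l); case: (corner_code c l).
rewrite [X in agree _ _ X](eq_turns (b' := corner_code c')); last first.
  by move=> l _; rewrite ff; case: (b' l); case: (corner_code c' l).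
apply: agree_sub => l /orP[/fp //|ul].
case fl: (b l (+) corner_code c l); first exact: fp.
by rewrite fromE /from fl.
Qed.

(** Comparing the parities of the two vertices shows that the witnessing viewpoints differ from [c]
    and [c'] along the same axes. *)
Lemma eqv_from_corner c c' (u : {ffun 'I_(cdim (tag c)) -> R})
    (u' : {ffun 'I_(cdim (tag c')) -> R}) :
  vtx (corner_frame c) = vtx (corner_frame c') -> (forall l, coords u l != 1) ->
  eqv (cpt (from_corner (tagged c) u) : cube_pt R (@cdim R X))
      (cpt (from_corner (tagged c') u') : cube_pt R (@cdim R X)) ->
  coords u =1 coords u' /\
  forall l, coords u l != 0 -> level (corner_frame c) l = level (corner_frame c') l.
Proof.
move=> v u1 [b [b' /= sp]]; have [bx b'y pq [vb _]] := sp.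
have ff l : b l (+) corner_code c l = b' l (+) corner_code c' l.
  have [lt|tl] := ltnP l (top F).
    have := congr1 (fun v => parity v l) v; have := congr1 (fun v => parity v l) vb.
    rewrite /corner_frame !parity_turns //.
    move: (parity (vtx (tag c : frame F)) l) (parity (vtx (tag c' : frame F)) l) => p p'.
    by case: (b l); case: (b' l); case: (corner_code c l); case: (corner_code c' l); case: p; case: p'.
  have out (x : frame F) a : inside a x -> a l = false.
    by move=> ai; apply/negP => /ai/lt_top; rewrite ltnNge tl.
  by rewrite (out _ _ bx) (out _ _ b'y) (out _ _ (@corner_inside c)) (out _ _ (@corner_inside c')).
have [uu [_ lv]] := same_point_corner sp ff (fun l _ => u1 l).
by split=> // l ul; apply: lv; rewrite ul orbT.
Qed.

Lemma same_vertexE c c' : same_vertex c c' <-> vtx (corner_frame c) = vtx (corner_frame c').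
Proof.
have z0 d l : @coords R d 0 l = 0.
  by rewrite /coords; have [ld|dl] := ltnP l d; [rewrite ext_lt ffunE|rewrite ext_out].
split=> [[b [b' /= sp]]|v]; last first.
  by apply: eqv_from_corner_intro => // l; rewrite ?z0 ?eqxx.
have [bx b'y pq _] := sp.
(* The coordinates at the corner are all 0, so those seen from [b] and [b'] are the bits
   themselves. *)
have ff l : b l (+) corner_code c l = b' l (+) corner_code c' l.
  have := pq l; rewrite !(eq_from _ (coords_from_corner _ _)) -!fromD !from0 //.
  by move/eqP; rewrite eqr_nat; do 2!case: (_ (+) _).
have nz l : b l (+) corner_code c l -> @coords R (cdim (tag c)) 0 l != 1.
  by rewrite z0 eq_sym oner_eq0.
by have [_ []] := same_point_corner sp ff nz.
Qed.

Lemma coords_spread d (s : seq 'I_d) (u : seq R) l :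
  coords (spread s u) l = if l \in map val s then u`_(index l (map val s)) else 0.
Proof.
have [ld|dl] := ltnP l d; last first.
  rewrite coords_ge //; case: mapP => // -[j _ lj]; move: dl.
  by rewrite lj leqNgt ltn_ord.
rewrite /coords ext_lt ffunE -[l in RHS]/(val (Ordinal ld)) mem_map ?index_map //; exact: val_inj.
Qed.

Lemma frame_eqvE c c' (s : seq 'I_(cdim (tag c))) (s' : seq 'I_(cdim (tag c'))) :
  uniq s -> uniq s' -> frame_eqv s s' ->
  [/\ vtx (corner_frame c) = vtx (corner_frame c'), map val s = map val s' &
      forall l, l \in map val s -> level (corner_frame c) l = level (corner_frame c') l].
Proof.
move=> us us' [ss e].
have v : vtx (corner_frame c) = vtx (corner_frame c').
  apply/same_vertexE; have := e (nseq (size s) 0); rewrite size_nseq.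
  have sp0 d (r : seq 'I_d) : spread r (nseq (size s) 0) = 0 :> {ffun 'I_d -> R}.
    by apply/ffunP => l; rewrite !ffunE nth_nseq !if_same.
  by rewrite !sp0; apply=> // a; rewrite mem_nseq => /andP[_ /eqP ->]; rewrite lexx ler01.
(* Pairwise distinct values strictly between 0 and 1: the coordinates of this test point identify
   the axes. *)
pose w m : R := (m.+2%:R)^-1.
have w0 m : w m != 0 by rewrite invr_eq0 pnatr_eq0.
have w01 m : 0 <= w m <= 1.
  by rewrite invr_ge0 ler0n invf_le1 ?ltr0n // ler1n.
have w1 m : w m != 1 by rewrite invr_eq1 (eqr_nat R _ 1).
have wi m k : w m = w k -> m = k.
  by move/invr_inj/eqP; rewrite eqr_nat => /eqP [].
have cE d (r : seq 'I_d) l : size r = size s ->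
    coords (spread r (mkseq w (size s))) l =
    if l \in map val r then w (index l (map val r)) else 0.
  move=> rs; rewrite coords_spread; case: ifP => // lr.
  by rewrite nth_mkseq // -rs -(size_map val) index_mem.
have c1 l : coords (spread s (mkseq w (size s))) l != 1.
  by rewrite cE //; case: ifP => _; rewrite ?w1 // eq_sym oner_eq0.
have [||uu lv] := eqv_from_corner v c1 (e (mkseq w (size s)) _ _).
- by rewrite size_mkseq.
- by move=> a /mapP[m _ ->].
have inj d (r : seq 'I_d) : uniq r -> uniq (map val r) by rewrite map_inj_uniq //; apply: val_inj.
split=> //; last by move=> l ls; apply: lv; rewrite cE ?ls.
apply: (@eq_from_nth _ 0%N); first by rewrite !size_map.
move=> m; rewrite size_map => ms.
have lin : nth 0%N (map val s) m \in map val s by rewrite mem_nth ?size_map.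
have := uu (nth 0%N (map val s) m); rewrite !cE // lin index_uniq ?size_map ?inj //.
case: ifP => [lin' /wi {2}-> |_ /eqP]; last by rewrite (negbTE (w0 _)).
by rewrite nth_index.
Qed.

Lemma subcell_levels c c' :
  vtx (corner_frame c) = vtx (corner_frame c') -> cdim (tag c) = cdim (tag c') ->
  (forall l, (l < cdim (tag c))%N -> level (corner_frame c) l = level (corner_frame c') l) ->
  subcell (tag c) (tag c').
Proof.
move=> v dd lv p p01.
pose u : {ffun 'I_(cdim (tag c)) -> R} := from_corner (tagged c) p.
pose u' : {ffun 'I_(cdim (tag c')) -> R} := [ffun l : 'I_(cdim (tag c')) => coords u l].
have uu l : coords u l = coords u' l.
  have [ld|dl] := ltnP l (cdim (tag c')); last by rewrite !coords_ge // dd.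
  by rewrite [RHS]/coords ext_lt ffunE.
have -> : p = from_corner (tagged c) u.
  by apply/ffunP => l; rewrite !ffunE; case: (tagged c l); rewrite ?subKr.
have cu l : 0 <= coords u l <= 1.
  by rewrite coords_from_corner; apply/from_cube/coords_cube.
exists (from_corner (tagged c') u').
  move=> l; rewrite -coords_ord coords_from_corner; apply: from_cube.
  by rewrite -uu.
apply: eqv_from_corner_intro => // l ul; apply: lv.
by case: ltnP ul => // dl; rewrite coords_ge ?eqxx.
Qed.

(** Describes a point of the link by weights on the vertices of the link, independently of the cube
    that contains it. *)
Definition link_weight (P : {c : corner X & {ffun 'I_(cdim (tag c)) -> R}})
    (t : {set ground F}) : R :=
  \sum_(l < top F | level (corner_frame (tag P)) l == t) coords (tagged P) l.

Lemma link_weight_level P l : (l < cdim (tag (tag P)))%N ->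
  link_weight P (level (corner_frame (tag P)) l) = coords (tagged P) l.
Proof.
move=> ld; have lt := lt_top ld.
rewrite /link_weight (bigD1 (Ordinal lt)) //= big1 ?addr0 // => m /andP[/eqP e].
have [md|dm] := ltnP m (cdim (tag (tag P))); last by rewrite coords_ge.
by rewrite -val_eqE /= (level_inj _ _ e) ?eqxx ?dim_corner_frame.
Qed.

Lemma link_weight_support P t : link_weight P t != 0 ->
  exists2 l, (l < cdim (tag (tag P)))%N & level (corner_frame (tag P)) l = t.
Proof.
move=> nz; case: (pickP (fun l : 'I_(top F) =>
  (l < cdim (tag (tag P)))%N && (level (corner_frame (tag P)) l == t))) => [l /andP[ld /eqP lt]|none].
  by exists l.
case/eqP: nz; apply: big1 => l lt; rewrite coords_ge // leqNgt.
by have := none l; rewrite lt andbT => ->.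
Qed.

Lemma link_weight_transfer P Q l : link_weight P =1 link_weight Q ->
  coords (tagged P) l != 0 -> coords (tagged P) l = coords (tagged Q) l /\
  level (corner_frame (tag P)) l = level (corner_frame (tag Q)) l.
Proof.
move=> PQ nz; have ld : (l < cdim (tag (tag P)))%N.
  by case: ltnP nz => // dl; rewrite coords_ge ?eqxx.
have wl := link_weight_level ld; move: nz; rewrite -wl PQ => nz.
have [m md mt] := link_weight_support nz.
have ml : m = l by apply: (level_inj _ _ mt); rewrite dim_corner_frame.
by subst m; rewrite -mt link_weight_level.
Qed.

Lemma vertex_link_glueP c (P Q : pt (vertex_link (X := X) c)) :
  in_space P -> in_space Q -> Defs.glue P Q <-> link_weight P =1 link_weight Q.
Proof.
case: P Q => [c1 u1] [c2 u2] [/= /same_vertexE v1 [u1p u1s]] [/same_vertexE v2 [u2p u2s]].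
have v : vtx (corner_frame c1) = vtx (corner_frame c2) by rewrite -v1.
(* Link points have their coordinates halved, since they lie on simplices spanned by midpoints of
   edges. This keeps them away from 1, as [eqv_from_corner] demands. *)
pose half d (u : {ffun 'I_d -> R}) := [ffun e => u e / 2] : {ffun 'I_d -> R}.
have halfE d (u : {ffun 'I_d -> R}) l : coords (half d u) l = coords u l / 2.
  have [ld|dl] := ltnP l d; last by rewrite !coords_ge // mul0r.
  by rewrite /coords !ext_lt ffunE.
have half0 d (u : {ffun 'I_d -> R}) l : (coords (half d u) l != 0) = (coords u l != 0).
  by rewrite halfE mulf_eq0 invr_eq0 pnatr_eq0 orbF.
have half1 l : coords (half _ u1) l != 1.
  rewrite halfE; have : coords u1 l <= 1.
    have [ld|dl] := ltnP l (cdim (tag c1)); last by rewrite coords_ge // ler01.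
    rewrite /coords ext_lt -u1s (bigD1 (Ordinal ld)) //= lerDl.
    by apply: sumr_ge0.
  by move=> h; apply/eqP; lra.
rewrite /link_pt /=; split=> [/(eqv_from_corner v half1) [uu lv] t|ww].
  rewrite /link_weight big_mkcond [RHS]big_mkcond; apply: eq_bigr => l _ /=.
  have uu' : coords u1 l = coords u2 l by have := uu l; rewrite !halfE; lra.
  have [z|nz] := eqVneq (coords u1 l) 0; first by rewrite -uu' z !if_same.
  by rewrite lv ?half0 // uu'.
have key l : (coords u1 l != 0) || (coords u2 l != 0) ->
    coords u1 l = coords u2 l /\ level (corner_frame c1) l = level (corner_frame c2) l.
  case/orP=> nz; first exact: (link_weight_transfer ww).
  by have [-> ->] := link_weight_transfer (fun t => esym (ww t)) nz.
apply: eqv_from_corner_intro => // l.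
  rewrite !halfE; congr (_ / 2).
  case E: ((coords u1 l != 0) || (coords u2 l != 0)); first by case: (key _ E).
  by move/negbT: E; rewrite negb_or !negbK => /andP[/eqP -> /eqP ->].
by rewrite half0 => nz; have [|] := key l; rewrite ?nz.
Qed.
End Corners.

(** * Piecewise linear maps *)

Section AffineMaps.
Local Open Scope ring_scope.
Import Order.TTheory GRing.Theory Num.Theory.
Variable R : realType.
Implicit Types E G H : finType.

Definition unit_pt E (e : E) : {ffun E -> R} := [ffun e' => (e' == e)%:R].

(** The linear part is homogeneous by comparison with 0, and additive because a sum is twice a
    midpoint. *)
Lemma affineE E G (A : {ffun E -> R} -> {ffun G -> R}) : affine A ->
  forall x g, A x g = A 0 g + \sum_e x e * (A (unit_pt e) g - A 0 g).
Proof.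
move=> Aa.
pose L g x := A x g - A 0 g.
have LZ g t (x : {ffun E -> R}) : L g [ffun e => t * x e] = t * L g x.
  have -> : [ffun e => t * x e] = bary t x 0 by apply/ffunP => e; rewrite !ffunE mulr0 addr0.
  rewrite /L Aa ffunE; ring.
have LD g x y : L g (x + y) = L g x + L g y.
  have -> : x + y = [ffun e => 2 * bary 2^-1 x y e].
    by apply/ffunP => e; rewrite !ffunE; lra.
  rewrite LZ /L Aa ffunE; lra.
move=> x g; rewrite -[LHS](subrK (A 0 g)) addrC; congr (_ + _).
rewrite -[LHS]/(L g x).
have {1}-> : x = \sum_e [ffun e' => x e * unit_pt e e'].
  apply/ffunP => e; rewrite sum_ffunE (bigD1 e) //= !ffunE eqxx mulr1 big1 ?addr0 // => e' ne.
  by rewrite !ffunE eq_sym (negbTE ne) mulr0.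
have L0 : L g 0 = 0 by rewrite /L subrr.
rewrite (big_morph (L g) (LD g) L0); apply: eq_bigr => e _.
by rewrite LZ.
Qed.

Lemma affine_comp E G H (A : {ffun E -> R} -> {ffun G -> R}) (B : {ffun G -> R} -> {ffun H -> R}) :
  affine A -> affine B -> affine (B \o A).
Proof. by move=> Aa Ba t x y /=; rewrite Aa Ba. Qed.

Definition half_space_pullback E G (A : {ffun E -> R} -> {ffun G -> R})
    (h : {ffun G -> R} * R) : {ffun E -> R} * R :=
  ([ffun e => \sum_g h.1 g * (A (unit_pt e) g - A 0 g)], h.2 - \sum_g h.1 g * A 0 g).

Lemma half_space_pullbackE E G (A : {ffun E -> R} -> {ffun G -> R}) h (x : {ffun E -> R}) : affine A ->
  (\sum_e (half_space_pullback A h).1 e * x e <= (half_space_pullback A h).2) =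
  (\sum_g h.1 g * A x g <= h.2).
Proof.
move=> Aa; rewrite /= lerBrDr; congr (_ <= _).
rewrite [RHS](eq_bigr (fun g => h.1 g * A 0 g +
    \sum_e h.1 g * (A (unit_pt e) g - A 0 g) * x e)); last first.
  move=> g _; rewrite [in LHS](affineE Aa) mulrDr big_distrr; congr (_ + _).
  by apply: eq_bigr => e _ /=; ring.
rewrite big_split addrC exchange_big; congr (_ + _).
by apply: eq_bigr => e _; rewrite ffunE mulr_suml.
Qed.

Lemma polyhedron_cat E (P Q : seq ({ffun E -> R} * R)) (x : {ffun E -> R}) :
  polyhedron (P ++ Q) x <-> polyhedron P x /\ polyhedron Q x.
Proof.
split=> [h|[hP hQ] h]; last by rewrite mem_cat => /orP[/hP|/hQ].
by split=> a aP; apply: h; rewrite mem_cat aP ?orbT.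
Qed.

Lemma polyhedron_pullback E G (A : {ffun E -> R} -> {ffun G -> R}) Q (x : {ffun E -> R}) : affine A ->
  polyhedron (map (half_space_pullback A) Q) x <-> polyhedron Q (A x).
Proof.
move=> Aa; split=> [h a aQ|h a /mapP[b bQ ->]]; last by rewrite half_space_pullbackE //; apply: h.
by rewrite -half_space_pullbackE //; apply: h; apply: map_f.
Qed.
End AffineMaps.

(** * Composition and construction of piecewise linear homeomorphisms *)

Section PLMaps.
Local Open Scope ring_scope.
Import Order.TTheory GRing.Theory Num.Theory.
Variable R : realType.
Implicit Types S T U : Defs.space R.

Definition glue_trans S : Prop := forall p q r : pt S,
  in_space p -> in_space q -> in_space r -> Defs.glue p q -> Defs.glue q r -> Defs.glue p r.

(** Each polyhedron for [f] is refined by the preimages, under its affine map, of the polyhedra for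
    [g]. *)
Lemma PL_map_comp S T U (f : pt S -> pt T) (g : pt T -> pt U) :
  glue_trans U -> PL_map f -> PL_map g -> PL_map (g \o f).
Proof.
move=> Utr [f_in f_gl f_PL] [g_in g_gl g_PL]; split=> [p /f_in/g_in //|p q ip iq pq|i].
  by apply: g_gl; [exact: f_in|exact: f_in|exact: f_gl].
pose piece (P : seq ({ffun crd i -> R} * R)) (W : Defs.space R) (h : pt S -> pt W) :=
  exists (j : part W) (A : {ffun crd i -> R} -> {ffun crd j -> R}), affine A /\
    forall x, body x -> polyhedron P x -> body (A x) /\
      Defs.glue (h (Tagged (fun i => {ffun crd i -> R}) x))
                (Tagged (fun j => {ffun crd j -> R}) (A x)).
have [D [Dcov Daff]] := f_PL i.
suff [D' [h1 h2]] : exists D' : seq (seq ({ffun crd i -> R} * R)), (forall x, body x -> (exists2 P, P \in D & polyhedron P x) ->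
    exists2 P, P \in D' & polyhedron P x) /\ forall P, P \in D' -> piece P U (g \o f).
  by exists D'; split=> [x bx|]; [apply: (h1 x bx (Dcov x bx))|exact: h2].
have {}Daff P : P \in D -> piece P T f by exact: Daff.
elim: D {Dcov} Daff => [|P D IH] Daff; first by exists [::]; split=> // x _ [].
have [|D' [D'cov D'aff]] := IH; first by move=> Q QD; apply: Daff; rewrite inE QD orbT.
have [j [A [Aa PA]]] := Daff P (mem_head _ _).
have [E [Ecov Eaff]] := g_PL j.
exists ([seq P ++ map (half_space_pullback A) Q | Q <- E] ++ D'); split.
  move=> x bx [Q]; rewrite inE => /predU1P[->|QD] Qx; last first.
    have [|Q' Q'D Q'x] := D'cov x bx; first by exists Q.
    by exists Q' => //; rewrite mem_cat Q'D orbT.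
  have [bA _] := PA x bx Qx; have [Q' Q'E Q'A] := Ecov _ bA.
  exists (P ++ map (half_space_pullback A) Q').
    by rewrite mem_cat; apply/orP; left; apply/mapP; exists Q'.
  by apply/polyhedron_cat; split=> //; apply/polyhedron_pullback.
move=> Q; rewrite mem_cat => /orP[/mapP[Q' Q'E ->]|/D'aff //].
have [l [B [Ba QB]]] := Eaff _ Q'E.
exists l, (B \o A); split; first exact: affine_comp.
move=> x bx /polyhedron_cat[Px /(polyhedron_pullback _ _ Aa) Q'A].
have [bA gA] := PA x bx Px; have [bB gB] := QB _ bA Q'A; split=> //=.
by apply: Utr gB => //; [apply/g_in/f_in|exact: g_in|apply: g_gl => //; apply: f_in].
Qed.

Lemma PL_homeomorphic_trans S T U : glue_trans S -> glue_trans U ->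
  PL_homeomorphic S T -> PL_homeomorphic T U -> PL_homeomorphic S U.
Proof.
move=> Str Utr [f [f' [fPL f'PL ff' f'f]]] [g [g' [gPL g'PL gg' g'g]]].
have [f_in _ _] := fPL; have [f'_in f'_gl _] := f'PL.
have [g_in g_gl _] := gPL; have [g'_in _ _] := g'PL.
exists (g \o f), (f' \o g'); split; [exact: PL_map_comp|exact: PL_map_comp| |].
  move=> p ip /=; apply: (Str _ (f' (f p))) => //; last exact: ff'.
  - by do !(apply: f_in || apply: f'_in || apply: g_in || apply: g'_in).
  - by apply/f'_in/f_in.
  - by apply: f'_gl; [apply/g'_in/g_in/f_in|apply: f_in|apply/gg'/f_in].
move=> q iq /=; apply: (Utr _ (g (g' q))) => //; last exact: g'g.
- by do !(apply: f_in || apply: f'_in || apply: g_in || apply: g'_in).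
- by apply/g_in/g'_in.
- by apply: g_gl; [apply/f_in/f'_in/g'_in|apply: g'_in|apply/f'f/g'_in].
Qed.

Lemma single_trans (E : finType) (B : classical_sets.set {ffun E -> R}) : glue_trans (single B).
Proof. by move=> p q r _ _ _ /= -> ->. Qed.

Definition in_single (E : finType) (B : classical_sets.set {ffun E -> R}) (x : {ffun E -> R}) : pt (single B) :=
  Tagged (fun i : part (single B) => {ffun crd i -> R}) (x : {ffun crd (tt : part (single B)) -> R}).

(** The inverse is piecewise linear since affine sections over finitely many polyhedra cover [B];
    which preimage is chosen does not matter up to gluing. *)
Lemma PL_homeomorphic_chart S (E : finType) (B : classical_sets.set {ffun E -> R}) (f : pt S -> {ffun E -> R})
    (D : seq (seq ({ffun E -> R} * R))) :
  pt S ->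
  (forall p q, in_space p -> in_space q -> (Defs.glue p q <-> f p = f q)) ->
  (forall p, in_space p -> B (f p)) ->
  (forall i : part S, exists A : {ffun crd i -> R} -> {ffun E -> R}, affine A /\
     forall x, body x -> f (Tagged (fun i => {ffun crd i -> R}) x) = A x) ->
  (forall x, B x -> exists2 P, P \in D & polyhedron P x) ->
  (forall P, P \in D -> exists (i : part S) (A : {ffun E -> R} -> {ffun crd i -> R}),
     affine A /\ forall x, B x -> polyhedron P x ->
       body (A x) /\ f (Tagged (fun i => {ffun crd i -> R}) (A x)) = x) ->
  PL_homeomorphic S (single B).
Proof.
move=> p0 gl fB f_aff Dcov Dsec.
have sec x : exists p : pt S, B x -> in_space p /\ f p = x.
  have [Bx|nBx] := boolp.pselect (B x); last by exists p0.
  have [P PD Px] := Dcov x Bx; have [i [A [_ h]]] := Dsec P PD.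
  by exists (Tagged (fun i => {ffun crd i -> R}) (A x)) => _; apply: h.
pose s x : pt S := projT1 (boolp.cid (sec x)).
have sP x : B x -> in_space (s x) /\ f (s x) = x by rewrite /s; case: (boolp.cid _).
pose h p : pt (single B) := in_single B (f p).
pose g (q : pt (single B)) : pt S := s (tagged q).
have Bin (q : pt (single B)) : in_space q -> B (tagged q) by [].
exists h, g; split.
- split=> [p /fB //|p q ip iq /gl|i]; first by move=> /(_ ip iq); rewrite /h => ->.
  exists [:: [::]]; split=> [x _|P]; first by exists [::]; rewrite ?inE.
  rewrite inE => /eqP ->; have [A [Aa fA]] := f_aff i; exists tt, A; split=> // x bx _; split.
    by rewrite -fA //; apply: fB.
  by rewrite /= /h fA.
- split=> [q /Bin/sP[] //|p q ip iq /= e|[]].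
    by rewrite e; have [iS _] := sP _ (Bin _ iq); apply/gl.
  exists D; split=> [x bx|P PD]; first exact: Dcov.
  have [i [A [Aa PA]]] := Dsec P PD; exists i, A; split=> // x Bx Px.
  have [bA fA] := PA x Bx Px; split=> //.
  by have [iS fS] := sP x Bx; apply/gl => //; rewrite fA.
- move=> p ip; have [iS fS] := sP _ (fB _ ip); exact/gl.
- by case=> -[] x Bx /=; have [_ fS] := sP x Bx; rewrite /h /g /= fS.
Qed.
End PLMaps.

(** * The link as a subdivision *)

Section RealizedLinks.
Local Open Scope ring_scope.
Import Order.TTheory GRing.Theory Num.Theory.
Variables (R : realType) (k : nat) (Y : 'I_k -> scomplex).
(** [vl] gives the sphere at a vertex and the remaining data, [vn] numbers the vertices of the
    spheres, and [rl] reads off the ordered facet at a frame. *)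
Variables (FS : frame_system) (Q : finType) (vl : vtx_type FS -> 'I_k * Q).
Variable vn : forall i, vert (Y i) -> ground FS.
Variable rl : forall i, frame FS -> seq (vert (Y i)).
Arguments vn : clear implicits.
Hypothesis vn_inj : forall i, injective (vn i).
Hypothesis rlP : forall x, (0 < dim x)%N ->
  facet_list (rl (vl (vtx x)).1 x) /\ size (rl (vl (vtx x)).1 x) = dim x.
Hypothesis levelE : forall x l, (l < dim x)%N ->
  level x l = [set vn _ v | v in [set v in take l.+1 (rl (vl (vtx x)).1 x)]].
Hypothesis rl_exists : forall (z : vtx_type FS) (r : seq (vert (Y (vl z).1))),
  facet_list r -> (0 < size r)%N -> exists x, [/\ vtx x = z, dim x = size r & rl (vl z).1 x = r].
Local Notation X := (complex_of R FS).

Lemma link_weightE (P : {c : corner X & {ffun 'I_(cdim (tag c)) -> R}}) t :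
  link_weight P t =
  \sum_(l < cdim (tag (tag P)) | level (corner_frame (tag P)) l == t) tagged P l.
Proof.
rewrite /link_weight.
transitivity (\sum_(l < cdim (tag (tag P)) | level (corner_frame (tag P)) l == t)
    coords (tagged P) l); last by apply: eq_bigr => l _; rewrite coords_ord.
rewrite [RHS](big_ord_widen_cond (top FS) (fun l => level (corner_frame (tag P)) l == t)
  (coords (tagged P))) ?dim_le_top //.
rewrite [RHS]big_mkcondr; apply: eq_bigr => l _; case: ltnP => // dl.
by rewrite coords_ge.
Qed.

Definition base_corner (x : frame FS) : corner X :=
  Tagged (fun i : cubes X => {ffun 'I_(cdim i) -> bool})
    ([ffun=> false] : {ffun 'I_(cdim (x : cubes X)) -> bool}).

Lemma corner_frame_base x : corner_frame (base_corner x) = x.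
Proof.
rewrite /corner_frame -[RHS](turns0 x); apply: eq_turns => l _.
rewrite /corner_code; have [ld|dl] := ltnP l (dim x); last by rewrite ext_out.
by rewrite ext_lt ffunE.
Qed.

Variable z : vtx_type FS.
Let i0 := (vl z).1.
Let K := Y i0.
Implicit Types c : corner X.
Definition at_z c := vtx (corner_frame c) = z.
Definition ord_at c : seq (vert K) := rl i0 (corner_frame c).

Lemma ord_atP c : at_z c -> (0 < cdim (tag c))%N ->
  facet_list (ord_at c) /\ size (ord_at c) = cdim (tag c).
Proof.
move=> cz d0; have := rlP (x := corner_frame c); rewrite dim_corner_frame => /(_ d0).
by rewrite /ord_at /K /i0 -cz.
Qed.

Lemma level_at c l : at_z c -> (l < cdim (tag c))%N ->
  level (corner_frame c) l = [set vn _ v | v in [set v in take l.+1 (ord_at c)]].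
Proof.
move=> cz ld; have := @levelE (corner_frame c) l; rewrite dim_corner_frame => /(_ ld) ->.
by rewrite /ord_at /K /i0 -cz.
Qed.

Lemma size_ord_at c (l : 'I_(cdim (tag c))) : at_z c -> (l < size (ord_at c))%N.
Proof.
by move=> cz; have [_ ->] := ord_atP cz (leq_ltn_trans (leq0n l) (ltn_ord l)).
Qed.

Lemma ord_at_facet c (l : 'I_(cdim (tag c))) : at_z c -> facet_list (ord_at c).
Proof. by move=> cz; have [] := ord_atP cz (leq_ltn_trans (leq0n l) (ltn_ord l)). Qed.

Lemma ord_at_uniq c (l : 'I_(cdim (tag c))) : at_z c -> uniq (ord_at c).
Proof. by move/(ord_at_facet l)/andP => []. Qed.

Lemma flag_map_exists c : at_z c -> exists phi : 'I_(cdim (tag c)) -> vert (sd K),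
  forall l, val (phi l) = [set v in take l.+1 (ord_at c)].
Proof.
move=> cz.
have h (l : 'I_(cdim (tag c))) : exists s : vert (sd K), val s = [set v in take l.+1 (ord_at c)].
  suff h : ([set v in take l.+1 (ord_at c)] \in face K) && ([set v in take l.+1 (ord_at c)] != set0).
    by exists (exist (fun s : {set vert K} => (s \in face K) && (s != set0)) _ h).
  rewrite -card_gt0 card_prefix ?(ord_at_uniq l) ?size_ord_at // andbT.
  apply: face_sub (facet_list_face (ord_at_facet l cz)).
  by apply/subsetP => v; rewrite !inE => /mem_take.
by have [phi phiE] := fin_all_exists h; exists phi.
Qed.

Lemma flag_map_inj c phi : at_z c ->
  (forall l : 'I_(cdim (tag c)), val (phi l : vert (sd K)) = [set v in take l.+1 (ord_at c)]) ->
  injective phi.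
Proof.
move=> cz phiE l l' e; apply: val_inj.
have := congr1 (fun s : vert (sd K) => #|val s|) e; rewrite /= !phiE !card_prefix ?(ord_at_uniq l) ?size_ord_at //.
by case.
Qed.

Lemma flag_map_chain c phi : at_z c ->
  (forall l : 'I_(cdim (tag c)), val (phi l : vert (sd K)) = [set v in take l.+1 (ord_at c)]) ->
  [set phi l | l in 'I_(cdim (tag c))] \in face (sd K).
Proof.
move=> cz phiE; apply/sd_faceP => _ _ /imsetP[l _ ->] /imsetP[l' _ ->]; rewrite !phiE.
have sub (a b : nat) : (a <= b)%N ->
    [set v in take a.+1 (ord_at c)] \subset [set v in take b.+1 (ord_at c)].
  move=> ab; apply/subsetP => v; rewrite !inE -(@take_takel _ a.+1 b.+1) //.
  exact: mem_take.
by have [/sub -> //|/ltnW/sub ->] := leqP l l'; rewrite orbT.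
Qed.

Lemma level_flag_map c phi (l : 'I_(cdim (tag c))) : at_z c ->
  (forall l : 'I_(cdim (tag c)), val (phi l : vert (sd K)) = [set v in take l.+1 (ord_at c)]) ->
  level (corner_frame c) l = [set vn _ v | v in val (phi l)].
Proof. by move=> cz phiE; rewrite level_at // phiE. Qed.

(** * The link as the barycentric subdivision *)

Definition sd_point (P : {c : corner X & {ffun 'I_(cdim (tag c)) -> R}}) :
    {ffun vert (sd K) -> R} :=
  [ffun s : vert (sd K) => link_weight P [set vn _ v | v in val s]].

Lemma sd_pointE c (u : {ffun 'I_(cdim (tag c)) -> R}) phi : at_z c ->
  (forall l : 'I_(cdim (tag c)), val (phi l : vert (sd K)) = [set v in take l.+1 (ord_at c)]) ->
  sd_point (Tagged (fun c : corner X => {ffun 'I_(cdim (tag c)) -> R}) u) = push phi u.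
Proof.
move=> cz phiE; apply/ffunP => s; rewrite !ffunE link_weightE /=; apply: eq_bigl => l.
rewrite (level_flag_map _ cz phiE); apply/eqP/eqP => [/(imset_inj (@vn_inj _)) e|-> //].
exact: val_inj.
Qed.

Lemma link_weight_face P t : at_z (tag P) -> link_weight P t != 0 ->
  exists s : vert (sd K), t = [set vn _ v | v in val s].
Proof.
move=> cz /link_weight_support[l ld <-].
have [phi phiE] := flag_map_exists cz.
by exists (phi (Ordinal ld)); rewrite -level_flag_map.
Qed.

(** Link weights vanish away from the images of faces, so restricting them to the vertices of the
    subdivision loses nothing. *)
Lemma sd_point_inj P P' : at_z (tag P) -> at_z (tag P') ->
  sd_point P = sd_point P' -> link_weight P =1 link_weight P'.
Proof.
move=> cz cz' e t.
have key S : at_z (tag S) -> sd_point P = sd_point S -> sd_point P' = sd_point S ->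
    link_weight S t != 0 -> link_weight P t = link_weight P' t.
  move=> Sz e1 e2 /(link_weight_face Sz)[s ->].
  by have := congr1 (fun f : {ffun _ -> _} => f s) e; rewrite !ffunE.
have [z1|/key] := eqVneq (link_weight P t) 0; last by apply.
have [z2|/key] := eqVneq (link_weight P' t) 0; first by rewrite z1 z2.
by apply.
Qed.

Lemma push_sum (E G : finType) (phi : E -> G) (x : {ffun E -> R}) :
  \sum_v push phi x v = \sum_e x e.
Proof.
rewrite (partition_big phi xpredT) //=; apply: eq_bigr => v _.
by rewrite ffunE.
Qed.

Lemma sd_point_realization c (u : {ffun 'I_(cdim (tag c)) -> R}) : at_z c -> simplex u ->
  realization R (sd K) (sd_point (Tagged (fun c : corner X => {ffun 'I_(cdim (tag c)) -> R}) u)).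
Proof.
move=> cz [u0 u1]; have [phi phiE] := flag_map_exists cz.
rewrite (sd_pointE _ cz phiE); split; first split.
- by move=> s; rewrite ffunE; apply: sumr_ge0.
- by rewrite push_sum.
apply: face_sub (flag_map_chain cz phiE); apply/subsetP => s; rewrite inE ffunE.
apply: contraR => sn; rewrite big1 // => l /eqP ls.
by case/imsetP: sn; exists l.
Qed.

Lemma corner_exists (r : seq (vert K)) : facet_list r -> (0 < size r)%N ->
  exists c, [/\ at_z c, cdim (tag c) = size r & ord_at c = r].
Proof.
move=> fr r0; have [x [xz dx rx]] := rl_exists fr r0.
by exists (base_corner x); rewrite /at_z /ord_at corner_frame_base.
Qed.

(** The support of [y] extends to the flag of an ordered facet, and every ordered facet occurs at a
    corner of this vertex. *)
Lemma sd_point_surj y : realization R (sd K) y ->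
  exists c (u : {ffun 'I_(cdim (tag c)) -> R}), [/\ at_z c, simplex u &
    sd_point (Tagged (fun c : corner X => {ffun 'I_(cdim (tag c)) -> R}) u) = y].
Proof.
move=> [[y0 y1] yK]; have [r fr ch] := chain_in_flag yK.
have r0 : (0 < size r)%N.
  case: (pickP (fun s => y s != 0)) => [s sy|none].
    by have [|l lr _] := ch s; [rewrite inE|apply: leq_ltn_trans lr].
  move: y1; rewrite big1 => [/eqP|s _]; first by rewrite eq_sym oner_eq0.
  by have /negbFE/eqP := none s.
have [c [cz dc rc]] := corner_exists fr r0.
have [phi phiE] := flag_map_exists cz.
have phi_inj := flag_map_inj cz phiE.
exists c, [ffun l : 'I_(cdim (tag c)) => y (phi l)].
have onto s : y s != 0 -> exists l, phi l = s.
  move=> sy; have [|l lr ls] := ch s; first by rewrite inE.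
  rewrite -dc in lr; exists (Ordinal lr); apply: val_inj.
  by rewrite phiE rc.
have pE : push phi [ffun l : 'I_(cdim (tag c)) => y (phi l)] = y.
  apply/ffunP => s; rewrite ffunE; have [sy|/onto[l <-]] := eqVneq (y s) 0.
    by rewrite sy big1 // => l /eqP ls; rewrite ffunE ls.
  rewrite (big_pred1 l) ?ffunE // => l' /=; exact: inj_eq.
split=> //; last by rewrite (sd_pointE _ cz phiE).
split=> [l|]; first by rewrite ffunE.
by rewrite -(push_sum phi) pE.
Qed.

(** * The link as a subdivision of the sphere itself *)

Local Notation link_pair := {c : corner X & {ffun 'I_(cdim (tag c)) -> R}}.
Definition pair_at c (u : {ffun 'I_(cdim (tag c)) -> R}) : link_pair :=
  Tagged (fun c : corner X => {ffun 'I_(cdim (tag c)) -> R}) u.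

Definition bary_coef c (l : nat) (v : vert K) : R :=
  if v \in take l.+1 (ord_at c) then (l.+1%:R)^-1 else 0.

Definition bary_point (P : link_pair) : {ffun vert K -> R} :=
  [ffun v => \sum_(l < cdim (tag (tag P))) tagged P l * bary_coef (tag P) l v].

(** Joins two descriptions: the left side depends only on the point of the link, the right side is
    visibly affine on each simplex. *)
Lemma bary_point_barycentric P v : at_z (tag P) ->
  barycentric_sum (link_weight P) (vn _ v) = bary_point P v.
Proof.
case: P => c u cz; rewrite /= in cz; rewrite ffunE /barycentric_sum /=.
rewrite (eq_bigr (fun t : {set ground FS} => \sum_(l < cdim (tag c) | level (corner_frame c) l == t)
    u l / #|t|%:R)); last by move=> t _; rewrite link_weightE mulr_suml.
rewrite (exchange_big_dep xpredT) //=; apply: eq_bigr => l _.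
rewrite /bary_coef.
have mem : (vn _ v \in level (corner_frame c) l) = (v \in take l.+1 (ord_at c)).
  by rewrite level_at // mem_imset ?inE //; apply: vn_inj.
have cardE : #|level (corner_frame c) l| = l.+1.
  by rewrite level_at // card_imset ?card_prefix ?(ord_at_uniq l) ?size_ord_at //; apply: vn_inj.
case: ifP => vl0.
  rewrite (big_pred1 (level (corner_frame c) l)) ?cardE // => t /=.
  by rewrite eq_sym; case: eqP => [->|]; rewrite ?andbF // mem vl0.
rewrite big_pred0 ?mulr0 // => t; apply/negbTE/negP => /andP[vt /eqP lt].
by rewrite -lt mem vl0 in vt.
Qed.

Lemma link_chain_weight P : at_z (tag P) -> simplex (tagged P) -> chain_weight (link_weight P).
Proof.
move=> cz [u0 _]; have [phi phiE] := flag_map_exists cz; split=> [t||s t].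
- by rewrite link_weightE; apply: sumr_ge0.
- apply/eqP/negPn/negP => /link_weight_support[l ld] /eqP.
  rewrite (level_flag_map (Ordinal ld) cz phiE) imset_eq0.
  by have /andP[_ /negbTE ->] := valP (phi (Ordinal ld)).
- move=> /link_weight_support[l ld <-] /link_weight_support[l' ld' <-].
  rewrite (level_flag_map (Ordinal ld) cz phiE) (level_flag_map (Ordinal ld') cz phiE).
  have /sd_faceP/(_ (phi (Ordinal ld)) (phi (Ordinal ld'))) := flag_map_chain cz phiE.
  by rewrite !imset_f // => /(_ isT isT)/orP[] /imsetS ->; rewrite ?orbT.
Qed.

Lemma bary_point_inj P P' : at_z (tag P) -> at_z (tag P') ->
  simplex (tagged P) -> simplex (tagged P') ->
  bary_point P = bary_point P' -> link_weight P =1 link_weight P'.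
Proof.
move=> cz cz' sP sP' e; apply: chain_weight_inj => [||w].
- exact: link_chain_weight.
- exact: link_chain_weight.
have [/existsP[v /eqP <-]|nv] := boolP [exists v, vn i0 v == w].
  by rewrite !bary_point_barycentric // e.
have out S : at_z (tag S) -> barycentric_sum (link_weight S) w = 0.
  move=> Sz; apply: big1 => t wt; have [->|/(link_weight_face Sz)[s ts]] := eqVneq (link_weight S t) 0.
    by rewrite mul0r.
  case/existsP: nv; move: wt; rewrite ts => /imsetP[v _ ->].
  by exists v.
by rewrite !out.
Qed.

Lemma bary_coef_sum c (l : 'I_(cdim (tag c))) : at_z c -> \sum_v bary_coef c l v = 1.
Proof.
move=> cz; rewrite /bary_coef -big_mkcond /= sumr_const.
rewrite -cardsE card_prefix ?(ord_at_uniq l) ?size_ord_at //.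
by rewrite -[LHS]mulr_natl divff // pnatr_eq0.
Qed.

Lemma bary_point_sum P : at_z (tag P) -> \sum_v bary_point P v = \sum_l tagged P l.
Proof.
move=> cz; rewrite (eq_bigr (fun v => \sum_l tagged P l * bary_coef (tag P) l v)); last first.
  by move=> v _; rewrite ffunE.
rewrite exchange_big; apply: eq_bigr => l _.
by rewrite -mulr_sumr bary_coef_sum // mulr1.
Qed.

Lemma bary_point_realization P : at_z (tag P) -> simplex (tagged P) ->
  realization R K (bary_point P).
Proof.
case: P => c u /= cz [u0 u1]; split; first split.
- move=> v; rewrite ffunE; apply: sumr_ge0 => l _; rewrite mulr_ge0 // /bary_coef.
  by case: ifP => // _; rewrite invr_ge0.
- by rewrite bary_point_sum.
have [l _|d0] := pickP ('I_(cdim (tag c))); last first.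
  by move: u1; rewrite big1 => [/eqP|l _]; [rewrite eq_sym oner_eq0|have := d0 l].
apply: face_sub (facet_list_face (ord_at_facet l cz)); apply/subsetP => v.
rewrite !inE ffunE; apply: contraR => vr; rewrite big1 // => j _.
by rewrite /bary_coef ifN ?mulr0 //; apply: contra vr; apply: mem_take.
Qed.

Lemma bary_point_affine c : affine (fun u : {ffun 'I_(cdim (tag c)) -> R} => bary_point (pair_at u)).
Proof.
move=> t u u'; apply/ffunP => v; rewrite !ffunE !mulr_sumr -big_split.
by apply: eq_bigr => l _; rewrite ffunE /=; ring.
Qed.

Lemma telescope_tail (a : nat -> R) j d : (j <= d)%N ->
  \sum_(l < d) (if (j <= l)%N then a l - a l.+1 else 0) = a j - a d.
Proof.
elim: d => [|d IH]; first by rewrite leqn0 big_ord0 => /eqP ->; rewrite subrr.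
rewrite leq_eqVlt => /orP[/eqP ->|].
  by rewrite subrr big1 // => l _; rewrite leqNgt ltn_ord.
rewrite ltnS big_ord_recr /= => jd; rewrite IH // jd.
by rewrite addrA subrK.
Qed.

(** Coordinates decrease along [ord_at c]. A vertex outside this list has its length as [index], so
    it must have the smallest coordinate. *)
Definition cell_polyhedron c : seq ({ffun vert K -> R} * R) :=
  [seq ([ffun v => (v == p.1)%:R - (v == p.2)%:R], 0) |
    p <- enum {: vert K * vert K} & (index p.2 (ord_at c) <= index p.1 (ord_at c))%N].

Lemma cell_polyhedronP c (x : {ffun vert K -> R}) : polyhedron (cell_polyhedron c) x <->
  forall v w, (index w (ord_at c) <= index v (ord_at c))%N -> x v <= x w.
Proof.
have sumE (v w : vert K) :
    \sum_e ([ffun e => (e == v)%:R - (e == w)%:R] : {ffun vert K -> R}) e * x e = x v - x w.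
  rewrite (eq_bigr (fun e => (e == v)%:R * x e - (e == w)%:R * x e)); last first.
    by move=> e _; rewrite ffunE mulrBl.
  rewrite sumrB; congr (_ - _).
    by rewrite (bigD1 v) //= eqxx mul1r big1 ?addr0 // => e /negbTE ->; rewrite mul0r.
  by rewrite (bigD1 w) //= eqxx mul1r big1 ?addr0 // => e /negbTE ->; rewrite mul0r.
split=> [h v w vw|h a /mapP[[v w]]].
  rewrite -subr_le0 -sumE.
  apply: (h ([ffun e => (e == v)%:R - (e == w)%:R], 0)); apply/mapP; exists (v, w) => //.
  by rewrite mem_filter mem_enum /= vw.
by rewrite mem_filter => /andP[/= vw _] -> /=; rewrite sumE subr_le0; apply: h.
Qed.

(** The coordinate at the [l]-th vertex of the ordering; as a sum it is linear in [x] and vanishes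
    past the end of the list. *)
Definition entry c (x : {ffun vert K -> R}) (l : nat) : R :=
  \sum_(v | (v \in ord_at c) && (index v (ord_at c) == l)) x v.

(** The inverse of the barycentric map on one simplex: the first [l.+1] vertices share the
    coefficient of their barycenter equally, so it is [l.+1] times the drop between consecutive
    coordinates. *)
Definition cell_coords c (x : {ffun vert K -> R}) : {ffun 'I_(cdim (tag c)) -> R} :=
  [ffun l : 'I_(cdim (tag c)) => l.+1%:R * (entry c x l - entry c x l.+1)].

Lemma cell_coords_affine c : affine (cell_coords c).
Proof.
move=> t x y; have E l : entry c (bary t x y) l = t * entry c x l + (1 - t) * entry c y l.
  by rewrite /entry !mulr_sumr -big_split; apply: eq_bigr => v _; rewrite ffunE.
by apply/ffunP => l; rewrite !ffunE !E; ring.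
Qed.

Lemma entry_index c x v : v \in ord_at c -> entry c x (index v (ord_at c)) = x v.
Proof.
move=> vr; rewrite /entry (big_pred1 v) // => w /=.
apply/andP/eqP => [[wr /eqP e]|->]; last by rewrite vr eqxx.
by rewrite -(nth_index v wr) e nth_index.
Qed.

Lemma entry_out c x l : (size (ord_at c) <= l)%N -> entry c x l = 0.
Proof.
move=> rl0; rewrite /entry big_pred0 // => v; apply/andP => -[vr /eqP e].
by move: vr; rewrite -index_mem e ltnNge rl0.
Qed.

Section Cell.
Variables (c : corner X) (x : {ffun vert K -> R}).
Hypotheses (cz : at_z c) (d0 : (0 < cdim (tag c))%N).
Hypotheses (xK : realization R K x) (xP : polyhedron (cell_polyhedron c) x).

(** A nonzero coordinate outside the facet would make all those on it nonzero, and the support would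
    be a face strictly larger than a maximal one. *)
Lemma cell_zero v : v \notin ord_at c -> x v = 0.
Proof.
move=> vr; apply/eqP/negPn/negP => xv; have [fr _] := ord_atP cz d0.
have [[x0 _] xF] := xK.
have pos w : w \in ord_at c -> x w != 0.
  move=> wr; rewrite gt_eqF // (lt_le_trans (y := x v)) ?lt_def ?xv ?x0 //.
  by move/cell_polyhedronP: xP; apply; apply/ltnW; rewrite (memNindex vr) index_mem.
have [_ /maxsetP[_ mx]] := andP fr.
have := mx _ xF; rewrite (_ : [set w in ord_at c] \subset _) => [/(_ isT) e|].
  have : v \in [set w | x w != 0] by rewrite inE.
  by rewrite e inE (negbTE vr).
by apply/subsetP => w; rewrite !inE => /pos.
Qed.

Lemma bary_point_cell : bary_point (pair_at (cell_coords c x)) = x.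
Proof.
have [fr sr] := ord_atP cz d0.
apply/ffunP => v; rewrite ffunE /=; have [vr|vr] := boolP (v \in ord_at c); last first.
  rewrite (cell_zero vr) big1 // => l _; rewrite /bary_coef ifN ?mulr0 //.
  by apply: contra vr; apply: mem_take.
set j := index v (ord_at c).
have jd : (j < cdim (tag c))%N by rewrite -sr index_mem.
have termE (l : 'I_(cdim (tag c))) : cell_coords c x l * bary_coef c l v =
    if (j <= l)%N then entry c x l - entry c x l.+1 else 0.
  rewrite ffunE /bary_coef in_take // ltnS -/j; case: ifP => _; last by rewrite mulr0.
  by rewrite mulrAC mulfV ?mul1r // pnatr_eq0.
rewrite (eq_bigr _ (fun l _ => termE l)).
rewrite (telescope_tail (entry c x)) ?(ltnW jd) // entry_index // entry_out ?subr0 //.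
by rewrite sr.
Qed.

Lemma cell_coords_simplex : simplex (cell_coords c x).
Proof.
have [fr sr] := ord_atP cz d0; have [[x0 x1] _] := xK; split=> [l|].
  rewrite ffunE mulr_ge0 ?ler0n // subr_ge0.
  have lr : (l < size (ord_at c))%N by rewrite sr.
  have nthP j (jr : (j < size (ord_at c))%N) : exists2 v, v \in ord_at c & index v (ord_at c) = j.
    have [v0 _] : {v : vert K | v \in ord_at c}.
      by case: (ord_at c) jr => // v r _; exists v; rewrite mem_head.
    exists (nth v0 (ord_at c) j); first exact: mem_nth.
    by rewrite index_uniq //; case/andP: fr.
  have [v vr <-] := nthP _ lr; rewrite entry_index //.
  have [sl|ls] := leqP (size (ord_at c)) (index v (ord_at c)).+1.
    by rewrite entry_out // x0.
  have [w wr wE] := nthP _ ls; rewrite -wE entry_index //.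
  by move/cell_polyhedronP: xP; apply; rewrite wE.
rewrite -[LHS](bary_point_sum (P := pair_at (cell_coords c x)) cz).
by rewrite bary_point_cell.
Qed.
End Cell.

Definition cells : seq (corner X) :=
  [seq c <- enum (corner X) | (vtx (corner_frame c) == z) && (0 < cdim (tag c))%N].

(** Sorting the vertices of a facet around the support by decreasing coordinate gives the ordering
    of the cell. *)
Lemma cell_cover (x : {ffun vert K -> R}) : realization R K x ->
  exists2 c, c \in cells & polyhedron (cell_polyhedron c) x.
Proof.
move=> [[x0 x1] xF].
have tot : total (fun v w => x w <= x v) by move=> v w; apply: le_total.
have [r [fr sub sr]] := sorted_facet xF tot.
have r0 : (0 < size r)%N.
  case: r fr sub {sr} => // _ /subsetP sub; move: x1; rewrite big1 => [/eqP|v _].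
    by rewrite eq_sym oner_eq0.
  by apply/eqP/negPn/negP => xv; have := sub v; rewrite !inE => /(_ xv).
have [c [cz dc rc]] := corner_exists fr r0; exists c.
  by rewrite mem_filter mem_enum inE (eqP (introT eqP cz)) eqxx dc r0.
apply/cell_polyhedronP; rewrite rc => v w wv.
have out u : u \notin r -> x u = 0.
  move=> ur; apply/eqP/negPn/negP => xu; case/negP: ur.
  by have := subsetP sub u; rewrite !inE; apply.
have [vr|/out -> //] := boolP (v \in r).
have wr : w \in r by rewrite -index_mem (leq_ltn_trans wv) ?index_mem.
have tr : transitive (fun v w => x w <= x v) by move=> a b e ab ae; apply: le_trans ae ab.
have := sorted_leq_nth tr (fun a => lexx (x a)) v sr (index w r) (index v r).
by rewrite !inE !index_mem => /(_ wr vr wv); rewrite !nth_index.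
Qed.

Lemma vertex_link_PL c : at_z c ->
  PL_homeomorphic (vertex_link c) (single (realization R K)).
Proof.
move=> cz.
have inP (P : pt (vertex_link c)) : in_space P -> at_z (tag P) /\ simplex (tagged P).
  by case: P => c' u [/same_vertexE v s]; split=> //; rewrite /at_z -v.
apply: (@PL_homeomorphic_chart R (vertex_link c) (vert K) (realization R K) bary_point
  (map cell_polyhedron cells)).
- exact: (pair_at ([ffun=> 0] : {ffun 'I_(cdim (tag c)) -> R})).
- move=> P P' iP iP'; rewrite vertex_link_glueP //.
  have [cP sP] := inP _ iP; have [cP' sP'] := inP _ iP'.
  split=> [e|]; last exact: bary_point_inj.
  apply/ffunP => v; rewrite -!bary_point_barycentric //.
  by apply: eq_bigr => t _; rewrite e.
- by move=> P /inP[cP sP]; apply: bary_point_realization.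
- move=> c'; exists (fun u => bary_point (pair_at u)); split=> //.
  exact: bary_point_affine.
- move=> x /cell_cover[c' c'c xP]; exists (cell_polyhedron c') => //.
  exact: map_f.
- move=> _ /mapP[c' c'c ->]; exists c', (cell_coords c'); split; first exact: cell_coords_affine.
  move: c'c; rewrite mem_filter => /andP[/andP[/eqP c'z d0] _] x xK xP; split.
    split; last exact: cell_coords_simplex.
    by apply/same_vertexE; rewrite c'z.
  exact: bary_point_cell.
Qed.
End RealizedLinks.

(** * Assembling the manifold *)

Section AssembledManifold.
Local Open Scope ring_scope.
Import Order.TTheory GRing.Theory Num.Theory.
Variables (R : realType) (n k : nat) (Y : 'I_k -> scomplex).
Variable o : forall i : 'I_k, seq (vert (Y i)) -> bool.
Hypothesis n_gt0 : (0 < n)%N.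
Hypothesis Y_sphere : forall i : 'I_k, combinatorial_sphere R n (Y i).
Variables (FS : frame_system) (Q : finType) (vl : vtx_type FS -> 'I_k * Q).
Variable vn : forall i, vert (Y i) -> ground FS.
Variable rl : forall i, frame FS -> seq (vert (Y i)).
Variable fs : frame FS -> bool.
Arguments vn : clear implicits.
Arguments o : clear implicits.
Hypothesis vn_inj : forall i, injective (vn i).
Hypothesis rlP : forall x, (0 < dim x)%N ->
  facet_list (rl (vl (vtx x)).1 x) /\ size (rl (vl (vtx x)).1 x) = dim x.
Hypothesis levelE : forall x l, (l < dim x)%N ->
  level x l = [set vn _ v | v in [set v in take l.+1 (rl (vl (vtx x)).1 x)]].
Hypothesis rl_exists : forall (z : vtx_type FS) (r : seq (vert (Y (vl z).1))),
  facet_list r -> (0 < size r)%N -> exists x, [/\ vtx x = z, dim x = size r & rl (vl z).1 x = r].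
Hypothesis vl_inj : injective vl.
Hypothesis vl_exists : forall z, exists x : frame FS, vl (vtx x) = z.
Hypothesis fs_turn : forall l x, (l < dim x)%N -> fs (turn l x) = ~~ fs x.
Hypothesis fs_rl : forall x, (0 < dim x)%N -> fs x = o _ (rl (vl (vtx x)).1 x).
Hypothesis fs_levels : forall x y : frame FS, vtx x = vtx y -> dim x = dim y ->
  (forall l, (l < dim x)%N -> level x l = level y l) -> fs x = fs y.
Hypothesis fs_ridge : forall (x y : frame FS) e, vtx x = vtx y -> dim x = dim y ->
  (e < dim x)%N -> (forall l, (l < dim x)%N -> l != e -> level x l = level y l) ->
  level x e != level y e -> fs y = ~~ fs x.
Hypothesis Q_gt0 : (0 < #|Q|)%N.
Local Notation X := (complex_of R FS).

Lemma vertex_link_trans (c : corner X) : glue_trans (vertex_link c).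
Proof. by move=> p q r _ _ _; apply: eqv_pt_trans. Qed.

Lemma complex_manifold : combinatorial_manifold n X.
Proof.
move=> c; apply: PL_homeomorphic_trans (Y_sphere (vl (vtx (corner_frame c))).1).
- exact: vertex_link_trans.
- exact: single_trans.
- exact: (vertex_link_PL vn_inj rlP levelE rl_exists (z := vtx (corner_frame c)) (c := c)).
Qed.

(** The sign of the ordered facet at the corner, corrected by the parity of the order in which the
    edges are listed. *)
Definition complex_sgn : frame_sgn X :=
  fun c s => fs (corner_frame c) (+) inv_parity (map val s).

Lemma corner_frame_flip (i : cubes X) (v : {ffun 'I_(cdim i) -> bool}) (e : 'I_(cdim i)) :
  corner_frame (Tagged (fun i => {ffun 'I_(cdim i) -> bool}) (flip e v) : corner X) =
  turn e (corner_frame (Tagged (fun i => {ffun 'I_(cdim i) -> bool}) v : corner X)).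
Proof.
have et : (e < top FS)%N := leq_trans (ltn_ord e) (dim_le_top (i : frame FS)).
rewrite -turns1 // /corner_frame turnsD; apply: eq_turns => l _.
rewrite /corner_code /=; have [ld|dl] := ltnP l (cdim i); first by rewrite !ext_lt ffunE.
by rewrite !ext_out // addbF gtn_eqF // (leq_trans (ltn_ord e)).
Qed.

Lemma perm_val_enum d (s : seq 'I_d) : perm_eq s (enum 'I_d) -> perm_eq (map val s) (iota 0 d).
Proof. by move=> /(perm_map val); rewrite val_enum_ord. Qed.

Lemma mem_perm_val d (s : seq 'I_d) l : perm_eq s (enum 'I_d) -> (l \in map val s) = (l < d)%N.
Proof. by move/perm_val_enum/perm_mem ->; rewrite mem_iota. Qed.

Lemma perm_enum_uniq d (s : seq 'I_d) : perm_eq s (enum 'I_d) -> uniq s.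
Proof. by move/perm_uniq ->; apply: enum_uniq. Qed.

Lemma complex_orientation : cubic_orientation n complex_sgn.
Proof.
split.
- move=> c s1 a b s2 _ /perm_enum_uniq us; rewrite /complex_sgn !map_cat /=.
  rewrite inv_parity_swap ?addbN //; move: us.
  by rewrite cat_uniq cons_uniq in_cons negb_or => /and3P[_ _ /andP[/andP[ab _] _]].
- move=> i v e s _ _; rewrite /complex_sgn corner_frame_flip fs_turn ?addNb //.
  by rewrite dim_corner_frame.
- move=> c c' s s' cn c'n ps ps' /(frame_eqvE (perm_enum_uniq ps) (perm_enum_uniq ps'))[v ss lv].
  rewrite /complex_sgn ss; congr (_ (+) _); apply/esym/fs_levels => //.
    by rewrite !dim_corner_frame cn.
  by move=> l; rewrite dim_corner_frame => lc; apply: lv; rewrite mem_perm_val.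
move=> c c' e s e' s' cn c'n ps ps' nsub fe.
have /= /andP[es us] := perm_enum_uniq ps; have /= /andP[_ us'] := perm_enum_uniq ps'.
have [v ss lv] := frame_eqvE us us' fe.
(* Both frames list all [n] edges, so the edges left out of [s] and [s'] have the same index. *)
have ee : val e = val e'.
  have : perm_eq ([:: val e] ++ map val s) ([:: val e'] ++ map val s).
    have h : perm_eq (val e :: map val s) (iota 0 n).
      by rewrite -[n in iota 0 n]cn; apply: perm_val_enum ps.
    have h' : perm_eq (val e' :: map val s) (iota 0 n).
      by rewrite ss -[n in iota 0 n]c'n; apply: perm_val_enum ps'.
    by apply: perm_trans h _; rewrite perm_sym.
  by rewrite perm_cat2r => /perm_mem/(_ (val e)); rewrite !inE eqxx => /esym/eqP.
have lv' l : (l < cdim (tag c))%N -> l != val e ->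
    level (corner_frame c) l = level (corner_frame c') l.
  move=> lc le; apply: lv; have : l \in map val (e :: s) by rewrite mem_perm_val.
  by rewrite inE (negbTE le).
have dd : cdim (tag c) = cdim (tag c') by rewrite cn.
rewrite /complex_sgn /= ss ee (fs_ridge (x := corner_frame c) (e := val e)) ?addNb //.
- by rewrite !dim_corner_frame.
- by rewrite dim_corner_frame; apply: ltn_ord.
- by rewrite dim_corner_frame.
(* If the levels at the remaining edge agreed too, the first cell would lie in the second. *)
apply/eqP => lve; apply: nsub; apply: subcell_levels => // l lc.
by have [->|/lv' ->] := eqVneq l (val e).
Qed.

Lemma fs_ord_at (z : vtx_type FS) (c : corner X) : at_z z c -> (0 < cdim (tag c))%N ->
  fs (corner_frame c) = o _ (ord_at vl rl z c).
Proof.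
move=> cz c0; rewrite fs_rl ?dim_corner_frame // /ord_at.
by rewrite cz.
Qed.

Lemma complex_link_iso (c : corner X) :
  link_oriented_iso n complex_sgn c (sd_sgn (o (vl (vtx (corner_frame c))).1)).
Proof.
set z := vtx (corner_frame c).
have cz : at_z z c by [].
have atz (c' : corner X) : same_vertex c c' -> at_z z c' by move=> /same_vertexE e; rewrite /at_z -e.
have inP (P : pt (vertex_link c)) : in_space P -> at_z z (tag P) /\ simplex (tagged P).
  by case: P => c' u [/atz].
exists (@sd_point R k Y FS Q vl vn z); split.
- move=> P P' iP iP'; rewrite vertex_link_glueP //.
  have [cP sP] := inP _ iP; have [cP' sP'] := inP _ iP'.
  split=> [e|]; first by apply/ffunP => s; rewrite !ffunE e.
  exact: (sd_point_inj rlP levelE).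
- move=> y; split=> [/(sd_point_surj vn_inj rlP levelE rl_exists)[c' [u [c'z su <-]]]|].
    exists (Tagged (fun c : corner X => {ffun 'I_(cdim (tag c)) -> R}) u) => //.
    by split=> //; apply/same_vertexE; rewrite c'z.
  case=> -[c' u] /inP[/= c'z su] <-.
  exact: (sd_point_realization vn_inj rlP levelE).
move=> c' /atz c'z; have [phi phiE] := @flag_map_exists R k Y FS Q vl rl rlP z c' c'z.
exists phi; split.
- exact: (@flag_map_inj R k Y FS Q vl rl rlP z c' phi c'z phiE).
- exact: (@flag_map_chain R k Y FS Q vl rl z c' phi c'z phiE).
- by move=> u _; apply: (sd_pointE vn_inj levelE).
move=> c'n s ps; have c'0 : (0 < cdim (tag c'))%N by rewrite c'n.
have [fr sr] := @ord_atP R k Y FS Q vl rl rlP z c' c'z c'0.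
rewrite (@sd_sgn_flag _ _ (ord_at vl rl z c') (map val s)).
- by rewrite /complex_sgn (fs_ord_at c'z).
- by case/andP: fr.
- by rewrite sr; apply: perm_val_enum.
- by rewrite -!map_comp; apply: eq_map => l /=; rewrite phiE.
Qed.

Lemma assembled_manifold :
  exists (X : cubic_complex R) (w : frame_sgn X) (r : nat),
    [/\ combinatorial_manifold n X, cubic_orientation n w, (0 < r)%N &
        exists lab : corner X -> 'I_k * 'I_r,
          [/\ forall c c' : corner X, same_vertex c c' <-> lab c = lab c',
              forall p : 'I_k * 'I_r, exists c : corner X, lab c = p &
              forall c : corner X, link_oriented_iso n w c (sd_sgn (o (lab c).1))]].
Proof.
(* Over each sphere there is one vertex for each value in [Q], whence the number of copies. *)
exists X, complex_sgn, #|Q|; split=> //; [exact: complex_manifold|exact: complex_orientation|].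
exists (fun c => ((vl (vtx (corner_frame c))).1, enum_rank (vl (vtx (corner_frame c))).2)).
split=> [c c'|[i j]|c]; last exact: complex_link_iso.
- rewrite same_vertexE; split=> [->//|[e1 /enum_rank_inj e2]]; apply: vl_inj.
  by rewrite [LHS]surjective_pairing e1 e2 -surjective_pairing.
- have [x xz] := vl_exists (i, enum_val j).
  by exists (base_corner R x); rewrite corner_frame_base xz /= enum_valK.
Qed.
End AssembledManifold.

Theorem theorem1p2 (R : realType) (n k : nat) (Y : 'I_k -> scomplex)
    (o : forall i : 'I_k, seq (vert (Y i)) -> bool)
    (n_ge1 : (1 <= n)%N)
    (Y_sphere : forall i : 'I_k, combinatorial_sphere R n (Y i))
    (Y_oriented : forall i : 'I_k, orientation (o i))
    (Y_balanced : balanced o) :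
  exists (X : cubic_complex R) (w : frame_sgn X) (r : nat),
    [/\ combinatorial_manifold n X,
        cubic_orientation n w,
        (0 < r)%N &
        (* [lab] induces a bijection from the vertices of X to 'I_k * 'I_r *)
        exists lab : corner X -> 'I_k * 'I_r,
          [/\ forall c c' : corner X, same_vertex c c' <-> lab c = lab c',
              forall p : 'I_k * 'I_r, exists c : corner X, lab c = p &
              forall c : corner X,
                link_oriented_iso n w c (sd_sgn (o (lab c).1))]].
Proof.
have [F [Finv Fstar]] := numbered_star_exists Y_balanced.
pose FS := @flag_system k _ (@num_facet k Y) (num_sign o) (@owner_index k Y) F
  (@num_facet_owner k Y) (num_facet_swap Y_oriented) Fstar Finv (@num_facet_max k Y).
have head x : (0 < dim (x : frame FS))%N -> exists2 r,
    head_list (@num_facet k Y) x = map (@vnum k Y (place x).1) r & facet_list r.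
  by move=> x0; apply/num_facetP/head_list_fl.
(* A vertex of the flag system is by construction a sphere index with further data, so the map [vl]
   is the identity. *)
apply: (@assembled_manifold R n k Y o n_ge1 Y_sphere FS _ (fun z => z) (@vnum k Y)
  (fun i x => pulls i (head_list (@num_facet k Y) x))
  (@flag_sign k _ (@num_facet k Y) (num_sign o) (@owner_index k Y) F Finv)) => //.
- exact: vnum_inj.
- move=> x x0; have [r e fr] := head x x0; rewrite /= e pullsK; split=> //.
  by rewrite -(size_map (@vnum k Y (place x).1)) -e size_head_list.
- move=> x l lx; rewrite [LHS](flag_levelE lx).
  have [r e fr] := head x (leq_ltn_trans (leq0n l) lx); rewrite /= e pullsK.
  rewrite -map_take; apply/setP => v; rewrite inE.
  by apply/mapP/imsetP => -[u ur ->]; exists u => //; move: ur; rewrite inE.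
- move=> z r fr r0.
  (* The ordered facet is completed to a listing of all numbers, and a frame at [z] is placed
     there. *)
  have [t tr] := listing_prefix (s := map (@vnum k Y z.1) r)
    (etrans (map_inj_uniq (@vnum_inj k Y z.1) r) (proj1 (andP fr))).
  have [x [xz px]] := @flag_frame_exists k _ (@owner_index k Y) F Finv z t.
  have good_r : good (@num_facet k Y) (size r) (place x).
    rewrite px /good /= -(size_map (@vnum k Y z.1)) tr.
    by apply/num_facetP; exists r.
  have rm : (size r <= #|{: {i : 'I_k & vert (Y i)}}|.+1)%N.
    by rewrite -(size_map (@vnum k Y z.1)) -tr size_take_min size_listing geq_minr.
  have dx : place_dim (@num_facet k Y) x = size r by apply: flag_dimE; [exact: num_facet_max| |].
  exists x; split=> //.
  by rewrite /head_list dx px /= -(size_map (@vnum k Y z.1)) tr pullsK.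
- by move=> z; have [x [xz _]] := @flag_frame_exists k _ (@owner_index k Y) F Finv z 1%g; exists x.
- move=> l x; apply: flag_sign_turn => //; [exact: num_facet_owner|
    exact: num_facet_swap|exact: num_facet_max].
- move=> x y v d lv; rewrite /flag_sign (flag_vtx_place v); congr num_sign.
  exact: head_list_eq.
- move=> x y e; apply: flag_sign_ridge => //; [exact: num_facet_swap|exact: num_facet_ridge].
(* The data beyond the sphere index have at least one value because a family of reflections
   exists. *)
have [D _] := @block_family_inhabited k _ (@owner_index k Y) F Finv.
by apply/card_gt0P; exists (1%g, D, [ffun=> false]).
Qed.
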